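(* Let $K\subset\mathbb{R}^n$ and $L\subset\mathbb{R}^m$ be non-trivial closed convex cones, $G\in\mathbb{R}^{m\times n}$ a standard Gaussian matrix, and $G^{-1}L\equiv\{\mu\in\mathbb{R}^n:G\mu\in L\}$. There exists a universal constant $C>0$ such that for every $t\ge1$: (1) if $\sqrt{\delta(K)}-\sqrt{m-\delta(L)}\le -C\sqrt t$, then $\mathbb{P}\big(K\cap G^{-1}L=\{0\}\big)\ge1-e^{-t}$; (2) if $\sqrt{\delta(K)}-\sqrt{m-\delta(L)}\ge C\sqrt t$, then $\mathbb{P}\big(K\cap G^{-1}L\neq\{0\}\big)\ge1-e^{-t}$.
   Context: A standard Gaussian matrix has i.i.d. $\mathcal{N}(0,1)$ entries. A closed convex cone is non-trivial if it is not $\{0\}$. For a closed convex cone $K\subset\mathbb{R}^n$, $\delta(K)\equiv\mathbb{E}\|\Pi_K(g)\|^2$ with $g\sim\mathcal{N}(0,I_n)$, where $\Pi_K$ is the Euclidean metric projection onto $K$. *)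

(* Defs.v *)
From HB Require Import structures.
From mathcomp Require Import all_boot all_order all_algebra.
From mathcomp Require Import all_classical all_reals all_analysis.
From mathcomp Require Import Rstruct Rstruct_topology.
From Stdlib Require Import Rdefinitions.

Set Implicit Arguments.
Unset Strict Implicit.
Unset Printing Implicit Defensive.

Import Order.TTheory GRing.Theory Num.Theory.
Local Open Scope classical_set_scope.
Local Open Scope ring_scope.

Notation RR := Rdefinitions.R.

Definition sqnorm (n : nat) (x : 'cV[RR]_n) : RR := \sum_(i < n) (x i 0) ^+ 2.

(* Closed convex cone (containing 0, so the empty set is excluded). *)
Definition closed_convex_cone (n : nat) (K : set 'cV[RR]_n) : Prop :=
  [/\ K 0,
      closed K,
      (forall x (a : RR), K x -> 0 <= a -> K (a *: x)) &
      (forall x y (a : RR), K x -> K y -> 0 <= a <= 1 ->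
         K (a *: x + (1 - a) *: y))].

Definition nontrivial (n : nat) (K : set 'cV[RR]_n) : Prop := K <> [set 0].

Definition is_proj (n : nat) (K : set 'cV[RR]_n) (g p : 'cV[RR]_n) : Prop :=
  K p /\ forall q, K q -> sqnorm (g - p) <= sqnorm (g - q).

(* Euclidean metric projection Pi_K (well defined for nonempty closed convex K). *)
Definition proj (n : nat) (K : set 'cV[RR]_n) (g : 'cV[RR]_n) : 'cV[RR]_n :=
  xget 0 [set p | is_proj K g p].

(* Expectation of a nonnegative functional F of a family (x_i)_{i in I} of
   i.i.d. N(0,1) real random variables, written as an iterated Lebesgue
   integral against the standard normal law (equal to the integral against
   the product measure by Tonelli). *)
Fixpoint gauss_iter (I : finType) (s : seq I) (F : (I -> RR) -> \bar RR)
    (x : I -> RR) : \bar RR :=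
  match s with
  | [::] => F x
  | i :: s' => (\int[normal_prob (0 : RR) 1]_y
                  gauss_iter s' F (fun j => if j == i then y else x j))%E
  end.

Definition gauss_expect (I : finType) (F : (I -> RR) -> \bar RR) : \bar RR :=
  gauss_iter (enum I) F (fun _ => 0).

Definition gauss_vec_expect (n : nat) (f : 'cV[RR]_n -> \bar RR) : \bar RR :=
  gauss_expect (fun x : 'I_n * 'I_1 -> RR => f (\matrix_(i, j) x (i, j))).

Definition gauss_mx_prob (m n : nat) (E : set 'M[RR]_(m, n)) : \bar RR :=
  gauss_expect (fun x : 'I_m * 'I_n -> RR =>
                  ((\1_E : 'M[RR]_(m, n) -> RR) (\matrix_(i, j) x (i, j)))%:E).

Definition stat_dim (n : nat) (K : set 'cV[RR]_n) : \bar RR :=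
  gauss_vec_expect (fun g => (sqnorm (proj K g))%:E).

Definition preim_mx (m n : nat) (G : 'M[RR]_(m, n)) (L : set 'cV[RR]_m)
  : set 'cV[RR]_n := [set mu | L (G *m mu)].

(* Main.v *)
(* Cover the unit spheres of K and of the polar cone L° by finite nets (x_i) and
   (v_j).  If every x_i has some v_j with <v_j, G x_i> bounded below, then
   K ∩ G^{-1}L = {0}, and Gordon's min-max inequality bounds the probability that
   this fails by comparing the Gaussian family <v_j, G x_i> + gamma with
   <g, v_j> - <h, x_i>.  By Moreau's decomposition the
   mean squares of max_i <h, x_i> and max_j <g, v_j> are, up to the mesh, delta(K)
   and m - delta(L), and both maxima are concentrated, by the Maurey-Pisier
   rotation argument done with finitely many small rotations.

   Gordon's inequality is obtained without calculus.  A Gaussian law is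
   determined by its covariance, so moving the covariance a small step between
   two entries in different rows amounts to replacing two independent noises on
   these entries by a common one.  Along the two directions the event is a
   product of two monotone indicators of a line, whose up-sets are nested, and
   P(A)P(B) <= min(P(A), P(B)) gives the comparison.

   For the second part, the roles of (K, x) and (L°, v) are exchanged: if
   K ∩ G^{-1}L = {0} and moreover no nonzero z in L° satisfies <z, G x> >= 0 on K,
   then (x, y) |-> y - G x maps K x L onto R^m and sends only 0 to 0, so K and L
   are subspaces with dim K + dim L <= m, which the gap excludes. *)
Require Import Defs.
From HB Require Import structures.
From mathcomp Require Import all_boot all_order all_algebra.
From mathcomp Require Import all_classical all_reals all_analysis.
From mathcomp Require Import Rstruct Rstruct_topology measurable_realfun ring lra.
Import Order.TTheory GRing.Theory Num.Theory.
Import numFieldNormedType.Exports.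
Local Open Scope classical_set_scope.
Local Open Scope ring_scope.

Set Implicit Arguments.
Unset Strict Implicit.
Unset Printing Implicit Defensive.

(** No union bound over the nets is ever taken, so the mesh may depend on m, n and even t. On the
    event that the squared Frobenius norm of G is at most some rho of order m n e^t, a mesh small
    against rho^(-1/2) carries statements from the nets to the cones; Markov's inequality bounds the
    complement by e^(-t)/2. The variable gamma equalizes variances. For unit vectors with a = <x_i,
    x_k> and b = <v_j, v_l>, the two covariances are a b + 1 and a + b; their difference (1 - a)(1 -
    b) is nonnegative, and it vanishes within a row, where a = 1. The events of the theorem and the
    squared norm of the projection come without any measurability. They are only compared with
    measurable functions above or below them, which monotonicity of the integral allows. The
    constant is 19 = 18 + 1: the 1 pays for the mesh, and the 18 pays for two Chernoff exponents,
    for the distance 7 between mean and root mean square of a maximum, and for the numerical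
    factors. *)

Notation gauss R := (normal_prob (0 : R) 1).

(** * Gaussian integrals and Gaussian sums *)

Lemma gauss_integral_pdf (R : realType) (f : R -> \bar R) :
  measurable_fun [set: R] f -> (forall x, 0 <= f x)%E ->
  (\int[gauss R]_x f x =
   \int[lebesgue_measure]_x (f x * (normal_pdf 0 1 x)%:E))%E.
Proof.
move=> mf f0.
have dom := normal_prob_dominates (0 : R) 1.
rewrite -(Radon_Nikodym_SigmaFinite.change_of_variables dom)//.
apply: ae_eq_integral => //.
- apply: emeasurable_funM => //; apply: (measurable_int lebesgue_measure).
  exact: Radon_Nikodym_SigmaFinite.f_integrable.
- apply: emeasurable_funM => //=; apply/measurable_EFinP.
  exact: measurable_normal_pdf.
- apply: ae_eqe_mul2l => /=.
  apply: integral_ae_eq => //=.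
  + exact: Radon_Nikodym_SigmaFinite.f_integrable.
  + by apply/measurable_EFinP; exact: measurable_normal_pdf.
  + by move=> E _ mE; rewrite -Radon_Nikodym_SigmaFinite.f_integral.
Qed.

Lemma measurable_addr (R : realType) (a : R) :
  measurable_fun [set: R] (fun x : R => x + a).
Proof. exact: measurable_funD. Qed.

Lemma lebesgue_measureD (R : realType) (a : R) (A : set R) : measurable A ->
  pushforward lebesgue_measure ((fun x => x + a) : _ -> measurableTypeR R) A
  = lebesgue_measure A.
Proof.
move=> mA; apply/esym/lebesgue_measure_unique => //=.
  exact: measurable_funD.
move=> ma _ [[b c]] _ <-.
rewrite /pushforward (_ : _ @^-1` _ = `]b - a, c - a]%classic).
  rewrite !lebesgue_measure_itv/= !lte_fin ltrD2r.
  by case: ifP => // _; rewrite -!EFinD; congr EFin; lra.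
by apply/seteqP; split => x /=; rewrite !in_itv/= ltrBlDr lerBrDr.
Qed.

Lemma ge0_integral_translation (R : realType) (a : R) (f : R -> \bar R) :
  measurable_fun [set: R] f -> (forall x, 0 <= f x)%E ->
  (\int[lebesgue_measure]_x f (x + a)%R = \int[lebesgue_measure]_x f x)%E.
Proof.
move=> mf f0.
pose T : measurableTypeR R -> measurableTypeR R := fun x => (x + a)%R.
have mT : measurable_fun [set: R] T by exact: measurable_addr.
transitivity (\int[pushforward lebesgue_measure T]_x f x)%E.
  by rewrite ge0_integral_pushforward//= preimage_setT.
by apply: eq_measure_integral => A mA _; exact: lebesgue_measureD.
Qed.

Lemma measurable_pair_lin (R : realType) (a b : R) :
  measurable_fun [set: R * R] (fun p : R * R => a * p.1 + b * p.2).
Proof.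
apply: measurable_funD; apply: measurable_funM => //=.
Qed.

Section shears.
Context {R : realType}.
Local Notation mu := (@lebesgue_measure R).
Variable h : R * R -> \bar R.
Hypothesis mh : measurable_fun [set: R * R] h.
Hypothesis h0 : forall p, (0 <= h p)%E.

Lemma integral_shear2 (b : R) :
  (\int[mu]_y \int[mu]_z h (y, z + b * y)%R = \int[mu]_y \int[mu]_z h (y, z))%E.
Proof.
apply: eq_integral => y _.
apply: (@ge0_integral_translation _ _ (fun z => h (y, z))) => //.
exact: measurableT_comp.
Qed.

Lemma integral_shear1 (b : R) :
  (\int[mu]_y \int[mu]_z h (y + b * z, z)%R = \int[mu]_y \int[mu]_z h (y, z))%E.
Proof.
have ms : measurable_fun [set: R * R] (fun p : R * R => h (p.1 + b * p.2, p.2)%R).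
  apply: measurableT_comp => //=; apply: measurable_fun_pair => //=.
  have := measurable_pair_lin 1 b; apply: eq_measurable_fun => p _ /=.
  by rewrite mul1r.
transitivity (\int[mu]_z \int[mu]_y h (y + b * z, z)%R)%E.
  by apply: (fubini_tonelli (m1 := mu) (m2 := mu) _ ms) => p; exact: h0.
transitivity (\int[mu]_z \int[mu]_y h (y, z))%E; last first.
  by apply/esym; exact: (fubini_tonelli (m1 := mu) (m2 := mu) _ mh).
apply: eq_integral => z _.
apply: (@ge0_integral_translation _ _ (fun y => h (y, z))) => //.
exact: measurableT_comp.
Qed.

End shears.

Lemma measurable_lin2 (R : realType) (a b c d : R) :
  measurable_fun [set: R * R]
    (fun p : R * R => (a * p.1 + b * p.2, c * p.1 + d * p.2)).
Proof. by apply: measurable_fun_pair; exact: measurable_pair_lin. Qed.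

(* A rotation of angle other than pi is a product of three shears. *)
Lemma integral_rotation (R : realType) (h : R * R -> \bar R) (c s : R) :
  measurable_fun [set: R * R] h -> (forall p, 0 <= h p)%E ->
  c ^+ 2 + s ^+ 2 = 1 -> c != -1 ->
  (\int[lebesgue_measure]_y \int[lebesgue_measure]_z
      h (c * y - s * z, s * y + c * z)%R =
   \int[lebesgue_measure]_y \int[lebesgue_measure]_z h (y, z))%E.
Proof.
move=> mh h0 cs1 cN1.
have c1 : 1 + c != 0 by apply: contra cN1 => /eqP c1; apply/eqP; lra.
(* The tangent of the half angle: the rotation is the shear by [- t], then the shear by [s] in the
   other variable, then the shear by [- t] again. *)
pose t := s / (1 + c).
have tc : t * (1 + c) = s by rewrite /t divfK.
have ts : t * s = 1 - c.
  by apply: (mulfI c1); rewrite mulrA [(1 + c) * t]mulrC tc; lra.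
pose h1 (p : R * R) := h (p.1 - t * p.2, p.2).
have mh1 : measurable_fun [set: R * R] h1.
  apply: measurableT_comp => //=.
  have := @measurable_lin2 R 1 (- t) 0 1; apply: eq_measurable_fun => p _ /=.
  by congr (_, _); ring.
pose h2 (p : R * R) := h1 (p.1, p.2 + s * p.1).
have mh2 : measurable_fun [set: R * R] h2.
  apply: measurableT_comp => //=.
  have := @measurable_lin2 R 1 0 s 1; apply: eq_measurable_fun => p _ /=.
  by congr (_, _); ring.
rewrite -(integral_shear1 mh h0 (- t)).
transitivity (\int[lebesgue_measure]_y \int[lebesgue_measure]_z h1 (y, z))%E; last first.
  by apply: eq_integral => y _; apply: eq_integral => z _; rewrite /h1 /= mulNr.
apply: etrans (integral_shear2 mh1 (fun p => h0 _) s).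
transitivity (\int[lebesgue_measure]_y \int[lebesgue_measure]_z h2 (y, z))%E; last first.
  by apply: eq_integral => y _; apply: eq_integral => z _.
rewrite -(integral_shear1 mh2 _ (- t)); last by move=> p; exact: h0.
apply: eq_integral => y _; apply: eq_integral => z _.
rewrite /h2 /h1 /=; congr h; congr (_, _).
  transitivity ((1 - t * s) * y - (t * (1 + c) + t * (1 - c - t * s)) * z).
    rewrite tc ts; ring.
  ring.
transitivity (s * y + (1 - t * s) * z); first by rewrite ts; ring.
ring.
Qed.

Lemma gauss_integral2_pdf (R : realType) (f : R * R -> \bar R) :
  measurable_fun [set: R * R] f -> (forall x, 0 <= f x)%E ->
  (\int[gauss R]_y \int[gauss R]_z f (y, z) =
   \int[lebesgue_measure]_y \int[lebesgue_measure]_z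
     (f (y, z) * (normal_pdf 0 1 y * normal_pdf 0 1 z)%:E))%E.
Proof.
move=> mf f0.
rewrite gauss_integral_pdf; last 2 first.
- exact: (measurable_fun_fubini_tonelli_F (m2 := gauss R)).
- by move=> x; exact: integral_ge0.
apply: eq_integral => y _.
rewrite gauss_integral_pdf//; last exact: measurableT_comp.
rewrite -ge0_integralZr//=.
- by apply: eq_integral => z _; rewrite -muleA -EFinM [(_ * _)%R in RHS]mulrC.
- apply: emeasurable_funM; first exact: measurableT_comp.
  by apply/measurable_EFinP; exact: measurable_normal_pdf.
- by move=> z _; apply: mule_ge0; rewrite ?lee_fin ?normal_pdf_ge0.
- by rewrite lee_fin normal_pdf_ge0.
Qed.

Lemma normal_pdf_rotation (R : realType) (c s y z : R) :
  c ^+ 2 + s ^+ 2 = 1 ->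
  normal_pdf 0 1 (c * y - s * z) * normal_pdf 0 1 (s * y + c * z) =
  normal_pdf 0 1 y * normal_pdf 0 1 z.
Proof.
move=> cs1.
rewrite !normal_pdfE ?oner_eq0// /normal_fun !subr0.
rewrite mulrACA [RHS]mulrACA -!exp.expRD; congr (_ * expR _).
rewrite -!mulrDl; congr (_ / _).
transitivity (- ((c ^+ 2 + s ^+ 2) * (y ^+ 2 + z ^+ 2))); first by ring.
by rewrite cs1; ring.
Qed.

Lemma gauss_rotation (R : realType) (f : R * R -> \bar R) (c s : R) :
  measurable_fun [set: R * R] f -> (forall p, 0 <= f p)%E ->
  c ^+ 2 + s ^+ 2 = 1 ->
  (\int[gauss R]_y \int[gauss R]_z f (c * y - s * z, s * y + c * z)%R =
   \int[gauss R]_y \int[gauss R]_z f (y, z))%E.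
Proof.
wlog cN1 : c s f / c != -1 => [hwlog|] mf f0 cs1.
  have [cN1|] := eqVneq c (-1); last by move=> ?; exact: hwlog.
  have s0 : s = 0.
    by apply/eqP; rewrite -sqrf_eq0; apply/eqP; rewrite cN1 in cs1; lra.
  (* The half turn, which the three shears miss, is a quarter turn done twice. *)
  have h01 : (0 : R) != -1 by apply/eqP; lra.
  have e01 : (0 : R) ^+ 2 + 1 ^+ 2 = 1 by ring.
  pose f1 (p : R * R) := f (0 * p.1 - 1 * p.2, 1 * p.1 + 0 * p.2).
  have mf1 : measurable_fun [set: R * R] f1.
    apply: measurableT_comp => //=.
    have := @measurable_lin2 R 0 (-1) 1 0; apply: eq_measurable_fun => p _ /=.
    by congr (_, _); ring.
  apply: etrans (hwlog 0 1 f h01 mf f0 e01).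
  apply: etrans (hwlog 0 1 f1 h01 mf1 (fun p => f0 _) e01).
  apply: eq_integral => y _; apply: eq_integral => z _.
  by rewrite /f1 /= cN1 s0; congr f; congr (_, _); ring.
pose k (p : R * R) := (normal_pdf 0 1 p.1 * normal_pdf 0 1 p.2)%R.
have mk : measurable_fun [set: R * R] k.
  by apply: measurable_funM; apply: measurableT_comp => //; exact: measurable_normal_pdf.
have mrot : measurable_fun [set: R * R]
    (fun p : R * R => (c * p.1 - s * p.2, s * p.1 + c * p.2)).
  have := @measurable_lin2 R c (- s) s c; apply: eq_measurable_fun => p _ /=.
  by congr (_, _); ring.
rewrite (gauss_integral2_pdf (f := fun p => f (c * p.1 - s * p.2, s * p.1 + c * p.2)%R))//; last first.
  exact: (measurableT_comp mf mrot).
rewrite [RHS](gauss_integral2_pdf mf f0).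
rewrite -(integral_rotation (h := fun p => (f p * (k p)%:E)%E) _ _ cs1 cN1).
- apply: eq_integral => y _; apply: eq_integral => z _.
  by rewrite /k /= normal_pdf_rotation.
- by apply: emeasurable_funM => //; exact/measurable_EFinP.
- move=> p; apply: mule_ge0 => //; rewrite lee_fin /k.
  by apply: mulr_ge0; exact: normal_pdf_ge0.
Qed.

(* No measurability is needed here: the integral of a nonnegative function is
   a supremum over the simple functions below it. *)
Lemma ge0_integral_mono d (T : measurableType d) (R : realType)
    (mu : {measure set T -> \bar R}) (f g : T -> \bar R) :
  (forall x, 0 <= f x)%E -> (forall x, f x <= g x)%E ->
  (\int[mu]_x f x <= \int[mu]_x g x)%E.
Proof.
move=> f0 fg; rewrite !ge0_integralTE//; last by move=> x; exact: le_trans (fg x).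
apply: le_ereal_sup => _ [h hf <-]; exists h => // x.
exact: le_trans (hf x) (fg x).
Qed.

Section gaussian_operators.
Context {R : realType}.
Implicit Types V : lmodType R.

Definition gsm1 V (c : V) (F : V -> \bar R) (w : V) : \bar R :=
  (\int[gauss R]_y F (w + y *: c)%R)%E.

(* [gsm cs F w] is the expectation of [F (w + \sum_k xi_k c_k)], where the
   [xi_k] are independent standard normal variables and the [c_k] are the
   elements of [cs]. *)
Definition gsm V (cs : seq V) (F : V -> \bar R) : V -> \bar R :=
  foldr (@gsm1 V) F cs.

(* [V] carries no sigma-algebra, so measurability is required along every
   finite-dimensional affine subspace. *)
Definition gmeas V d (T : measurableType d) (F : V -> T) : Prop :=
  forall k (w : V) (c : 'I_k -> V),
    measurable_fun [set: k.-tuple (measurableTypeR R)]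
      (fun y => F (w + \sum_(i < k) tnth y i *: c i)).

Definition gfun V (F : V -> \bar R) : Prop :=
  gmeas F /\ (forall w, 0 <= F w)%E.

Lemma gmeasP V d (T : measurableType d) (F : V -> T) d' (X : measurableType d')
    k (f : 'I_k -> X -> R) (w : V) (c : 'I_k -> V) :
  gmeas F -> (forall i, measurable_fun [set: X] (f i)) ->
  measurable_fun [set: X] (fun t => F (w + \sum_(i < k) f i t *: c i)).
Proof.
move=> mF mf.
pose g (t : X) : k.-tuple (measurableTypeR R) := [tuple f i t | i < k].
have mg : measurable_fun [set: X] g.
  apply/measurable_fun_tnthP => i; have := mf i; apply: eq_measurable_fun => t _.
  by rewrite /g /= tnth_mktuple.
have := measurableT_comp (mF k w c) mg; apply: eq_measurable_fun => t _ /=.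
by congr (F (_ + _)); apply: eq_bigr => i _; rewrite tnth_mktuple.
Qed.

Lemma gmeas_line V d (T : measurableType d) (F : V -> T) (w c : V) :
  gmeas F -> measurable_fun [set: R] (fun y : R => F (w + y *: c)).
Proof.
move=> mF; have := @gmeasP V d T F _ R 1 (fun _ y => y) w (fun _ => c) mF.
move/(_ (fun=> @measurable_id _ _ _)); apply: eq_measurable_fun => y _.
by rewrite big_ord1.
Qed.

Lemma gmeas_plane V d (T : measurableType d) (F : V -> T) (w a b : V) :
  gmeas F -> measurable_fun [set: R * R]
    (fun p : R * R => F (w + p.1 *: a + p.2 *: b)).
Proof.
move=> mF; have := @gmeasP V d T F _ (R * R)%type 2
  (fun i p => if val i == 0%N then p.1 else p.2) w
  (fun i => if val i == 0%N then a else b) mF.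
move=> h; apply: eq_measurable_fun (h _) => [p _|]; last by case => -[|[|]] //= _; [exact: measurable_fst | exact: measurable_snd].
by rewrite !big_ord_recl big_ord0 /= addr0 addrA.
Qed.

Lemma gmeas_gsm1 V (c : V) F : gfun F -> gmeas (gsm1 c F).
Proof.
move=> [mF F0] k w b.
apply: (measurable_fun_fubini_tonelli_F (m2 := gauss R)
  (fun p : k.-tuple (measurableTypeR R) * R =>
     F (w + \sum_(i < k) tnth p.1 i *: b i + p.2 *: c))) => //.
(* The integration variable is treated as one more coordinate, with column [c] at the last index. *)
have := @gmeasP V _ _ F _ (k.-tuple (measurableTypeR R) * R)%type k.+1
  (fun i p => if unlift ord_max i is Some j then tnth p.1 j else p.2) w
  (fun i => if unlift ord_max i is Some j then b j else c) mF.
move=> h; apply: eq_measurable_fun (h _) => [p _|]; last first.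
  move=> i; case: unliftP => [j _|_]; last exact: measurable_snd.
  by apply: (measurableT_comp (measurable_tnth j)).
rewrite big_ord_recr /= unlift_none addrA; congr (F (_ + _ + _)).
apply: eq_bigr => i _.
by rewrite (_ : widen_ord _ i = lift ord_max i) ?liftK//; apply/val_inj; rewrite /= /bump leqNgt ltn_ord.
Qed.

Lemma gfun_gsm1 V (c : V) F : gfun F -> gfun (gsm1 c F).
Proof.
move=> gF; split; first exact: gmeas_gsm1.
by move=> w; apply: integral_ge0 => y _; exact: gF.2.
Qed.

Lemma gfun_gsm V (cs : seq V) F : gfun F -> gfun (gsm cs F).
Proof. by move=> gF; elim: cs => //= c cs IH; exact: gfun_gsm1. Qed.

Lemma gsm_ge0 V (cs : seq V) F w : (forall w, 0 <= F w)%E -> (0 <= gsm cs F w)%E.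
Proof.
move=> F0; elim: cs w => //= c cs IH w.
by apply: integral_ge0 => y _; exact: IH.
Qed.

Lemma gsm_cat V (cs ds : seq V) F : gsm (cs ++ ds) F = gsm cs (gsm ds F).
Proof. exact: foldr_cat. Qed.

(** Rotation invariance of two independent normal variables, read on the columns. Every later change
    of columns reduces to this one. *)
Lemma gsm1_rotation V (a b : V) F (c s : R) : gfun F -> c ^+ 2 + s ^+ 2 = 1 ->
  gsm1 (c *: a + s *: b) (gsm1 (- s *: a + c *: b) F) = gsm1 a (gsm1 b F).
Proof.
move=> [mF F0] cs1; apply/funext => w.
rewrite /gsm1 -(gauss_rotation (f := fun p => F (w + p.1 *: a + p.2 *: b)) _ _ cs1)//.
  apply: eq_integral => y _; apply: eq_integral => z _ /=.
  congr F; rewrite -!addrA; congr (w + _).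
  rewrite !scalerDr !scalerA addrACA -!scalerDl.
  by congr (_ *: _ + _ *: _); ring.
exact: gmeas_plane.
Qed.

Lemma gsm1_0 V F : gsm1 (0 : V) F = F.
Proof.
apply/funext => w; rewrite /gsm1.
under eq_integral do rewrite scaler0 addr0.
by rewrite integral_cst//= probability_setT mule1.
Qed.

Lemma gsm1N V (a : V) F : gfun F -> gsm1 (- a) F = gsm1 a F.
Proof.
move=> gF; rewrite -[in RHS](gsm1_0 F).
rewrite -(@gsm1_rotation V a 0 F (-1) 0)//; last by ring.
by rewrite !scaler0 !scaleN1r oppr0 scale0r !addr0 gsm1_0.
Qed.

Lemma gsm1_le V (c : V) F G w : (forall w, 0 <= F w)%E ->
  (forall w, F w <= G w)%E -> (gsm1 c F w <= gsm1 c G w)%E.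
Proof.
by move=> F0 FG; exact: ge0_integral_mono.
Qed.

Lemma gsm_le V (cs : seq V) F G w : (forall w, 0 <= F w)%E ->
  (forall w, F w <= G w)%E -> (gsm cs F w <= gsm cs G w)%E.
Proof.
move=> F0 FG; elim: cs w => //= c cs IH w.
by apply: gsm1_le => // {}w; exact: gsm_ge0.
Qed.

Lemma gsmD V (cs : seq V) F G w : gfun F -> gfun G ->
  gsm cs (fun w => F w + G w)%E w = (gsm cs F w + gsm cs G w)%E.
Proof.
move=> gF gG; elim: cs w => //= c cs IH w.
have gF1 := gfun_gsm cs gF; have gG1 := gfun_gsm cs gG.
rewrite /gsm1; under eq_integral do rewrite IH.
rewrite ge0_integralD//.
- by move=> y _; exact: gF1.2.
- exact: gmeas_line gF1.1.
- by move=> y _; exact: gG1.2.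
- exact: gmeas_line gG1.1.
Qed.

Lemma gsmZl V (cs : seq V) F w (k : R) : gfun F -> 0 <= k ->
  gsm cs (fun w => k%:E * F w)%E w = (k%:E * gsm cs F w)%E.
Proof.
move=> gF k0; elim: cs w => //= c cs IH w.
have gF1 := gfun_gsm cs gF.
rewrite /gsm1; under eq_integral do rewrite IH.
rewrite ge0_integralZl//.
- exact: gmeas_line gF1.1.
- by move=> y _; exact: gF1.2.
Qed.

Lemma gsm_cst V (cs : seq V) w (k : \bar R) : gsm cs (fun _ => k) w = k.
Proof.
elim: cs w => //= c cs IH w.
rewrite /gsm1; under eq_integral do rewrite IH.
by rewrite integral_cst//= probability_setT mule1.
Qed.

Lemma gsm_linear V (W : lmodType R) (M : {linear V -> W}) (cs : seq V) F w :
  gsm cs (F \o M) w = gsm (map M cs) F (M w).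
Proof.
elim: cs w => //= c cs IH w; rewrite /gsm1; apply: eq_integral => y _.
by rewrite IH linearD linearZ.
Qed.

Lemma gmeas_linear V (W : lmodType R) (M : {linear V -> W}) d (T : measurableType d)
  (F : W -> T) : gmeas F -> gmeas (F \o M).
Proof.
move=> mF k w c; have := mF k (M w) (M \o c); apply: eq_measurable_fun => y _ /=.
by rewrite linearD linear_sum; congr (F (_ + _)); apply: eq_bigr => i _; rewrite linearZ.
Qed.

Lemma gfun_linear V (W : lmodType R) (M : {linear V -> W}) F : gfun F -> gfun (F \o M).
Proof. by case=> mF F0; split => [|w]; [exact: gmeas_linear | exact: F0]. Qed.

Lemma gmeas_comp V d (T : measurableType d) d' (U : measurableType d')
    (f : T -> U) (F : V -> T) :
  measurable_fun [set: T] f -> gmeas F -> gmeas (f \o F).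
Proof. by move=> mf mF k w c; exact: measurableT_comp mf (mF k w c). Qed.

Lemma gmeas_cst V d (T : measurableType d) (x : T) : gmeas (fun _ : V => x).
Proof. by move=> k w c; exact: measurable_cst. Qed.

Lemma gmeas_form V (l : {scalar V}) : gmeas (fun w => l w : R).
Proof.
move=> k w c; rewrite (_ : (fun y => _) = fun y : k.-tuple (measurableTypeR R) =>
  l w + \sum_(i < k) tnth y i * l (c i)).
  apply: measurable_funD => //; apply: measurable_sum => i.
  by apply: measurable_funM => //; exact: measurable_tnth.
apply/funext => y; rewrite linearD linear_sum; congr (_ + _).
by apply: eq_bigr => i _; rewrite linearZ.
Qed.

Lemma gmeasD V (F G : V -> R) : gmeas F -> gmeas G -> gmeas (fun w => F w + G w).
Proof. by move=> mF mG k w c; exact: measurable_funD (mF k w c) (mG k w c). Qed.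

Lemma gmeasM V (F G : V -> R) : gmeas F -> gmeas G -> gmeas (fun w => F w * G w).
Proof. by move=> mF mG k w c; exact: measurable_funM (mF k w c) (mG k w c). Qed.

Lemma gmeas_max V (F G : V -> R) : gmeas F -> gmeas G ->
  gmeas (fun w => Num.max (F w) (G w)).
Proof. by move=> mF mG k w c; exact: measurable_maxr (mF k w c) (mG k w c). Qed.

Lemma gfun_EFin V (F : V -> R) : gmeas F -> (forall w, 0 <= F w) ->
  gfun (fun w => (F w)%:E).
Proof.
move=> mF F0; split; last by move=> w; rewrite lee_fin.
by move=> k w c; apply/measurable_EFinP; exact: mF.
Qed.

End gaussian_operators.

Lemma lebesgue_integralZl (R : realType) (k : R) (f : R -> \bar R) :
  measurable_fun [set: R] f -> (forall x, 0 <= f x)%E -> 0 <= k ->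
  (\int[lebesgue_measure]_y (k%:E * f y) =
   k%:E * \int[lebesgue_measure]_y f y)%E.
Proof. by move=> mf f0 k0; exact: ge0_integralZl_EFin. Qed.

(** Completing the square turns the tilted density into a multiple of the density translated by
    [l]. *)
Lemma gauss_mgf (R : realType) (a l : R) :
  (\int[gauss R]_y (expR (a + l * y))%:E = (expR (a + l ^+ 2 / 2))%:E)%E.
Proof.
have me : measurable_fun [set: R] (fun y : R => expR (a + l * y)).
  apply: measurableT_comp => //; apply: measurable_funD => //.
rewrite gauss_integral_pdf; last 2 first.
- exact/measurable_EFinP.
- by move=> y; rewrite lee_fin expR_ge0.
pose f (y : R) := (normal_pdf 0 1 y)%:E.
have mf : measurable_fun [set: R] f.
  by apply/measurable_EFinP; exact: measurable_normal_pdf.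
have f0 y : (0 <= f y)%E by rewrite lee_fin normal_pdf_ge0.
transitivity (\int[lebesgue_measure]_y
    ((expR (a + l ^+ 2 / 2))%:E * f (y + - l)%R))%E.
  apply: eq_integral => y _; rewrite /f -!EFinM; congr EFin.
  rewrite !normal_pdfE ?oner_eq0// /normal_fun !subr0 mulrCA [RHS]mulrCA.
  congr (_ * _); rewrite -!exp.expRD; congr expR; by field; rewrite ?oner_eq0 ?pnatr_eq0.
transitivity ((expR (a + l ^+ 2 / 2))%:E *
    \int[lebesgue_measure]_y f (y + - l)%R)%E.
  apply: (@lebesgue_integralZl _ _ (fun y => f (y + - l)%R)); rewrite ?expR_ge0//.
  exact: (measurableT_comp mf (measurable_addr (- l))).
rewrite (@ge0_integral_translation _ _ f)// /f integral_normal_pdf.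
by rewrite mule1.
Qed.

Lemma gauss_sym (R : realType) (f : R -> \bar R) :
  measurable_fun [set: R] f -> (forall x, 0 <= f x)%E ->
  (\int[gauss R]_y f (- y)%R = \int[gauss R]_y f y)%E.
Proof.
move=> mf f0.
have e : (-1 : R) ^+ 2 + 0 ^+ 2 = 1 by ring.
have := gauss_rotation (f := fun p => f p.1) _ _ e => /(_ _ _)/= H.
have K (h : R -> \bar R) : (\int[gauss R]_y \int[gauss R]_z h y = \int[gauss R]_y h y)%E.
  apply: eq_integral => y _.
  by rewrite integral_cst//= probability_setT mule1.
rewrite -[RHS]K -H//; last exact: measurableT_comp.
rewrite -[LHS]K; apply: eq_integral => y _; apply: eq_integral => z _.
by congr f; ring.
Qed.

(** The half-lines [y <= 0] and [- y <= 0] cover the line and have equal mass by symmetry. *)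
Lemma gauss_half (R : realType) :
  ((2^-1)%:E <= \int[gauss R]_y (if (y <= 0)%R then 1 else 0))%E.
Proof.
pose f (y : R) : \bar R := (if (y <= 0)%R then 1 else 0)%E.
have mf : measurable_fun [set: R] f.
  by apply: measurable_fun_ifT => //; exact: measurable_fun_ler.
have f0 y : (0 <= f y)%E by rewrite /f; case: ifP.
have fs := gauss_sym mf f0.
have mfN : measurable_fun [set: R] (fun y : R => f (- y)).
  exact: (measurableT_comp mf (@oppr_measurable R _)).
have h : (1 <= \int[gauss R]_y f y + \int[gauss R]_y f y)%E.
  rewrite -{1}fs -ge0_integralD//.
  have {1}-> : (1 = \int[gauss R]_y 1)%E.
    by rewrite integral_cst//= probability_setT mule1.
  apply: ge0_integral_mono => // y.
  rewrite /f oppr_le0; case: (leP y 0) => y0.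
    by case: ifP => _; rewrite ?adde0 ?add0e// leeDl.
  by rewrite (ltW y0) adde0.
rewrite -/(f) in h *; move: h; case: (\int[gauss R]_y f y)%E => [r| |] //=.
by rewrite -EFinD !lee_fin => h; lra.
by move=> _; rewrite leey.
Qed.

(** The integrand times the standard density is [q] times the density of standard deviation [q]. *)
Lemma gauss_exp_sqr (R : realType) (q : R) : 0 < q ->
  (\int[gauss R]_y (expR ((1 - q ^- 2) * y ^+ 2 / 2))%:E = q%:E)%E.
Proof.
move=> q0.
rewrite gauss_integral_pdf; last 2 first.
- apply/measurable_EFinP; apply: measurableT_comp => //.
  by apply: measurable_funM => //; apply: measurable_funM => //; exact: measurable_funX.
- by move=> y; rewrite lee_fin expR_ge0.
transitivity (\int[lebesgue_measure]_y (q%:E * (normal_pdf 0 q y)%:E))%E.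
  apply: eq_integral => y _; rewrite -!EFinM; congr EFin.
  rewrite !normal_pdfE ?oner_eq0 ?gt_eqF// /normal_fun !subr0 [LHS]mulrCA -exp.expRD [RHS]mulrA.
  congr (_ * expR _); last by field; rewrite gt_eqF.
  rewrite /normal_peak expr1n mul1r -mulrnAr sqrtrM ?sqr_ge0// sqrtr_sqr gtr0_norm//.
  by rewrite invfM mulrA divff ?gt_eqF// mul1r.
transitivity (q%:E * \int[lebesgue_measure]_y (normal_pdf 0 q y)%:E)%E.
  apply: lebesgue_integralZl; last exact: ltW.
  - by apply/measurable_EFinP; exact: measurable_normal_pdf.
  - by move=> y; rewrite lee_fin normal_pdf_ge0.
by rewrite integral_normal_pdf mule1.
Qed.

(* Comparing [1 + x] with [expR x] under the Gaussian integral, for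
   [x = (1 - q^-2) y^2 / 2] and [q] on both sides of [1], pins the second
   moment without integrating by parts. *)
Lemma gauss_sqr (R : realType) : (\int[gauss R]_y (y ^+ 2)%:E = 1)%E.
Proof.
have me (q : R) : measurable_fun [set: R] (fun y : R => (expR ((1 - q ^- 2) * y ^+ 2 / 2))%:E).
  apply/measurable_EFinP; apply: measurableT_comp => //.
  by apply: measurable_funM => //; apply: measurable_funM => //; exact: measurable_funX.
have m2 (k : R) : measurable_fun [set: R] (fun y : R => (k%:E * (y ^+ 2)%:E)%E).
  by apply/measurable_EFinP; apply: measurable_funM => //; exact: measurable_funX.
have m1 : measurable_fun [set: R] (fun y : R => ((y ^+ 2)%:E)%E).
  by apply/measurable_EFinP; exact: measurable_funX.
have i1 : (\int[gauss R]_y 1 = 1)%E.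
  by rewrite integral_cst//= probability_setT mule1.
set v := (\int[gauss R]_y (y ^+ 2)%:E)%E.
have v0 : (0 <= v)%E by apply: integral_ge0 => y _; rewrite lee_fin sqr_ge0.
have hZ (k : R) : 0 <= k -> (k%:E * v = \int[gauss R]_y (k%:E * (y ^+ 2)%:E))%E.
  move=> k0; apply/esym; apply: ge0_integralZl_EFin => //.
  by move=> y _; rewrite lee_fin sqr_ge0.
have up (q : R) : 1 < q -> (1 + ((1 - q ^- 2) / 2)%:E * v <= q%:E)%E.
  move=> q1; have q0 : 0 < q by lra.
  have k0 : 0 <= (1 - q ^- 2) / 2.
    by rewrite divr_ge0// subr_ge0 invf_le1 ?exprn_gt0// expr_ge1// ltW.
  rewrite -(gauss_exp_sqr q0) hZ//.
  rewrite -{1}i1 -ge0_integralD//; try exact: m2; try exact: me; try by move=> y _; rewrite -EFinM lee_fin mulr_ge0 ?sqr_ge0.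
  apply: ge0_integral_mono => y; first by rewrite -EFinM -EFinD lee_fin addr_ge0// mulr_ge0 ?sqr_ge0.
  rewrite -EFinM -EFinD lee_fin.
  by apply: le_trans (expR_ge1Dx _); rewrite lerD2l mulrAC.
have dn (q : R) : 0 < q < 1 -> (1 <= q%:E + ((q ^- 2 - 1) / 2)%:E * v)%E.
  move=> /andP[q0 q1].
  have k0 : 0 <= (q ^- 2 - 1) / 2.
    by rewrite divr_ge0// subr_ge0 invf_ge1 ?exprn_gt0// expr_le1// ltW.
  rewrite -(gauss_exp_sqr q0) hZ//.
  rewrite -{1}i1 -ge0_integralD//; try exact: m2; try exact: me; try by move=> y _; rewrite -EFinM lee_fin mulr_ge0 ?sqr_ge0.
  apply: ge0_integral_mono => // y.
  rewrite -EFinM -EFinD lee_fin.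
  by have := expR_ge1Dx ((1 - q ^- 2) * y ^+ 2 / 2); lra.
have vfin : v \is a fin_num.
  rewrite ge0_fin_numE// ltey; apply/eqP => vy.
  have /up : (1 : R) < 2 by lra.
  rewrite vy gt0_muley ?addey//.
  by rewrite lte_fin divr_gt0// subr_gt0 invf_lt1 ?exprn_gt0// expr2; lra.
move: v0 up dn; rewrite -(fineK vfin); set r := fine v; rewrite lee_fin => r0 up dn.
congr EFin; apply/eqP; rewrite eq_le; apply/andP; split.
  apply/ler_addgt0Pr => e e0.
  pose q := 1 + e / 2; have q1 : 1 < q by rewrite /q; lra.
  have := up q q1; rewrite -EFinM -EFinD lee_fin => h.
  (* Multiplying by [q ^+ 2] exposes a common factor [q - 1]; once it is cancelled, letting [q] tend
     to 1 gives [r <= 1]. The lower bound below is symmetric. *)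
  have h2 : (q + 1) * r <= 2 * q ^+ 2.
    have qe : q ^- 2 * q ^+ 2 = 1 by rewrite mulVf// expf_neq0// gt_eqF//; lra.
    have : (1 + (1 - q ^- 2) / 2 * r) * q ^+ 2 <= q * q ^+ 2.
      by rewrite ler_wpM2r// sqr_ge0.
    have -> : (1 + (1 - q ^- 2) / 2 * r) * q ^+ 2 = q ^+ 2 + (q ^+ 2 - q ^- 2 * q ^+ 2) / 2 * r by ring.
    rewrite qe => h3.
    rewrite -(ler_pM2l (_ : 0 < q - 1)); last by lra.
    by rewrite expr2 in h3 *; nra.
  by rewrite -(ler_pM2l (_ : 0 < q + 1)); [apply: le_trans h2 _; rewrite /q; nra | lra].
apply/ler_addgt0Pr => e e0.
case: (leP 1 e) => e1; first by lra.
pose q := 1 - e / 2; have q1 : 0 < q < 1 by rewrite /q; apply/andP; split; lra.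
have := dn q q1; rewrite -EFinM -EFinD lee_fin => h.
have h2 : 2 * q ^+ 2 <= (q + 1) * r.
  have qe : q ^- 2 * q ^+ 2 = 1 by rewrite mulVf// expf_neq0// gt_eqF//; lra.
  have : 1 * q ^+ 2 <= (q + (q ^- 2 - 1) / 2 * r) * q ^+ 2.
    by rewrite ler_wpM2r// sqr_ge0.
  have -> : (q + (q ^- 2 - 1) / 2 * r) * q ^+ 2 = q * q ^+ 2 + (q ^- 2 * q ^+ 2 - q ^+ 2) / 2 * r by ring.
  rewrite qe mul1r => h3.
  rewrite -(ler_pM2l (_ : 0 < 1 - q)); last by lra.
  by rewrite expr2 in h3 *; nra.
have h3 : (q + 1) * (1 - e) <= (q + 1) * r by apply: le_trans h2; rewrite /q; nra.
have : 1 - e <= r by rewrite -(ler_pM2l (_ : 0 < q + 1)) //; lra.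
lra.
Qed.

(** * Gaussian vectors and their covariance *)

Section covariance.
Context {R : realType} {A : finType}.
Local Notation V := {ffun A -> R}.

Definition gcov (cs : seq V) (a b : A) : R := \sum_(c <- cs) c a * c b.

Lemma gcov_ge0 (cs : seq V) a : 0 <= gcov cs a a.
Proof. by apply: sumr_ge0 => c _; rewrite -expr2 sqr_ge0. Qed.

Lemma gcov_nil a b : gcov [::] a b = 0.
Proof. exact: big_nil. Qed.

Lemma gcov_cons c (cs : seq V) a b : gcov (c :: cs) a b = c a * c b + gcov cs a b.
Proof. by rewrite /gcov big_cons. Qed.

Lemma gcov_cat (cs ds : seq V) a b :
  gcov (cs ++ ds) a b = gcov cs a b + gcov ds a b.
Proof. by rewrite /gcov big_cat. Qed.

Lemma gcov_eq0 (cs : seq V) a : gcov cs a a = 0 -> {in cs, forall c : V, c a = 0}.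
Proof.
elim: cs => // c cs IH /eqP; rewrite gcov_cons -expr2 paddr_eq0 ?sqr_ge0 ?gcov_ge0//.
rewrite sqrf_eq0 => /andP[/eqP ca /eqP/IH cs0] d; rewrite inE => /predU1P[->//|].
exact: cs0.
Qed.

(* Successive Givens rotations concentrate the coordinate [a] in one column. *)
Lemma gsm_givens a (cs : seq V) : exists c0 cs',
  [/\ forall F, gfun F -> gsm cs F = gsm1 c0 (gsm cs' F),
      forall x y, gcov cs x y = c0 x * c0 y + gcov cs' x y,
      0 <= c0 a & gcov cs' a a = 0].
Proof.
elim: cs => [|c cs [c0 [cs' [gE covE c0a cs'a]]]].
  exists 0, [::]; split => [F _|x y||].
  - by rewrite /= gsm1_0.
  - by rewrite /gcov big_nil !ffunE mulr0 addr0.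
  - by rewrite ffunE.
  - by rewrite /gcov big_nil.
pose r := Num.sqrt (c a ^+ 2 + c0 a ^+ 2).
have r2 : r ^+ 2 = c a ^+ 2 + c0 a ^+ 2 by rewrite sqr_sqrtr// addr_ge0 ?sqr_ge0.
have [r0|rN0] := eqVneq r 0.
  have /eqP : c a ^+ 2 + c0 a ^+ 2 = 0 by rewrite -r2 r0 expr0n.
  rewrite paddr_eq0 ?sqr_ge0// !sqrf_eq0 => /andP[/eqP ca0 /eqP c0a0].
  exists c, (c0 :: cs'); split => [F gF|x y||].
  - by rewrite /= gE.
  - by rewrite !gcov_cons covE.
  - by rewrite ca0.
  - by rewrite gcov_cons c0a0 mul0r add0r.
pose u := c a / r; pose v := c0 a / r.
have uv1 : u ^+ 2 + v ^+ 2 = 1.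
  by rewrite /u /v !expr_div_n -mulrDl -r2 divff// expf_neq0.
exists (u *: c + v *: c0), ((- v *: c + u *: c0) :: cs'); split => [F gF|x y||].
- rewrite [LHS]/=.
  rewrite (gE F gF).
  have h := gsm1_rotation c c0 (gfun_gsm cs' gF) uv1.
  exact: esym h.
- rewrite !gcov_cons covE !ffunE /= addrA addrA; congr (_ + _).
  rewrite -[LHS]mul1r -uv1 /GRing.scale /=; ring.
- rewrite !ffunE /= /u /v /GRing.scale /= ![_ / r * _]mulrAC -!expr2 -mulrDl -r2.
  by rewrite expr2 mulfK// sqrtr_ge0.
- rewrite gcov_cons cs'a addr0 !ffunE /GRing.scale /=.
  by rewrite (_ : _ + _ = 0) ?mul0r// /u /v; ring.
Qed.

Lemma gsm_zero (cs : seq V) F : (forall a, gcov cs a a = 0) -> gsm cs F = F.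
Proof.
elim: cs => //= c cs IH cs0.
have -> : c = 0.
  by apply/ffunP => a; rewrite ffunE; exact: (gcov_eq0 (cs0 a) (mem_head _ _)).
rewrite gsm1_0; apply: IH => a; apply/eqP; rewrite eq_le gcov_ge0 andbT.
by rewrite -(cs0 a) gcov_cons lerDr -expr2 sqr_ge0.
Qed.

(** Cholesky elimination. After the Givens rotations at [a], only the column [c0] is nonzero at [a],
    so [c0 a * c0 b] is the covariance of [a] and [b]. With [0 <= c0 a], a positive variance at [a]
    determines [c0]; this column is then shared by both families and can be peeled off. *)
Lemma gsm_cov (cs ds : seq V) F : gfun F ->
  (forall a b, gcov cs a b = gcov ds a b) -> gsm cs F = gsm ds F.
Proof.
move=> gF.
(* [s] lists the coordinates whose variance may still be nonzero. *)
suff H (s : seq A) : forall cs ds, (forall a b, gcov cs a b = gcov ds a b) ->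
    (forall a, a \notin s -> gcov cs a a = 0) -> gsm cs F = gsm ds F.
  by move=> cd; apply: (H (enum A)) => // a; rewrite mem_enum.
elim: s => [|a s IH] {}cs {}ds cd cs0.
  rewrite !gsm_zero// => a; last by rewrite cs0.
  by rewrite -cd cs0.
have [c0 [cs' [gc covc c0a cs'a]]] := gsm_givens a cs.
have [d0 [ds' [gd covd d0a ds'a]]] := gsm_givens a ds.
have ca b : c0 a * c0 b = d0 a * d0 b.
  have := cd a b; rewrite covc covd.
  have ortho (es : seq V) : gcov es a a = 0 -> gcov es a b = 0.
    by move=> /gcov_eq0 es0; apply: big1_seq => e /andP[_ /es0 ->]; rewrite mul0r.
  by rewrite !ortho// !addr0.
rewrite gc// gd//.
have cd0 : c0 a = d0 a.
  by apply/eqP; rewrite -(@eqrXn2 _ 2)// !expr2; apply/eqP; exact: ca.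
(* If the variance at [a] is zero, nothing is peeled off and [a] just leaves [s]. *)
have [c0a0|c0aN0] := eqVneq (c0 a) 0.
  apply: (IH (c0 :: cs') (d0 :: ds')) => [x y|x xs].
    by rewrite !gcov_cons -covc -covd.
  have [->|xa] := eqVneq x a; first by rewrite gcov_cons c0a0 mul0r add0r.
  by rewrite gcov_cons -covc cs0// inE negb_or xa.
have c0d0 : c0 = d0.
  by apply/ffunP => b; apply: (mulfI c0aN0); rewrite ca cd0.
rewrite c0d0 (IH cs' ds')// => [x y|x xs].
  by have := cd x y; rewrite covc covd c0d0 => /addrI.
have [->//|xa] := eqVneq x a.
have := cs0 x; rewrite inE negb_or xa => /(_ xs).
move/eqP; rewrite covc paddr_eq0 ?gcov_ge0//; last by rewrite -expr2 sqr_ge0.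
by move=> /andP[_ /eqP].
Qed.

End covariance.

(** By symmetry [k] and [- k] give the same integral, and in the sum of the two the cross term
    cancels before integration, so only nonnegative functions are integrated. *)
Lemma gauss_affine_sqr (R : realType) (a k s : R) : 0 <= s ->
  (\int[gauss R]_y ((a + y * k) ^+ 2 + s)%:E = (a ^+ 2 + k ^+ 2 + s)%:E)%E.
Proof.
move=> s0.
pose f (b y : R) : \bar R := ((a + y * b) ^+ 2 + s)%:E.
have mf b : measurable_fun [set: R] (f b).
  apply/measurable_EFinP; apply: measurable_funD => //; apply: measurable_funX => //.
  by apply: measurable_funD => //; exact: mulrr_measurable.
have f0 b y : (0 <= f b y)%E by rewrite lee_fin addr_ge0// sqr_ge0.
have fs : (\int[gauss R]_y f (- k)%R y = \int[gauss R]_y f k y)%E.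
  by rewrite -(gauss_sym (mf k))//; apply: eq_integral => y _; rewrite /f mulrN mulNr.
have two : (\int[gauss R]_y f k y + \int[gauss R]_y f k y =
    ((a ^+ 2 + k ^+ 2 + s) *+ 2)%:E)%E.
  rewrite -{2}fs -ge0_integralD//; try exact: mf.
  transitivity (\int[gauss R]_y (((a ^+ 2 + s) *+ 2)%:E + (k ^+ 2 *+ 2)%:E * (y ^+ 2)%:E))%E.
    apply: eq_integral => y _; rewrite /f -EFinM -!EFinD; congr EFin; ring.
  have mk : measurable_fun [set: R] (fun y : R => ((k ^+ 2 *+ 2)%:E * (y ^+ 2)%:E)%E).
    by apply/measurable_EFinP; apply: measurable_funM => //; exact: measurable_funX.
  have k0 (y : R) : (0 <= (k ^+ 2 *+ 2)%:E * (y ^+ 2)%:E)%E.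
    by rewrite -EFinM lee_fin mulr_ge0 ?mulrn_wge0 ?sqr_ge0.
  have as0 : 0 <= (a ^+ 2 + s) *+ 2 by rewrite mulrn_wge0// addr_ge0// sqr_ge0.
  have Z : (\int[gauss R]_y ((k ^+ 2 *+ 2)%:E * (y ^+ 2)%:E) = (k ^+ 2 *+ 2)%:E)%E.
    rewrite -[RHS]mule1 -(gauss_sqr R); apply: ge0_integralZl_EFin => //.
    - by move=> y _; rewrite lee_fin sqr_ge0.
    - by apply/measurable_EFinP; exact: measurable_funX.
    - by rewrite mulrn_wge0// sqr_ge0.
  have D : (\int[gauss R]_y (((a ^+ 2 + s) *+ 2)%:E + (k ^+ 2 *+ 2)%:E * (y ^+ 2)%:E) =
     \int[gauss R]_y ((a ^+ 2 + s) *+ 2)%:E +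
     \int[gauss R]_y ((k ^+ 2 *+ 2)%:E * (y ^+ 2)%:E))%E.
    by apply: ge0_integralD => // y _; exact: k0.
  rewrite D Z integral_cst//= probability_setT mule1 -EFinD; congr EFin; ring.
rewrite -/(f k) in two *; move: two; case: (\int[gauss R]_y f k y)%E => [r| |]//=.
by rewrite -EFinD => -[rr]; congr EFin; lra.
Qed.

Section moments.
Context {R : realType} {V : lmodType R}.

Lemma gsm_form_sqr (l : {scalar V}) (b : R) (cs : seq V) w :
  gsm cs (fun z => ((l z + b) ^+ 2)%:E) w =
  ((l w + b) ^+ 2 + \sum_(c <- cs) l c ^+ 2)%:E.
Proof.
elim: cs w => [|c cs IH] w; first by rewrite /= big_nil addr0.
rewrite /= /gsm1; under eq_integral do rewrite IH.
rewrite big_cons addrA -gauss_affine_sqr ?sumr_ge0// => [|d _]; last exact: sqr_ge0.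
by apply: eq_integral => y _; rewrite linearD linearZ addrAC.
Qed.

Lemma gmeas_affine (l : {scalar V}) (b : R) : gmeas (fun z : V => l z + b).
Proof. by apply: gmeasD; [exact: gmeas_form | exact: gmeas_cst]. Qed.

Lemma gmeas_sqr (F : V -> R) : gmeas F -> gmeas (fun z => F z ^+ 2).
Proof. by move=> mF; exact: gmeasM. Qed.

Lemma gmeas_sum (I : Type) (s : seq I) (F : I -> V -> R) :
  (forall i, gmeas (F i)) -> gmeas (fun z => \sum_(i <- s) F i z).
Proof. by move=> mF k w c; apply: measurable_sum => i; exact: mF. Qed.

Lemma gsm_sum_sqr (I : Type) (s : seq I) (l : I -> {scalar V}) (b : I -> R) cs w :
  gsm cs (fun z => (\sum_(i <- s) (l i z + b i) ^+ 2)%:E) w =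
  (\sum_(i <- s) ((l i w + b i) ^+ 2 + \sum_(c <- cs) l i c ^+ 2))%:E.
Proof.
elim: s => [|i s IH].
  by rewrite (_ : (fun z => _) = fun=> 0%:E) ?gsm_cst ?big_nil//;
    apply/funext => z; rewrite big_nil.
rewrite (_ : (fun z => _) = fun z => (((l i z + b i) ^+ 2)%:E +
    (\sum_(i <- s) (l i z + b i) ^+ 2)%:E)%E); last first.
  by apply/funext => z; rewrite big_cons EFinD.
rewrite gsmD; last 2 first.
- apply: gfun_EFin => [|z]; last exact: sqr_ge0.
  by apply: gmeas_sqr; exact: gmeas_affine.
- apply: gfun_EFin => [|z]; last by apply: sumr_ge0 => *; exact: sqr_ge0.
  by apply: gmeas_sum => j; apply: gmeas_sqr; exact: gmeas_affine.
by rewrite gsm_form_sqr IH big_cons EFinD.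
Qed.

Lemma gsm_form_exp (l : {scalar V}) (b : R) (cs : seq V) w :
  gsm cs (fun z => (expR (l z + b))%:E) w =
  (expR (l w + b + (\sum_(c <- cs) l c ^+ 2) / 2))%:E.
Proof.
elim: cs w => [|c cs IH] w; first by rewrite /= big_nil mul0r addr0.
rewrite /= /gsm1; under eq_integral do rewrite IH.
rewrite big_cons mulrDl [X in _ + X]addrC addrA -gauss_mgf.
apply: eq_integral => y _; rewrite linearD linearZ /=; congr (expR _)%:E.
rewrite -!addrA; congr (_ + _); rewrite mulrC; ring.
Qed.

Lemma gmeas_expR (F : V -> R) : gmeas F -> gmeas (fun z => expR (F z)).
Proof. by move=> mF; apply: gmeas_comp mF; exact: measurable_expR. Qed.

End moments.

Section coordinates.
Context {R : realType} {A : finType}.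

Fact coordf_additive (a : A) : additive (fun z : {ffun A -> R} => z a : R).
Proof. by move=> z z'; rewrite !ffunE. Qed.

Fact coordf_scalable (a : A) :
  GRing.scalable_for *%R (fun z : {ffun A -> R} => z a : R).
Proof. by move=> k z; rewrite ffunE. Qed.

Definition coordf (a : A) : {scalar {ffun A -> R}} :=
  HB.pack (fun z : {ffun A -> R} => z a : R)
    (GRing.isZmodMorphism.Build {ffun A -> R} R _ (coordf_additive a))
    (GRing.isScalable.Build R {ffun A -> R} R _ _ (coordf_scalable a)).

Lemma gmeas_coord (a : A) : gmeas (fun z : {ffun A -> R} => z a : R).
Proof. exact: (gmeas_form (coordf a)). Qed.

End coordinates.

(** * Gordon's comparison inequality *)

Section gordon.
Context {R : realType} {I J : finType}.
Local Notation A := (I * J)%type.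
Local Notation V := {ffun I * J -> R}.
Implicit Types (a b : I * J) (w z : {ffun I * J -> R}) (c : R).

(** Rows carry the minimum and columns the maximum: [reaches c z], defined next, is the event that
    min over i of max over j of z(i, j) is at least c, as in Gordon's inequality. *)
Definition row_reaches c z (i : I) : bool := [exists j, c <= z (i, j)].
Definition reaches c z : bool := [forall i, row_reaches c z i].
Definition reachesE c z : \bar R := ((reaches c z)%:R)%:E.

Definition fbasis a : V := [ffun x => (x == a)%:R].

Lemma gmeas_reaches c : gmeas (reaches c : V -> bool).
Proof.
move=> k w d.
rewrite (_ : (fun y => _) = (fun y : k.-tuple (measurableTypeR R) =>
  \big[andb/true]_(i : I) \big[orb/false]_(j : J)
    (c <= (w + \sum_(l < k) tnth y l *: d l) (i, j)))); last first.
  apply/funext => y; rewrite big_andE; apply: eq_forallb => i.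
  by rewrite big_orE.
elim: (index_enum I) => [|i s IH].
  by under eq_fun do rewrite big_nil; exact: measurable_cst.
under eq_fun do rewrite big_cons.
apply: measurable_and => //.
elim: (index_enum J) => [|j s' IH'].
  by under eq_fun do rewrite big_nil; exact: measurable_cst.
under eq_fun do rewrite big_cons.
apply: measurable_or => //.
by apply: measurable_fun_ler => //; exact: gmeas_coord.
Qed.

Lemma gfun_reachesE c : gfun (reachesE c : V -> \bar R).
Proof.
apply: gfun_EFin; last by move=> z; rewrite ler0n.
apply: (@gmeas_comp _ _ _ bool _ _ (fun b : bool => b%:R : R)) (gmeas_reaches c).
by [].
Qed.

Lemma row_reachesD c z a i (k : R) : 0 <= k -> row_reaches c z i ->
  row_reaches c (z + k *: fbasis a) i.
Proof.
move=> k0 /existsP[j zj]; apply/existsP; exists j; rewrite !ffunE.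
by rewrite (le_trans zj)// lerDl mulr_ge0.
Qed.

Lemma row_reaches_ext c z z' i : (forall j, z (i, j) = z' (i, j)) ->
  row_reaches c z i = row_reaches c z' i.
Proof. by move=> zz; apply: eq_existsb => j; rewrite zz. Qed.

(* Along the directions [a] and [b], which lie in different rows, the
   indicator is a product of two monotone indicators; the two up-sets of the
   line are nested, whence the comparison. *)
Lemma gsm_swap c w a b (k : R) : 0 <= k -> a.1 != b.1 ->
  (gsm [:: k *: fbasis a; k *: fbasis b] (reachesE c) w <=
   gsm [:: k *: (fbasis a + fbasis b)] (reachesE c) w)%E.
Proof.
move=> k0 ab; rewrite /= /gsm1.
pose f y := row_reaches c (w + (y * k) *: fbasis a) a.1.
pose g y := row_reaches c (w + (y * k) *: fbasis b) b.1.
pose r := [forall (i | (i != a.1) && (i != b.1)), row_reaches c w i].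
(* As the rows differ, row [a.1] sees only the first noise, row [b.1] only the second, and the other
   rows see neither. *)
have rE (y z : R) : reaches c (w + (y * k) *: fbasis a + (z * k) *: fbasis b) = [&& r, f y & g z].
  apply/forallP/and3P => [h|[/forallP hr hf hg] i].
    split.
    - apply/forall_inP => i /andP[ia ib]; rewrite -(@row_reaches_ext _ (w + (y * k) *: fbasis a + (z * k) *: fbasis b))// => j.
      rewrite !ffunE /eq_op /= (negbTE ia) (negbTE ib) /=.
      by rewrite /GRing.scale /= !mulr0 !addr0.
    - rewrite /f -(@row_reaches_ext _ (w + (y * k) *: fbasis a + (z * k) *: fbasis b))// => j.
      by rewrite !ffunE [in X in _ + X]/eq_op /= (negbTE ab) /= /GRing.scale /= mulr0 addr0.
    - rewrite /g -(@row_reaches_ext _ (w + (y * k) *: fbasis a + (z * k) *: fbasis b))// => j.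
      by rewrite !ffunE [in X in _ + X + _]/eq_op /= eq_sym (negbTE ab) /= /GRing.scale /= mulr0 addr0.
  have [->|ia] := eqVneq i a.1.
    rewrite (@row_reaches_ext _ _ (w + (y * k) *: fbasis a))// => j.
    by rewrite !ffunE [in X in _ + X]/eq_op /= (negbTE ab) /= /GRing.scale /= mulr0 addr0.
  have [->|ib] := eqVneq i b.1.
    rewrite (@row_reaches_ext _ _ (w + (z * k) *: fbasis b))// => j.
    by rewrite !ffunE [in X in _ + X + _]/eq_op /= eq_sym (negbTE ab) /= /GRing.scale /= mulr0 addr0.
  have := hr i; rewrite ia ib /= => hi; rewrite (@row_reaches_ext _ _ w)// => j.
  rewrite !ffunE /eq_op /= (negbTE ia) (negbTE ib) /=.
  by rewrite /GRing.scale /= !mulr0 !addr0.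
have fmono y y' : y <= y' -> f y -> f y'.
  move=> yy' fy; rewrite /f.
  have -> : w + (y' * k) *: fbasis a = w + (y * k) *: fbasis a + ((y' - y) * k) *: fbasis a.
    by rewrite -addrA -scalerDl -mulrDl [y + _]addrC subrK.
  by apply: row_reachesD => //; rewrite mulr_ge0// subr_ge0.
have gmono y y' : y <= y' -> g y -> g y'.
  move=> yy' gy; rewrite /g.
  have -> : w + (y' * k) *: fbasis b = w + (y * k) *: fbasis b + ((y' - y) * k) *: fbasis b.
    by rewrite -addrA -scalerDl -mulrDl [y + _]addrC subrK.
  by apply: row_reachesD => //; rewrite mulr_ge0// subr_ge0.
have nested : (forall y, f y -> g y) \/ (forall y, g y -> f y).
  have [?|/existsNP[y /not_implyP[fy gy]]] := pselect (forall y, f y -> g y); first by left.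
  right=> y' gy'; apply: fmono fy; rewrite leNgt; apply/negP => /ltW/gmono.
  by move/(_ gy'); exact/negP/negP.
have E (y z : R) : reachesE c (w + y *: (k *: fbasis a) + z *: (k *: fbasis b)) = (([&& r, f y & g z])%:R)%:E.
  by rewrite /reachesE !scalerA rE.
have E2 y : reachesE c (w + y *: (k *: (fbasis a + fbasis b))) = (([&& r, f y & g y])%:R)%:E.
  by rewrite /reachesE !scalerDr addrA !scalerA rE.
under eq_integral => y _ do under eq_integral => z _ do rewrite E.
under [leRHS]eq_integral do rewrite E2.
have K (h : R -> \bar R) : (\int[gauss R]_y \int[gauss R]_z h y = \int[gauss R]_y h y)%E.
  apply: eq_integral => y _.
  by rewrite integral_cst//= probability_setT mule1.
have C (x : \bar R) : (\int[gauss R]_y x = x)%E.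
  by rewrite integral_cst//= probability_setT mule1.
(* The smaller of the two up-sets is the event under the common noise. The event under independent
   noises implies it, whatever the other variable is. *)
case: nested => [fg|gf].
  rewrite -[leRHS]K; apply: ge0_integral_mono => y.
    by apply: integral_ge0 => z _; rewrite lee_fin ler0n.
  apply: ge0_integral_mono => z; rewrite lee_fin ?ler0n// ler_nat.
  by have := fg y; case: (r); case: (f y); case: (g y); case: (g z) => //= /(_ isT).
rewrite -[leRHS]C; apply: ge0_integral_mono => y.
  by apply: integral_ge0 => z _; rewrite lee_fin ler0n.
apply: ge0_integral_mono => z; rewrite lee_fin ?ler0n// ler_nat.
by have := gf z; case: (r); case: (f y); case: (g z); case: (f z) => //= /(_ isT).
Qed.

Section exchange.
Variables (D : A -> A -> R) (e : R).
Hypothesis D0 : forall a b, 0 <= D a b.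
Hypothesis Dsym : forall a b, D a b = D b a.
Hypothesis Drow : forall a b, a.1 = b.1 -> D a b = 0.
Hypothesis e0 : 0 <= e.

(** Ordered pairs are enumerated, so each unordered pair occurs twice and each copy carries half of
    [e * D]. *)
Let kap (p : A * A) : R := Num.sqrt (e * D p.1 p.2 / 2).
Let sep (ps : seq (A * A)) : seq V :=
  flatten [seq [:: kap p *: fbasis p.1; kap p *: fbasis p.2] | p <- ps].
Let joined (ps : seq (A * A)) : seq V :=
  [seq kap p *: (fbasis p.1 + fbasis p.2) | p <- ps].

Let gsm_pair c w p :
  (gsm [:: kap p *: fbasis p.1; kap p *: fbasis p.2] (reachesE c) w <=
   gsm [:: kap p *: (fbasis p.1 + fbasis p.2)] (reachesE c) w)%E.
Proof.
have [pp|pp] := eqVneq p.1.1 p.2.1; last by apply: gsm_swap => //; exact: sqrtr_ge0.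
by rewrite /kap Drow// mulr0 mul0r sqrtr0 !scale0r /= !gsm1_0.
Qed.

(** Pairs are joined one at a time. [gsm_cov] serves as a permutation of columns: it moves the
    current pair to the innermost place, where [gsm_pair] applies under the remaining
    expectation. *)
Let gsm_pairs c w ps cs :
  (gsm (cs ++ sep ps) (reachesE c) w <= gsm (cs ++ joined ps) (reachesE c) w)%E.
Proof.
elim: ps cs => [|p ps IH] cs; first by rewrite /sep /joined.
have gF := @gfun_reachesE c.
pose ab := [:: kap p *: fbasis p.1; kap p *: fbasis p.2] : seq V.
have -> : cs ++ sep (p :: ps) = (cs ++ ab) ++ sep ps by rewrite -catA.
apply: le_trans (IH _) _.
rewrite (@gsm_cov _ _ ((cs ++ ab) ++ joined ps) ((cs ++ joined ps) ++ ab))//; last first.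
  by move=> x y; rewrite !gcov_cat addrAC.
rewrite (@gsm_cov _ _ (cs ++ joined (p :: ps))
    ((cs ++ joined ps) ++ [:: kap p *: (fbasis p.1 + fbasis p.2)]))//; last first.
  move=> x y; rewrite /joined /= !gcov_cat !gcov_cons gcov_nil addr0.
  by rewrite addrA addrAC.
rewrite !(gsm_cat (cs ++ joined ps)).
by apply: gsm_le => [z|z]; [apply: gsm_ge0 => z'; exact: gF.2 | exact: gsm_pair].
Qed.

(** Separate noises add [e * \sum_b D a b] to the variance at [a]; joined noises add the same and,
    in addition, [e * D a b] off the diagonal. So [cs] is rewritten as [rest] plus separate noises
    and [ds] as [rest] plus joined ones, which requires the diagonal reserve [eta]. *)
Lemma gsm_exchange c w (eta : R) (cs' cs ds : seq V) :
  (forall a, e * \sum_b D a b <= eta) ->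
  (forall a b, gcov cs a b = gcov cs' a b + eta * (a == b)%:R) ->
  (forall a b, gcov ds a b = gcov cs a b + e * D a b) ->
  (gsm cs (reachesE c) w <= gsm ds (reachesE c) w)%E.
Proof.
move=> etaP covcs covds; have gF := @gfun_reachesE c.
pose rest : seq V := cs' ++ [seq Num.sqrt (eta - e * \sum_b D a b) *: fbasis a | a <- enum {: A}].
have covrest x y : gcov rest x y = gcov cs' x y + (eta - e * \sum_b D x b) * (x == y)%:R.
  rewrite /rest gcov_cat; congr (_ + _); rewrite /gcov big_map big_enum /=.
  rewrite (bigD1 x)//= [X in _ + X]big1 ?addr0 => [|a ax]; last first.
    by rewrite !ffunE eq_sym (negbTE ax) /GRing.scale /= mulr0 mul0r.
  rewrite !ffunE eqxx /GRing.scale /= mulr1 mulrA -expr2 sqr_sqrtr ?subr_ge0//.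
  by rewrite eq_sym.
have kap2 p : kap p * kap p = e * D p.1 p.2 / 2.
  by rewrite -expr2 sqr_sqrtr// divr_ge0// mulr_ge0.
have indic (G : A -> R) x : \sum_a G a * (x == a)%:R = G x.
  rewrite (bigD1 x)//= eqxx mulr1 big1 ?addr0// => a ax.
  by rewrite eq_sym (negbTE ax) mulr0.
have covsep x y : gcov (sep (enum {: A * A})) x y = e * (\sum_b D x b) * (x == y)%:R.
  rewrite /gcov /sep big_flatten /= big_map big_enum /=.
  transitivity (\sum_(p : A * A) (e * D p.1 p.2 / 2) *
     ((x == p.1)%:R * (y == p.1)%:R + (x == p.2)%:R * (y == p.2)%:R)).
    apply: eq_bigr => p _; rewrite !big_cons big_nil !ffunE /GRing.scale /= addr0 -kap2.
    by ring.
  rewrite -(pair_bigA _ (fun a b => (e * D a b / 2) *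
     ((x == a)%:R * (y == a)%:R + (x == b)%:R * (y == b)%:R)))/=.
  transitivity (\sum_a \sum_b (e * D a b / 2 * (y == a)%:R) * (x == a)%:R +
     \sum_a \sum_b (e * D a b / 2 * (y == b)%:R) * (x == b)%:R).
    rewrite -big_split; apply: eq_bigr => a _; rewrite -big_split.
    by apply: eq_bigr => b _ /=; ring.
  rewrite exchange_big /=.
  under eq_bigr do rewrite indic.
  under [X in _ + X]eq_bigr do rewrite indic.
  under [X in _ + X = _]eq_bigr => a _ do rewrite (Dsym a x).
  by rewrite -!mulr_suml -!mulr_sumr eq_sym; field.
have covjoin x y : gcov (joined (enum {: A * A})) x y =
    e * (\sum_b D x b) * (x == y)%:R + e * D x y.
  rewrite -covsep /gcov /joined /sep big_flatten /= !big_map -!enumT !big_enum /=.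
  transitivity (\sum_(p : A * A)
     (\sum_(c <- [:: kap p *: fbasis p.1; kap p *: fbasis p.2]) c x * c y +
       (e * D p.1 p.2 / 2) * ((x == p.1)%:R * (y == p.2)%:R + (x == p.2)%:R * (y == p.1)%:R))).
    apply: eq_bigr => p _; rewrite !big_cons big_nil !ffunE /GRing.scale /= addr0 -kap2.
    by ring.
  rewrite big_split /=; congr (_ + _).
  rewrite -(pair_bigA _ (fun a b => (e * D a b / 2) *
     ((x == a)%:R * (y == b)%:R + (x == b)%:R * (y == a)%:R)))/=.
  transitivity (\sum_a (\sum_b (e * D a b / 2) * (y == b)%:R) * (x == a)%:R +
     \sum_a (\sum_b (e * D a b / 2) * (x == b)%:R) * (y == a)%:R).
    rewrite -big_split; apply: eq_bigr => a _; rewrite !mulr_suml -big_split.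
    by apply: eq_bigr => b _ /=; ring.
  by rewrite !indic (Dsym y x); field.
rewrite (@gsm_cov _ _ cs (rest ++ sep (enum {: A * A})))//; last first.
  by move=> x y; rewrite gcov_cat covrest covsep covcs; ring.
rewrite (@gsm_cov _ _ ds (rest ++ joined (enum {: A * A})))//.
by move=> x y; rewrite gcov_cat covrest covjoin covds covcs; ring.
Qed.

End exchange.

End gordon.

Section gordon_comparison.
Context {R : realType} {I J : finType}.
Local Notation A := (I * J)%type.
Local Notation V := {ffun I * J -> R}.
Implicit Types (a b : I * J) (w z : {ffun I * J -> R}) (c d eta : R).

Definition noise eta : seq V := [seq Num.sqrt eta *: fbasis a | a <- enum {: A}].

Lemma gcov_noise eta a b : 0 <= eta -> gcov (noise eta) a b = eta * (a == b)%:R.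
Proof.
move=> eta0; rewrite /gcov big_map big_enum /=.
rewrite (bigD1 a)//= [X in _ + X]big1 ?addr0 => [|a' aa]; last first.
  by rewrite !ffunE eq_sym (negbTE aa) /GRing.scale /= mulr0 mul0r.
rewrite !ffunE eqxx /GRing.scale /= mulr1 mulrA -expr2 sqr_sqrtr//.
by rewrite eq_sym.
Qed.

Lemma gcov_scale (k : R) (cs : seq V) a b : 0 <= k ->
  gcov [seq Num.sqrt k *: x | x <- cs] a b = k * gcov cs a b.
Proof.
move=> k0; rewrite /gcov big_map mulr_sumr; apply: eq_bigr => x _.
rewrite !ffunE /GRing.scale /=.
by transitivity (Num.sqrt k ^+ 2 * (x a * x b)); [ring | rewrite sqr_sqrtr].
Qed.

(* The covariance is moved along the segment from [ys] to [xs] in [N] steps;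
   the diagonal mass needed by each exchange is taken from the noise. *)
Lemma gsm_gordon_noise c w eta (xs ys : seq V) : 0 < eta ->
  (forall a b, gcov ys a b <= gcov xs a b) ->
  (forall a b, a.1 = b.1 -> gcov xs a b = gcov ys a b) ->
  (gsm (ys ++ noise eta) (reachesE c) w <= gsm (xs ++ noise eta) (reachesE c) w)%E.
Proof.
move=> eta0 D0 Drow; pose D a b := gcov xs a b - gcov ys a b.
pose M := \sum_a \sum_b D a b.
have gF := @gfun_reachesE R I J c.
have DM a : \sum_b D a b <= M.
  rewrite /M [leRHS](bigD1 a)//= lerDl; apply: sumr_ge0 => a' _; apply: sumr_ge0 => b _.
  by rewrite subr_ge0.
have M0 : 0 <= M by apply: sumr_ge0 => a' _; apply: sumr_ge0 => b _; rewrite subr_ge0.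
(* Enough steps for the mass [e * M] moved in a single one to fit into the noise variance [eta]. *)
have [N NM] : exists N : nat, M / eta < N.+1%:R.
  exists (Num.truncn (M / eta)); exact: truncnS_gt.
pose e : R := N.+1%:R^-1.
have eM : e * M <= eta.
  rewrite /e mulrC ler_pdivrMr ?ltr0n// mulrC.
  by rewrite -ler_pdivrMr// ltW.
(* Scaling columns by square roots makes the covariance affine in [k]. *)
pose path (k : nat) : seq V := [seq Num.sqrt (1 - k%:R * e) *: x | x <- ys] ++
  [seq Num.sqrt (k%:R * e) *: x | x <- xs].
have covp k a b : (k <= N.+1)%N ->
    gcov (path k) a b = gcov ys a b + k%:R * e * D a b.
  move=> kN; rewrite /path gcov_cat !gcov_scale ?/D; first ring.
  - by rewrite mulr_ge0// invr_ge0.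
  - by rewrite subr_ge0 /e ler_pdivrMr ?ltr0n// mul1r ler_nat.
have step k : (k <= N.+1)%N -> (gsm (path 0%N ++ noise eta) (reachesE c) w <=
    gsm (path k ++ noise eta) (reachesE c) w)%E.
  elim: k => [//|k IH] kN; apply: le_trans (IH (ltnW kN)) _.
  apply: (@gsm_exchange _ _ _ D e _ _ _ _ _ _ eta (path k)) => //.
  - by move=> a b; rewrite subr_ge0.
  - by move=> a b; rewrite /D /gcov; congr (_ - _); apply: eq_bigr => x _; rewrite mulrC.
  - by move=> a b ab; rewrite /D Drow// subrr.
  - by rewrite invr_ge0.
  - by move=> a; apply: le_trans eM; rewrite ler_wpM2l// invr_ge0.
  - by move=> a b; rewrite gcov_cat gcov_noise// ltW.
  - by move=> a b; rewrite !(gcov_cat _ (noise eta)) !covp// ?(ltnW kN)// -[k.+1]addn1 natrD; ring.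
have := step N.+1 (leqnn _).
rewrite (@gsm_cov _ _ (path 0%N ++ _) (ys ++ noise eta))//; last first.
  by move=> a b; rewrite !(gcov_cat _ (noise eta)) covp// !mul0r addr0.
rewrite (@gsm_cov _ _ (path N.+1 ++ _) (xs ++ noise eta))// => a b.
rewrite !(gcov_cat _ (noise eta)) covp// divff ?mul1r ?pnatr_eq0// /D.
by congr (_ + _); rewrite addrC subrK.
Qed.

Definition failsE c z : \bar R := ((~~ reaches c z)%:R)%:E.

Lemma gfun_failsE c : gfun (failsE c : V -> \bar R).
Proof.
apply: gfun_EFin; last by move=> z; rewrite ler0n.
by apply: (@gmeas_comp _ _ _ bool _ _ (fun b : bool => (~~ b)%:R : R)) (gmeas_reaches c).
Qed.

Lemma gsm_reaches_fails c (cs : seq V) w :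
  (gsm cs (reachesE c) w + gsm cs (failsE c) w = 1)%E.
Proof.
rewrite -gsmD; [|exact: gfun_reachesE|exact: gfun_failsE].
rewrite -[RHS](gsm_cst cs w); congr (gsm cs _ w); apply/funext => z.
by rewrite /reachesE /failsE -EFinD; case: reaches; rewrite ?addr0 ?add0r.
Qed.

Lemma failsE_anti c (cs ds : seq V) w :
  (gsm ds (reachesE c) w <= gsm cs (reachesE c) w ->
   gsm cs (failsE c) w <= gsm ds (failsE c) w)%E.
Proof.
have := gsm_reaches_fails c cs w; have := gsm_reaches_fails c ds w.
have r0 es : (0 <= gsm es (reachesE c) w)%E by apply: gsm_ge0 => z; rewrite lee_fin.
have f0 es : (0 <= gsm es (failsE c) w)%E by apply: gsm_ge0 => z; rewrite lee_fin.
move: (r0 cs) (r0 ds) (f0 cs) (f0 ds).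
case: (gsm cs (reachesE c) w) => [x| |]//; case: (gsm ds (reachesE c) w) => [x'| |]//;
case: (gsm cs (failsE c) w) => [y| |]//; case: (gsm ds (failsE c) w) => [y'| |]//.
by move=> _ _ _ _ [e1] [e2]; rewrite !lee_fin; lra.
Qed.

Definition dist2 d w z : R := \sum_a ((z a - w a) / d) ^+ 2.

Lemma dist2_ge0 d w z : 0 <= dist2 d w z.
Proof. by apply: sumr_ge0 => a _; exact: sqr_ge0. Qed.

Lemma gfun_dist2 d w : gfun (fun z => (dist2 d w z)%:E).
Proof.
apply: gfun_EFin => [|z]; last exact: dist2_ge0.
apply: gmeas_sum => a; apply: gmeas_sqr; apply: gmeasM; last exact: gmeas_cst.
exact: (gmeas_affine (coordf a)).
Qed.

Lemma gsm_dist2 d w eta : 0 < d -> 0 <= eta ->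
  gsm (noise eta) (fun z => (dist2 d w z)%:E) w = (#|{: A}|%:R * eta / d ^+ 2)%:E.
Proof.
move=> d0 eta0.
rewrite (_ : (fun z => _) = fun z => ((d ^- 2)%:E *
   (\sum_(a <- index_enum {: A}) (coordf a z + - w a) ^+ 2)%:E)%E); last first.
  apply/funext => z; rewrite -EFinM mulr_sumr; congr EFin; apply: eq_bigr => a _.
  by rewrite expr_div_n mulrC.
rewrite gsmZl; last 2 first.
- apply: gfun_EFin => [|z]; last by apply: sumr_ge0 => a _; exact: sqr_ge0.
  by apply: gmeas_sum => a; apply: gmeas_sqr; exact: gmeas_affine.
- by rewrite invr_ge0 sqr_ge0.
rewrite (gsm_sum_sqr _ (@coordf R _)) -EFinM; congr EFin.
rewrite mulrC; congr (_ / _).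
transitivity (\sum_(a : A) eta); last by rewrite sumr_const mulr_natl.
apply: eq_bigr => a _; rewrite subrr expr0n add0r.
transitivity (gcov (noise eta) a a); last by rewrite gcov_noise// eqxx mulr1.
by apply: eq_bigr => x _; exact: expr2.
Qed.

(** Chebyshev's inequality before integration: if [w] fails at [c] while [z] reaches [c + d], some
    coordinate has moved by at least [d], so [dist2] is at least 1. *)
Lemma fails_dist2 c d w z : 0 < d ->
  (failsE c w <= failsE (c + d) z + (dist2 d w z)%:E)%E.
Proof.
move=> d0; rewrite /failsE -EFinD lee_fin.
case: (boolP (reaches c w)) => /= cw; first by rewrite addr_ge0 ?dist2_ge0.
case: (boolP (reaches (c + d) z)) => /= cz; last by rewrite lerDl dist2_ge0.
rewrite add0r; move: cw; rewrite negb_forall => /existsP[i].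
rewrite negb_exists => /forallP wi.
have /existsP[j zij] := forallP cz i.
have := wi j; rewrite -ltNge => wij.
rewrite /dist2 (bigD1 (i, j))//= -[leLHS]addr0 lerD//; last first.
  by apply: sumr_ge0 => a _; exact: sqr_ge0.
have h : 1 <= (z (i, j) - w (i, j)) / d by rewrite ler_pdivlMr// mul1r; lra.
by rewrite expr2; nra.
Qed.

Lemma fails_dist2C c d w z : 0 < d ->
  (failsE c z <= failsE (c + d) w + (dist2 d w z)%:E)%E.
Proof.
move=> d0; have := fails_dist2 c z w d0; rewrite /dist2.
by under eq_bigr => a _ do rewrite -opprB mulNr sqrrN.
Qed.

Definition shift : V := [ffun=> 1].

Lemma failsE_shift c w (y : R) : y <= 0 ->
  (failsE c w <= failsE c (w + y *: shift)%R)%E.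
Proof.
move=> y0; rewrite lee_fin ler_nat; case: (boolP (reaches c w)) => //= cw.
case: (boolP (reaches _ _)) => //= /forallP h; case/negP: cw.
apply/forallP => i; have /existsP[j hj] := h i; apply/existsP; exists j.
apply: le_trans hj _; rewrite !ffunE /GRing.scale /= mulr1; lra.
Qed.

(* The [+ 1] is the variance of a Gaussian shift common to all coordinates; it
   is nonpositive with probability 1/2, which costs a factor 2. *)
Theorem gordon (xs ys : seq V) c d (e : R) : 0 < d -> 0 < e ->
  (forall a b, gcov ys a b <= gcov xs a b + 1) ->
  (forall a b, a.1 = b.1 -> gcov ys a b = gcov xs a b + 1) ->
  (gsm xs (failsE c) 0%R <= 4%:E * gsm ys (failsE (c + d + d)) 0%R + e%:E)%E.
Proof.
move=> d0 e0 xy xyrow.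
pose p : R := #|{: A}|%:R.
(* Makes the mean of [dist2] at most 1/2, for [lower], and at most [e / 4], for [upper]. The
   denominator [p + 1] stays positive for an empty index set. *)
pose eta := Num.min (2^-1) (e / 4) * d ^+ 2 / (p + 1).
have p0 : 0 <= p by rewrite ler0n.
have m0 : 0 < Num.min (2^-1) (e / 4) by rewrite lt_min; apply/andP; split; lra.
have eta0 : 0 < eta by rewrite divr_gt0 ?mulr_gt0 ?exprn_gt0//; lra.
have smallE : p * eta / d ^+ 2 <= Num.min (2^-1) (e / 4).
  have dN0 : d != 0 by rewrite gt_eqF.
  have p1 : p + 1 != 0 by rewrite gt_eqF//; lra.
  have -> : p * eta / d ^+ 2 = Num.min (2^-1) (e / 4) * (p / (p + 1)).
    by rewrite /eta; field; rewrite dN0 p1.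
  rewrite -[leRHS]mulr1 ler_wpM2l ?(ltW m0)//.
  by rewrite ler_pdivrMr; lra.
have ones : gcov [:: shift] =2 (fun _ _ => 1).
  by move=> a b; rewrite gcov_cons gcov_nil !ffunE addr0 mulr1.
have gF c' := @gfun_failsE c'.
have gN c' : gfun (gsm (noise eta) (failsE c')) by exact: gfun_gsm.
have upper w : (gsm (noise eta) (failsE (c + d)) w <=
    failsE (c + d + d) w + (e / 4)%:E)%E.
  apply: (@le_trans _ _ (gsm (noise eta)
      (fun z => failsE (c + d + d) w + (dist2 d w z)%:E)%E w)).
    by apply: gsm_le => z; [rewrite lee_fin | exact: fails_dist2C].
  rewrite gsmD; last 2 first.
  - by split => [|z]; [exact: gmeas_cst | rewrite lee_fin].
  - exact: gfun_dist2.
  rewrite gsm_cst gsm_dist2 ?(ltW eta0)//. apply: leeD => //.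
  rewrite lee_fin; apply: le_trans smallE _.
  by rewrite ge_min lexx orbT.
have lower w : ((2^-1)%:E * failsE c w <= gsm (noise eta) (failsE (c + d)) w)%E.
  case: (boolP (reaches c w)) => cw.
    by rewrite /failsE cw mule0; exact: (gN _).2.
  have : (gsm (noise eta) (fun=> failsE c w) w <= gsm (noise eta)
      (fun z => failsE (c + d) z + (dist2 d w z)%:E)%E w)%E.
    by apply: gsm_le => z; [rewrite lee_fin | exact: fails_dist2].
  rewrite gsm_cst gsmD//; last exact: gfun_dist2.
  rewrite gsm_dist2 ?(ltW eta0)// /failsE cw /=.
  have := (gN (c + d)).2 w; rewrite /failsE.
  case: (gsm _ _ _) => [r| |]//=; last by move=> *; rewrite leey.
  rewrite mule1 -EFinD !lee_fin => _ h.
  have : Num.min (2^-1) (e / 4) <= 2^-1 by rewrite ge_min lexx.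
  by lra.
(* One factor 2 comes from the sign of the common shift, the other from the noise, under which a
   failure survives at the looser level with probability at least 1/2. *)
have lower2 w : ((4^-1)%:E * failsE c w <=
    gsm ([:: shift] ++ noise eta) (failsE (c + d)) w)%E.
  rewrite gsm_cat /= /gsm1.
  apply: (@le_trans _ _ ((2^-1)%:E * failsE c w *
     \int[gauss R]_y (if (y <= 0)%R then 1 else 0))%E).
    apply: (@le_trans _ _ ((2^-1)%:E * failsE c w * (2^-1)%:E)%E).
      by rewrite -!EFinM lee_fin; lra.
    by apply: lee_wpmul2l; [rewrite -EFinM lee_fin mulr_ge0 | exact: gauss_half].
  rewrite -ge0_integralZl//.
  - apply: ge0_integral_mono => y.
      by rewrite mule_ge0 ?mule_ge0 ?lee_fin//; case: ifP.
    case: ifPn => y0; last by rewrite mule0; exact: (gN _).2.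
    rewrite mule1; apply: le_trans (lower _); apply: lee_wpmul2l; first by rewrite lee_fin.
    exact: failsE_shift.
  - by apply: measurable_fun_ifT => //; exact: measurable_fun_ler.
  - by move=> y _; case: ifP.
  - by rewrite mule_ge0 ?lee_fin.
have main : (gsm (xs ++ [:: shift] ++ noise eta) (failsE (c + d)) 0%R <=
    gsm (ys ++ noise eta) (failsE (c + d)) 0%R)%E.
  apply: failsE_anti; rewrite catA.
  apply: gsm_gordon_noise => // a b; rewrite gcov_cat ones//.
  by move=> /xyrow ->.
have s1 : ((4^-1)%:E * gsm xs (failsE c) 0%R <=
    gsm (xs ++ [:: shift] ++ noise eta) (failsE (c + d)) 0%R)%E.
  rewrite gsm_cat -gsmZl//; apply: gsm_le => // z.
  by rewrite mule_ge0 ?lee_fin.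
have s2 : (gsm (ys ++ noise eta) (failsE (c + d)) 0%R <=
    gsm ys (failsE (c + d + d)) 0%R + (e / 4)%:E)%E.
  rewrite gsm_cat -[X in (_ <= _ + X)%E](gsm_cst ys 0%R) -gsmD//; last first.
    by split => [|z]; [exact: gmeas_cst | rewrite lee_fin; lra].
  by apply: gsm_le => // z; exact: (gN _).2.
have fy : (4%:E * +oo = +oo :> \bar R)%E by rewrite gt0_muley// lte_fin.
have := le_trans s1 (le_trans main s2).
have := gsm_ge0 ys 0 (gF (c + d + d)).2; have := gsm_ge0 xs 0 (gF c).2.
case: (gsm xs _ _) => [r| |]//=; case: (gsm ys _ _) => [r'| |]//=.
- by rewrite -!EFinM -!EFinD !lee_fin; lra.
- by move=> *; rewrite fy addye// leey.
- by rewrite gt0_muley ?lte_fin ?invr_gt0.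
- by move=> *; rewrite fy addye// leey.
Qed.

End gordon_comparison.

(** * Concentration of Gaussian maxima *)

Lemma sin_le (R : realType) (x : R) : 0 <= x -> sin x <= x.
Proof.
rewrite le_eqVlt => /predU1P[<-|x0]; first by rewrite sin0.
have [c _] : exists2 c, c \in `]0, x[%R & sin x - sin 0 = cos c * (x - 0).
  apply: MVT => //.
  by apply: continuous_subspaceT => y; exact: continuous_sin.
rewrite sin0 !subr0 => ->.
by rewrite -[leRHS]mul1r ler_wpM2r ?(ltW x0)// cos_le1.
Qed.

Lemma sin_ge0 (R : realType) (x : R) : 0 <= x < 2 -> 0 <= sin x.
Proof.
move=> /andP[]; rewrite le_eqVlt => /predU1P[<- _|x0 x2]; first by rewrite sin0.
by rewrite ltW// sin2_gt0// x0.
Qed.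

Lemma cos_ge (R : realType) (x : R) : 0 <= x < 2 -> 1 - x ^+ 2 / 2 <= cos x.
Proof.
move=> /andP[x0 x2]; have xE : x = (x / 2) *+ 2 by rewrite -mulr_natr divfK.
have s0 : 0 <= sin (x / 2) by apply: sin_ge0; apply/andP; split; lra.
have sx : sin (x / 2) <= x / 2 by apply: sin_le; lra.
have s2 : sin (x / 2) ^+ 2 <= (x / 2) ^+ 2 by rewrite lerXn2r ?nnegrE//; lra.
have -> : x ^+ 2 / 2 = (x / 2) ^+ 2 + (x / 2) ^+ 2 by field.
rewrite [in leRHS]xE cos_mulr2n cos2sin2 mulr2n.
by move: (sin _ ^+ 2) ((x / 2) ^+ 2) s2 => u v uv; lra.
Qed.

Section operators_more.
Context {R : realType} {V : lmodType R}.

Lemma gsm1C (a b : V) F : gfun F -> gsm1 a (gsm1 b F) = gsm1 b (gsm1 a F).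
Proof.
move=> gF; have e : (0 : R) ^+ 2 + 1 ^+ 2 = 1 by ring.
rewrite -(gsm1_rotation a b gF e) !scale0r !scale1r add0r addr0 scaleN1r.
by rewrite gsm1N.
Qed.

Lemma gsm_gsm1C (cs : seq V) (a : V) F : gfun F ->
  gsm cs (gsm1 a F) = gsm1 a (gsm cs F).
Proof.
move=> gF; elim: cs => //= c cs ->.
by rewrite gsm1C//; exact: gfun_gsm.
Qed.

Lemma gsm_zip (T : Type) (f g : T -> V) (s : seq T) F : gfun F ->
  gsm (map f s ++ map g s) F = gsm (flatten [seq [:: f x; g x] | x <- s]) F.
Proof.
move=> gF; elim: s => //= x s <-.
rewrite gsm_cat /= [in RHS]gsm_cat gsm_gsm1C//; exact: gfun_gsm.
Qed.

Lemma gsm_sum_le (I : Type) (s : seq I) (f : I -> V -> R) (b : I -> R) cs w :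
  (forall i, gmeas (f i)) -> (forall i z, 0 <= f i z) ->
  (forall i, (gsm cs (fun z => (f i z)%:E) w <= (b i)%:E)%E) ->
  (gsm cs (fun z => (\sum_(i <- s) f i z)%:E) w <= (\sum_(i <- s) b i)%:E)%E.
Proof.
move=> mf f0 fb; elim: s => [|i s IH].
  by rewrite (_ : (fun z => _) = fun=> 0%:E) ?gsm_cst ?big_nil//;
    apply/funext => z; rewrite big_nil.
rewrite (_ : (fun z => _) = fun z => ((f i z)%:E + (\sum_(i <- s) f i z)%:E)%E);
  last by apply/funext => z; rewrite big_cons EFinD.
rewrite gsmD; last 2 first.
- exact: gfun_EFin.
- by apply: gfun_EFin => [|z]; [exact: gmeas_sum | exact: sumr_ge0].
by rewrite big_cons EFinD; apply: leeD.
Qed.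

End operators_more.

(** * Two independent copies of a Gaussian vector and their rotation *)

Section pairs.
Context {R : realType} {V : lmodType R}.
Local Notation W := (V * V)%type.
Implicit Types (cs : seq V) (H : W -> \bar R).

Definition pair_cols cs : seq W :=
  [seq (c, 0 : V) | c <- cs] ++ [seq (0 : V, c) | c <- cs].

Lemma pairDZ (x y u v : V) (r : R) :
  (x, y) + r *: (u, v) = (x + r *: u, y + r *: v) :> W.
Proof. by []. Qed.

Lemma gsm_pair_cols cs H x y :
  gsm (pair_cols cs) H (x, y) = gsm cs (fun x' => gsm cs (fun y' => H (x', y')) y) x.
Proof.
have inner z : gsm [seq (0 : V, c) | c <- cs] H (z, y) = gsm cs (fun y' => H (z, y')) y.
  elim: cs y => //= c cs IH y; rewrite /gsm1; apply: eq_integral => r _.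
  by rewrite pairDZ scaler0 addr0 IH.
rewrite /pair_cols gsm_cat.
elim: {1 3}cs x => [|c cs' IH] x; first exact: inner.
rewrite /= /gsm1; apply: eq_integral => r _.
by rewrite pairDZ scaler0 addr0 IH.
Qed.

Definition rot (c s : R) (p : W) : W := (c *: p.1 + s *: p.2, - s *: p.1 + c *: p.2).

Lemma rot_linear c s : linear (rot c s).
Proof.
move=> k [p1 p2] [q1 q2]; rewrite /rot /=.
have pairZD (x y u v : V) : k *: (x, y) + (u, v) = (k *: x + u, k *: y + v) :> W by [].
rewrite [RHS]pairZD; congr (_, _).
  by rewrite !scalerDr !scalerA addrACA [c * k]mulrC [s * k]mulrC.
by rewrite !scalerDr !scalerA addrACA [- s * k]mulrC [c * k]mulrC.
Qed.

HB.instance Definition _ c s :=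
  GRing.isLinear.Build R W W _ (rot c s) (rot_linear c s).

(** Once the columns are interleaved by [gsm_zip], the rotation acts on each pair [(d, 0)], [(0, d)]
    separately. *)
Lemma gsm_rot (c s : R) cs H : gfun H -> c ^+ 2 + s ^+ 2 = 1 ->
  gsm (pair_cols cs) (H \o rot c s) 0 = gsm (pair_cols cs) H 0.
Proof.
move=> gH cs1; rewrite gsm_linear linear0; congr (_ _).
rewrite /pair_cols map_cat -!map_comp !gsm_zip//.
elim: cs => //= d ds ->; set G := gsm _ H.
have gG : gfun G by exact: gfun_gsm.
have cs1' : c ^+ 2 + (- s) ^+ 2 = 1 by rewrite sqrrN.
have pairZZ (k l : R) : k *: (d, 0) + l *: (0, d) = (k *: d, l *: d) :> W.
  by rewrite [LHS](_ : _ = (k *: d + l *: 0, k *: 0 + l *: d))// !scaler0 addr0 add0r.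
rewrite -(gsm1_rotation (d, 0) (0, d) gG cs1') !pairZZ /rot /= !scaler0 opprK.
by rewrite !addr0 !add0r.
Qed.

End pairs.

Section concentration.
Context {R : realType} {A : finType}.
Local Notation V := {ffun A -> R}.
Local Notation W := (V * V)%type.
Implicit Types (s : seq A) (u v : V) (p : W).

(** The base value 0 makes this the positive part of the maximum, as fits the norm of a projection
    onto a cone, which vanishes when no direction of the cone correlates positively with the
    vector. *)
Fixpoint fmax s u : R := if s is a :: s' then Num.max (u a) (fmax s' u) else 0.

(* The derivative of [fmax s] at [u] in the direction [v], with ties broken
   by the order of [s]. *)
Fixpoint dmax s u v : R :=
  if s is a :: s' then if fmax s' u <= u a then v a else dmax s' u v else 0.

Lemma fmax_ge0 s u : 0 <= fmax s u.
Proof. by elim: s => //= a s IH; rewrite le_max IH orbT. Qed.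

(** The coordinate that attains the maximum at [u] still competes at the new point. *)
Lemma fmax_convex s u v (c k : R) : 0 <= c ->
  c * fmax s u - k * dmax s u v <= fmax s (c *: u - k *: v).
Proof.
move=> c0; elim: s => [|a s IH] /=; first by rewrite !mulr0 subr0.
case: ifP => h.
  rewrite (max_idPl h) le_max; apply/orP; left.
  by rewrite !ffunE /GRing.scale /=.
by rewrite le_max max_r ?IH ?orbT// ltW// ltNge h.
Qed.

(** For fixed [u] the derivative is a single coordinate of [v], hence Gaussian of variance at most
    1. This is the Lipschitz property behind the concentration. *)
Lemma dmax_coord s u : (forall v, dmax s u v = 0) \/
  exists a, forall v, dmax s u v = v a.
Proof.
elim: s => [|a s IH] /=; first by left.
by case: (_ <= u a) => //; right; exists a.
Qed.

Lemma gmeas_fmax s : gmeas (fmax s : V -> R).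
Proof.
elim: s => [|a s IH] /=; first exact: gmeas_cst.
by apply: gmeas_max => //; exact: gmeas_coord.
Qed.

Lemma gmeas_fst (F : V -> R) : gmeas F -> gmeas (fun p => F p.1).
Proof. by move=> mF; exact: (gmeas_linear (fst : {linear W -> V}) mF). Qed.

Lemma gmeas_snd (F : V -> R) : gmeas F -> gmeas (fun p => F p.2).
Proof. by move=> mF; exact: (gmeas_linear (snd : {linear W -> V}) mF). Qed.

Lemma gmeas_dmax s : gmeas (fun p => dmax s p.1 p.2).
Proof.
elim: s => [|a s IH] /=; first exact: gmeas_cst.
move=> k w c; apply: measurable_fun_ifT; last exact: IH.
  apply: measurable_fun_ler; first exact: (gmeas_fst (gmeas_fmax s)).
  exact: (gmeas_fst (gmeas_coord a)).
exact: (gmeas_snd (gmeas_coord a)).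
Qed.

Variable cs : seq V.
Hypothesis var1 : forall a, gcov cs a a <= 1.

Lemma gsm_coord_exp a (k b : R) :
  (gsm cs (fun z => (expR (k * z a + b))%:E) 0%R <= (expR (b + k ^+ 2 / 2))%:E)%E.
Proof.
pose l : {scalar V} := k \*o coordf a.
have := gsm_form_exp l b cs 0; rewrite linear0 add0r => ->.
rewrite lee_fin ler_expR lerD2l ler_pM2r//.
apply: (@le_trans _ _ (k ^+ 2 * gcov cs a a)).
  rewrite /gcov mulr_sumr ler_sum// => c _; rewrite /l /= exprMn expr2 -expr2.
  by rewrite le_eqVlt; apply/orP; left; apply/eqP; congr (_ * _); rewrite expr2.
by rewrite -[leRHS]mulr1 ler_wpM2l// sqr_ge0.
Qed.

Variable s : seq A.
Local Notation F := (fmax s).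

Lemma gmeas_expR_fmax (l : R) : gmeas (fun z : V => expR (l * F z)).
Proof.
by apply: gmeas_expR; apply: gmeasM; [exact: gmeas_cst | exact: gmeas_fmax].
Qed.

Lemma gfun_expR_fmax (l : R) : gfun (fun z : V => (expR (l * F z))%:E).
Proof.
by apply: gfun_EFin => [|z]; [exact: gmeas_expR_fmax | exact: expR_ge0].
Qed.

Lemma expR_fmax_fin (l : R) : 0 <= l ->
  exists M : R, gsm cs (fun z => (expR (l * F z))%:E) 0 = M%:E.
Proof.
move=> l0; have : (gsm cs (fun z => (expR (l * F z))%:E) 0%R < +oo)%E.
  elim: s => [|a s' IH] /=.
    by rewrite gsm_cst ltry.
  apply: (@le_lt_trans _ _ (gsm cs (fun z => (expR (l * z a + 0))%:E +
      (expR (l * fmax s' z))%:E)%E 0)).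
    apply: gsm_le => z; first by rewrite lee_fin expR_ge0.
    rewrite -EFinD lee_fin addr0.
    by case: (leP (z a) (fmax s' z)) => _; rewrite ?lerDl ?lerDr ?expR_ge0.
  rewrite gsmD; last 2 first.
  - apply: gfun_EFin => [|z]; last exact: expR_ge0.
    apply: gmeas_expR; apply: gmeasD; last exact: gmeas_cst.
    by apply: gmeasM; [exact: gmeas_cst|exact: gmeas_coord].
  - apply: gfun_EFin => [|z]; last exact: expR_ge0.
    by apply: gmeas_expR; apply: gmeasM; [exact: gmeas_cst|exact: gmeas_fmax].
  rewrite lte_add_pinfty//; exact: le_lt_trans (gsm_coord_exp a l 0) (ltry _).
have : (0 <= gsm cs (fun z => (expR (l * F z))%:E) 0%R)%E.
  by apply: gsm_ge0 => z; rewrite lee_fin expR_ge0.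
by case: (gsm _ _ _) => [M| |]//= _ _; exists M.
Qed.

(** Convexity between 0 and [x], from the tangent at [e * x]. It makes a small exponential moment
    linear in [e], so that one finite moment controls all of them. *)
Lemma expR_chord (e x : R) : 0 <= e <= 1 -> expR (e * x) <= 1 - e + e * expR x.
Proof.
move=> /andP[e0 e1]; set y := e * x.
have h1 : expR y * (1 - y) <= 1.
  rewrite -[leRHS](expRxMexpNx_1 y) ler_wpM2l ?expR_ge0//.
  exact: expR_ge1Dx.
have h2 : expR y * (1 + (x - y)) <= expR x.
  have -> : expR x = expR y * expR (x - y) by rewrite -exp.expRD addrC subrK.
  rewrite ler_wpM2l ?expR_ge0//.
  exact: expR_ge1Dx.
have -> : expR y = (1 - e) * (expR y * (1 - y)) + e * (expR y * (1 + (x - y))).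
  by rewrite /y; ring.
apply: lerD; last exact: ler_wpM2l.
by rewrite -[leRHS]mulr1 ler_wpM2l// subr_ge0.
Qed.

Lemma expR_Jensen (N : nat) (t : 'I_N -> R) : (0 < N)%N ->
  expR (\sum_k t k) <= \sum_k N%:R^-1 * expR (N%:R * t k).
Proof.
move=> N0; set S := \sum_k t k.
have -> : expR S = \sum_(k < N) N%:R^-1 * (expR S * (1 + (N%:R * t k - S))).
  rewrite -!mulr_sumr big_split /= sumr_const card_ord sumrB -mulr_sumr -/S.
  rewrite sumr_const card_ord -[S *+ N]mulr_natl subrr addr0 mulrCA mulVf ?mulr1//.
  by rewrite pnatr_eq0 -lt0n.
apply: ler_sum => k _; rewrite ler_wpM2l ?invr_ge0//.
rewrite [leRHS](_ : _ = expR S * expR (N%:R * t k - S)); last first.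
  by rewrite -exp.expRD addrC subrK.
rewrite ler_wpM2l ?expR_ge0//.
exact: expR_ge1Dx.
Qed.

(** One rotation step: the [dmax] term is the Gaussian increment, and the [F] term is the defect due
    to a cosine below 1. *)
Let Phi (m e : R) p : R := expR (m * dmax s p.1 p.2 + e * F p.1).

Let gmeas_Phi m e : gmeas (Phi m e).
Proof.
apply: gmeas_expR; apply: gmeasD; apply: gmeasM; try exact: gmeas_cst.
  exact: gmeas_dmax.
exact: (gmeas_fst (gmeas_fmax s)).
Qed.

Let gfun_Phi m e : gfun (fun p => (Phi m e p)%:E).
Proof. by apply: gfun_EFin => // p; exact: expR_ge0. Qed.

Let gsm_Phi (m e M : R) : 0 <= e <= 1 ->
  gsm cs (fun z => (expR (F z))%:E) 0 = M%:E ->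
  (gsm (pair_cols cs) (fun p => (Phi m e p)%:E) 0%R <=
   (expR (m ^+ 2 / 2) * (1 + e * M))%:E)%E.
Proof.
move=> /andP[e0 e1] ME; rewrite (gsm_pair_cols cs _ 0 0).
apply: (@le_trans _ _ (gsm cs (fun z => (expR (m ^+ 2 / 2))%:E *
    ((1 - e)%:E + e%:E * (expR (F z))%:E))%E 0)).
  apply: gsm_le => z; first by apply: gsm_ge0 => z'; rewrite lee_fin expR_ge0.
  apply: (@le_trans _ _ (expR (e * F z + m ^+ 2 / 2))%:E).
    rewrite /Phi /=; have [d0|[a da]] := dmax_coord s z.
      rewrite (_ : (fun y => _) = fun=> (expR (e * F z))%:E); last first.
        by apply/funext => y; rewrite d0 mulr0 add0r.
      by rewrite gsm_cst lee_fin ler_expR lerDl divr_ge0 ?sqr_ge0.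
    rewrite (_ : (fun y => _) = fun y : V => (expR (m * y a + e * F z))%:E); last first.
      by apply/funext => y; rewrite da.
    exact: gsm_coord_exp.
  rewrite -[leRHS]/((expR (m ^+ 2 / 2) * (1 - e + e * expR (F z)))%:E) lee_fin.
  rewrite addrC exp.expRD ler_wpM2l ?expR_ge0//.
  by apply: expR_chord; rewrite e0.
have gM : gfun (fun z : V => (expR (F z))%:E).
  apply: gfun_EFin => [|z]; last exact: expR_ge0.
  by apply: gmeas_expR; exact: gmeas_fmax.
have gZ : gfun (fun z : V => (e%:E * (expR (F z))%:E)%E).
  apply: gfun_EFin => [|z]; last by rewrite mulr_ge0 ?expR_ge0.
  by apply: gmeasM; [exact: gmeas_cst | apply: gmeas_expR; exact: gmeas_fmax].
have gC : gfun (fun _ : V => (1 - e)%:E).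
  by split => [|z]; [exact: gmeas_cst | rewrite lee_fin subr_ge0].
rewrite gsmZl ?expR_ge0//; last first.
  split => [|z]; last by apply: adde_ge0; [exact: (gC.2 z) | exact: (gZ.2 z)].
  move=> k w c; exact: emeasurable_funD (gC.1 k w c) (gZ.1 k w c).
rewrite gsmD// gsm_cst gsmZl// ME.
rewrite -[leLHS]/((expR (m ^+ 2 / 2) * (1 - e + e * M))%:E) lee_fin.
rewrite ler_wpM2l ?expR_ge0//.
lra.
Qed.

(** A quarter turn takes [p.1] to [p.2]. It is cut into [N] rotations of angle [h]; the increments
    telescope, [expR_Jensen] separates them at the price of a factor [N] in each exponent, and every
    rotated pair has the original law. The Gaussian exponent is at most [2 * l ^+ 2] since pi / 2 <
    2, and the defect vanishes as [N] grows. *)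
Lemma gsm_fmax_pair (l : R) : 0 <= l ->
  (gsm (pair_cols cs) (fun p => (expR (l * (F p.2 - F p.1)))%:E) 0%R <=
   (expR (2 * l ^+ 2))%:E)%E.
Proof.
move=> l0; have [M ME] : exists M : R, gsm cs (fun z => (expR (F z))%:E) 0 = M%:E.
  have [M] := expR_fmax_fin ler01; under eq_fun do rewrite mul1r.
  by exists M.
have M0 : 0 <= M.
  by rewrite -lee_fin -ME; apply: gsm_ge0 => z; rewrite lee_fin expR_ge0.
apply/lee_addgt0Pr => e e0.
(* The first term makes the total defect at most [e]; the second gives [ee <= 1], as [expR_chord]
   demands. *)
pose B := expR (2 * l ^+ 2) * M * l * 2 / e + 2 * l.
have [N0 NB] : exists N0 : nat, B < N0.+1%:R.
  by exists (Num.truncn B); exact: truncnS_gt.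
pose N := N0.+1; rewrite -/N in NB.
pose h : R := pi / 2 / N%:R.
have N1 : 1 <= N%:R :> R by rewrite ler1n.
have Ngt0 : 0 < N%:R :> R by lra.
have pi2 : 0 < (pi : R) / 2 < 2 by exact: pihalf_02.
have hN : N%:R * h = pi / 2 by rewrite /h mulrC divfK// gt_eqF.
have h02 : 0 <= h < 2.
  case/andP: pi2 => p0 p2; rewrite /h divr_ge0 ?ltW//=.
  by rewrite ltr_pdivrMr//; nra.
pose m := N%:R * l * sin h; pose ee := N%:R * l * (1 - cos h).
have m2 : m ^+ 2 / 2 <= 2 * l ^+ 2.
  have s0 := sin_ge0 h02; have sh := sin_le (andP h02).1.
  have : m <= l * 2 by rewrite /m mulrAC [leRHS]mulrC ler_wpM2r//; case/andP: pi2; nra.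
  have : 0 <= m by rewrite /m !mulr_ge0// ltW.
  by rewrite !expr2; nra.
have ee1 : 0 <= ee <= 2 * l / N%:R.
  have c1 := cos_le1 h; have ch := cos_ge h02.
  have c2 : 0 <= 1 - cos h by rewrite subr_ge0.
  apply/andP; split; first by rewrite /ee !mulr_ge0// ltW.
  rewrite /ee ler_pdivlMr//.
  have : N%:R * (1 - cos h) * N%:R <= 2.
    apply: (@le_trans _ _ ((N%:R * h) ^+ 2 / 2)).
      have -> : (N%:R * h) ^+ 2 / 2 = N%:R * (h ^+ 2 / 2) * N%:R by field.
      by rewrite ler_pM2r// ler_pM2l//; lra.
    by rewrite hN; case/andP: pi2; rewrite expr2; nra.
  have -> : N%:R * l * (1 - cos h) * N%:R = l * (N%:R * (1 - cos h) * N%:R) by ring.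
  by move=> H; rewrite [leRHS]mulrC ler_wpM2l.
have Bl : 2 * l <= N%:R.
  apply: le_trans (ltW NB); rewrite lerDr !mulr_ge0 ?expR_ge0 ?invr_ge0 ?(ltW e0)//.
have ee01 : 0 <= ee <= 1.
  case/andP: ee1 => -> /= ee1; apply: le_trans ee1 _.
  by rewrite ler_pdivrMr// mul1r.
have eeM : expR (2 * l ^+ 2) * (1 + ee * M) <= expR (2 * l ^+ 2) + e.
  rewrite mulrDr mulr1 lerD2l.
  have /andP[_ ee2] := ee1.
  apply: (@le_trans _ _ (expR (2 * l ^+ 2) * (2 * l / N%:R * M))).
    by rewrite ler_wpM2l ?expR_ge0// ler_wpM2r.
  have -> : expR (2 * l ^+ 2) * (2 * l / N%:R * M) =
     expR (2 * l ^+ 2) * M * l * 2 / N%:R by field; rewrite gt_eqF.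
  rewrite ler_pdivrMr// -ler_pdivrMl// mulrC.
  by apply: le_trans (ltW NB); rewrite lerDl mulr_ge0.
pose rk (k : nat) := rot (V := V) (cos (k%:R * h)) (sin (k%:R * h)).
have cs1 k : cos (k%:R * h) ^+ 2 + sin (k%:R * h) ^+ 2 = 1 by exact: cos2Dsin2.
(* The step is read backwards: [rk k] is [rk k.+1] turned by [- h], and convexity at the later point
   bounds the increment from above. *)
have incr k p : N%:R * (l * (F (rk k.+1 p).1 - F (rk k p).1)) <=
    m * dmax s (rk k.+1 p).1 (rk k.+1 p).2 + ee * F (rk k.+1 p).1.
  have c0 : 0 <= cos h.
    case/andP: h02 => h0 _; case/andP: pi2 => p0 _.
    by apply: cos_ge0_pihalf; apply/andP; split; nra.
  have := @fmax_convex s (rk k.+1 p).1 (rk k.+1 p).2 (cos h) (sin h) c0.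
  have -> : cos h *: (rk k.+1 p).1 - sin h *: (rk k.+1 p).2 = (rk k p).1.
    rewrite /rk /rot /= !scalerDr !scalerA opprD addrACA -!scalerBl.
    rewrite -natr1 mulrDl mul1r trigo.cosD trigo.sinD.
    congr (_ *: _ + _ *: _).
      transitivity (cos (k%:R * h) * (cos h ^+ 2 + sin h ^+ 2)); first ring.
      by rewrite cos2Dsin2 mulr1.
    transitivity (sin (k%:R * h) * (cos h ^+ 2 + sin h ^+ 2)); first ring.
    by rewrite cos2Dsin2 mulr1.
  move: (F _) (F _) (dmax _ _ _) => f1 f0 d hf.
  rewrite /m /ee -!mulrA -mulrDr ler_pM2l// -mulrDr ler_wpM2l//; lra.
pose Psi p := \sum_(k < N) N%:R^-1 * Phi m ee (rk k.+1 p).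
have le1 p : expR (l * (F p.2 - F p.1)) <= Psi p.
  have -> : l * (F p.2 - F p.1) = \sum_(k < N) l * (F (rk k.+1 p).1 - F (rk k p).1).
    rewrite -mulr_sumr -(big_mkord xpredT (fun k => F (rk k.+1 p).1 - F (rk k p).1)).
    rewrite telescope_sumr// /rk /rot /= mul0r cos0 sin0 hN cos_pihalf sin_pihalf.
    by rewrite !scale1r !scale0r add0r addr0.
  apply: le_trans (expR_Jensen _ _) _ => //.
  apply: ler_sum => k _; rewrite ler_wpM2l ?invr_ge0//.
  by rewrite /Phi ler_expR; exact: incr.
apply: (@le_trans _ _ (gsm (pair_cols cs) (fun p => (Psi p)%:E) 0%R)).
  by apply: gsm_le => p; rewrite lee_fin// expR_ge0.
apply: (@le_trans _ _ (expR (2 * l ^+ 2) * (1 + ee * M))%:E); last first.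
  by rewrite -EFinD lee_fin.
have bound (k : 'I_N) : (gsm (pair_cols cs)
    (fun p => (N%:R^-1 * Phi m ee (rk k.+1 p))%:E) 0%R <=
    (N%:R^-1 * (expR (2 * l ^+ 2) * (1 + ee * M)))%:E)%E.
  rewrite (_ : (fun p => _) = fun p => (N%:R^-1%:E *
     ((fun q => (Phi m ee q)%:E) \o rk k.+1) p)%E); last by [].
  rewrite gsmZl ?invr_ge0//; last exact: gfun_linear.
  rewrite gsm_rot// [leRHS]EFinM; apply: lee_wpmul2l; first by rewrite lee_fin invr_ge0.
  apply: le_trans (gsm_Phi _ ee01 ME) _; rewrite lee_fin ler_wpM2r ?ler_expR//.
  by case/andP: ee01 => ? _; rewrite addr_ge0// mulr_ge0.
have -> : expR (2 * l ^+ 2) * (1 + ee * M) =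
    \sum_(k < N) N%:R^-1 * (expR (2 * l ^+ 2) * (1 + ee * M)).
  by rewrite sumr_const card_ord -[RHS]mulr_natl mulVKf// gt_eqF.
apply: gsm_sum_le => // k; last by move=> p; rewrite mulr_ge0 ?invr_ge0 ?expR_ge0.
apply: gmeasM; first exact: gmeas_cst.
exact: (gmeas_linear (rk k.+1) (gmeas_Phi m ee)).
Qed.

Lemma gsm_fin_le (G H : V -> R) (b : R) : (forall z, 0 <= G z) ->
  (forall z, G z <= b * H z) -> gfun (fun z => (H z)%:E) -> 0 <= b ->
  (exists M : R, gsm cs (fun z => (H z)%:E) 0 = M%:E) ->
  exists2 r : R, 0 <= r & gsm cs (fun z => (G z)%:E) 0 = r%:E.
Proof.
move=> G0 GH gH b0 [M ME].
have : (gsm cs (fun z => (G z)%:E) 0%R <= b%:E * M%:E)%E.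
  by rewrite -ME -gsmZl//; apply: gsm_le => z; rewrite lee_fin.
have : (0 <= gsm cs (fun z => (G z)%:E) 0%R)%E.
  by apply: gsm_ge0 => z; rewrite lee_fin.
by case: (gsm _ _ _) => [r| |]//= r0 _; exists r.
Qed.

(** For independent copies, [gsm_fmax_pair] bounds the product of the moments at [l] and [- l].
    Jensen's inequality bounds each factor below by the exponential at the mean [mu], and dividing
    by one bounds the other above. *)
Lemma gsm_fmax_conc : exists mu S : R,
  [/\ 0 <= mu, mu ^+ 2 <= S, Num.sqrt S <= mu + 7,
      gsm cs (fun z => (F z ^+ 2)%:E) 0 = S%:E &
      forall l, 0 <= l ->
      (gsm cs (fun z => (expR (l * F z))%:E) 0%R <= (expR (2 * l ^+ 2 + l * mu))%:E)%E /\
      (gsm cs (fun z => (expR (- l * F z))%:E) 0%R <= (expR (2 * l ^+ 2 - l * mu))%:E)%E].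
Proof.
have gE l := gfun_expR_fmax l.
have F0 z : 0 <= F z by exact: fmax_ge0.
have gF : gfun (fun z : V => (F z)%:E) by apply: gfun_EFin => //; exact: gmeas_fmax.
have gF2 : gfun (fun z : V => (F z ^+ 2)%:E).
  by apply: gfun_EFin => [|z]; [apply: gmeas_sqr; exact: gmeas_fmax | exact: sqr_ge0].
have gC (r : R) : 0 <= r -> gfun (fun _ : V => r%:E).
  by split => [|z]; [exact: gmeas_cst | rewrite lee_fin].
have gZ (G : V -> R) (r : R) : 0 <= r -> gfun (fun z => (G z)%:E) -> gfun (fun z => (r * G z)%:E).
  move=> r0 [mG G0]; split => [k w c|z]; last by rewrite EFinM mule_ge0.
  apply/measurable_EFinP; apply: measurable_funM => //.
  by apply/measurable_EFinP; exact: mG.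
have gZE (G : V -> R) (r m : R) : 0 <= r -> gfun (fun z => (G z)%:E) ->
    gsm cs (fun z => (G z)%:E) 0 = m%:E -> gsm cs (fun z => (r * G z)%:E) 0 = (r * m)%:E.
  by move=> r0 gG Gm; rewrite EFinM -Gm -gsmZl.
have gDE (G H : V -> R) (r m : R) : gfun (fun z => (G z)%:E) -> gfun (fun z => (H z)%:E) ->
    gsm cs (fun z => (G z)%:E) 0 = r%:E -> gsm cs (fun z => (H z)%:E) 0 = m%:E ->
    gsm cs (fun z => (G z + H z)%:E) 0 = (r + m)%:E.
  by move=> gG gH Gr Hm; rewrite EFinD -Gr -Hm -gsmD.
have fin1 := expR_fmax_fin ler01.
have [mu mu0 muE] : exists2 r : R, 0 <= r & gsm cs (fun z => (F z)%:E) 0 = r%:E.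
  apply: (@gsm_fin_le _ (fun z => expR (1 * F z)) 1) => // z.
  by rewrite !mul1r; have := expR_ge1Dx (F z); lra.
have [S S0 SE] : exists2 r : R, 0 <= r & gsm cs (fun z => (F z ^+ 2)%:E) 0 = r%:E.
  apply: (@gsm_fin_le _ (fun z => expR (1 * F z)) 2) => // z; first exact: sqr_ge0.
  by rewrite mul1r; have := @expR_ge1Dxn _ (F z) 1 (F0 z); rewrite (_ : 2`!%:R = 2 :> R)//; lra.
have Q l : 0 <= l -> exists2 q : R,
    gsm cs (fun z => (expR (- l * F z))%:E) 0 = q%:E & expR (- (l * mu)) <= q.
  move=> l0; have [q q0 qE] : exists2 r : R, 0 <= r &
      gsm cs (fun z => (expR (- l * F z))%:E) 0 = r%:E.
    apply: (@gsm_fin_le _ (fun z => 1) 1) => [z|z|||].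
    - exact: expR_ge0.
    - by rewrite mulr1 exp.expR_le1 mulNr oppr_le0 mulr_ge0.
    - exact: (gC 1 ler01).
    - exact: ler01.
    - by exists 1; rewrite gsm_cst.
  exists q => //; set k := expR (- (l * mu)).
  have k0 : 0 <= k := expR_ge0 _.
  have : ((k * (1 + l * mu))%:E <= (q + k * l * mu)%:E)%E.
    rewrite -(gDE _ _ _ _ _ _ qE (gZE _ _ _ _ _ muE)) ?mulr_ge0 ?gE//; last by apply: gZ => //; rewrite mulr_ge0.
    rewrite -[leLHS](gsm_cst cs 0); apply: gsm_le => z.
      by rewrite lee_fin mulr_ge0// addr_ge0// mulr_ge0.
    rewrite lee_fin.
    have -> : expR (- l * F z) = k * expR (l * mu - l * F z).
      by rewrite /k -exp.expRD; congr expR; ring.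
    by have := ler_wpM2l k0 (expR_ge1Dx (l * mu - l * F z)); lra.
  by rewrite lee_fin; lra.
(* Jensen's inequality from the tangent at [mu], arranged, like [Q], so that both sides are
   expectations of nonnegative functions. *)
have P l : 0 <= l -> exists2 q : R,
    gsm cs (fun z => (expR (l * F z))%:E) 0 = q%:E & expR (l * mu) <= q.
  move=> l0; have [q qE] := expR_fmax_fin l0.
  exists q => //; set k := expR (l * mu).
  have k0 : 0 <= k := expR_ge0 _.
  have : ((k + k * l * mu)%:E <= (q + k * (l * mu))%:E)%E.
    have C1 : gsm cs (fun _ => (k * (l * mu))%:E) 0 = (k * (l * mu))%:E by rewrite gsm_cst.
    have C2 : gsm cs (fun _ => k%:E) 0 = k%:E by rewrite gsm_cst.
    have klmu : 0 <= k * (l * mu) by rewrite !mulr_ge0.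
    have kl : 0 <= k * l by rewrite mulr_ge0.
    rewrite -(gDE (fun z => expR (l * F z)) (fun=> k * (l * mu)) _ _ (gE l) (gC _ klmu) qE C1).
    rewrite -(gDE (fun=> k) (fun z => k * l * F z) _ _ (gC _ k0) (gZ _ _ kl gF) C2 (gZE F _ _ kl gF muE)).
    apply: gsm_le => z; first by rewrite lee_fin addr_ge0// mulr_ge0.
    rewrite lee_fin.
    have -> : expR (l * F z) = k * expR (l * F z - l * mu).
      by rewrite /k -exp.expRD; congr expR; ring.
    by have := ler_wpM2l k0 (expR_ge1Dx (l * F z - l * mu)); lra.
  by rewrite lee_fin; lra.
have PQ (l p q : R) : 0 <= l -> gsm cs (fun z => (expR (l * F z))%:E) 0 = p%:E ->
    gsm cs (fun z => (expR (- l * F z))%:E) 0 = q%:E -> p * q <= expR (2 * l ^+ 2).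
  move=> l0 pE qE; rewrite -lee_fin; apply: le_trans (gsm_fmax_pair l0).
  rewrite (gsm_pair_cols cs _ 0 0) /=.
  rewrite [leRHS](_ : _ = gsm cs (fun x => p%:E * (expR (- l * F x))%:E)%E 0); last first.
    congr (gsm _ _ _); apply/funext => x; rewrite -pE muleC -gsmZl ?expR_ge0//.
    congr (gsm _ _ _); apply/funext => y; rewrite -EFinM -exp.expRD; congr (expR _)%:E.
    ring.
  rewrite gsmZl//; first by rewrite qE EFinM.
  by rewrite -lee_fin -pE; apply: gsm_ge0 => z; rewrite lee_fin expR_ge0.
have main l : 0 <= l ->
    (gsm cs (fun z => (expR (l * F z))%:E) 0%R <= (expR (2 * l ^+ 2 + l * mu))%:E)%E /\
    (gsm cs (fun z => (expR (- l * F z))%:E) 0%R <= (expR (2 * l ^+ 2 - l * mu))%:E)%E.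
  move=> l0; have [p pE pl] := P l l0; have [q qE ql] := Q l l0.
  have pq := PQ l p q l0 pE qE; rewrite pE qE !lee_fin.
  have p0 : 0 <= p by apply: le_trans pl; exact: expR_ge0.
  have q0 : 0 <= q by apply: le_trans ql; exact: expR_ge0.
  split.
    rewrite [leLHS](_ : _ = expR (l * mu) * (expR (- (l * mu)) * p)); last first.
      by rewrite mulrA expRxMexpNx_1 mul1r.
    rewrite addrC exp.expRD ler_wpM2l ?expR_ge0//; apply: le_trans pq.
    by rewrite mulrC ler_wpM2l.
  rewrite [leLHS](_ : _ = expR (- (l * mu)) * (expR (l * mu) * q)); last first.
    by rewrite mulrA [_ * expR (l * mu)]mulrC expRxMexpNx_1 mul1r.
  rewrite addrC exp.expRD ler_wpM2l ?expR_ge0//; apply: le_trans pq.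
  by rewrite ler_wpM2r.
exists mu, S; split => //.
- have : ((2 * mu * mu)%:E <= (S + mu ^+ 2)%:E)%E.
    have C1 : gsm cs (fun _ => (mu ^+ 2)%:E) 0 = (mu ^+ 2)%:E by rewrite gsm_cst.
    have mu2 : 0 <= 2 * mu by rewrite mulr_ge0.
    rewrite -(gZE F _ _ mu2 gF muE) -(gDE (fun z => F z ^+ 2) (fun=> mu ^+ 2) _ _ gF2 (gC _ (sqr_ge0 mu)) SE C1).
    apply: gsm_le => z; rewrite lee_fin ?mulr_ge0//.
    by have := sqr_ge0 (F z - mu); rewrite !expr2; lra.
  by rewrite lee_fin expr2; lra.
have [p pE _] := P 1 ler01; have [q qE _] := Q 1 ler01.
have [] := main 1 ler01; rewrite pE qE !lee_fin !expr1n !mulr1 !mul1r => p1 q1.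
set k := expR mu; set k' := expR (- mu).
have kk : k * k' = 1 by exact: expRxMexpNx_1.
have k0 : 0 <= k := expR_ge0 _; have k'0 : 0 <= k' := expR_ge0 _.
(* The variance is bounded by the centred exponential moments at 1 and -1, through [u ^+ 2 + 2 <= 2
   * expR u + 2 * expR (- u)]. *)
have var : S + mu ^+ 2 + 2 <= 2 * mu * mu + (2 * k' * p + 2 * k * q).
  have mu2 : 0 <= 2 * mu by rewrite mulr_ge0.
  have k2 : 0 <= 2 * k by rewrite mulr_ge0.
  have k'2 : 0 <= 2 * k' by rewrite mulr_ge0.
  have C2 : gsm cs (fun _ => (mu ^+ 2 + 2)%:E) 0 = (mu ^+ 2 + 2)%:E by rewrite gsm_cst.
  have C20 : 0 <= mu ^+ 2 + 2 by rewrite addr_ge0// sqr_ge0.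
  have gpq : gfun (fun z : V => (2 * k' * expR (1 * F z) + 2 * k * expR (-1 * F z))%:E).
    apply: gfun_EFin => [|z]; last by rewrite addr_ge0// mulr_ge0 ?expR_ge0.
    by apply: gmeasD; apply: gmeasM; try exact: gmeas_cst; exact: gmeas_expR_fmax.
  rewrite -addrA -lee_fin -(gDE (fun z => F z ^+ 2) (fun=> mu ^+ 2 + 2) _ _ gF2 (gC _ C20) SE C2).
  rewrite -(gDE (fun z => 2 * mu * F z)
    (fun z => 2 * k' * expR (1 * F z) + 2 * k * expR (-1 * F z)) _ _
    (gZ _ _ mu2 gF) gpq (gZE F _ _ mu2 gF muE)
    (gDE (fun z => 2 * k' * expR (1 * F z)) (fun z => 2 * k * expR (-1 * F z)) _ _
       (gZ _ _ k'2 (gE 1)) (gZ _ _ k2 (gE (-1)))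
       (gZE (fun z => expR (1 * F z)) _ _ k'2 (gE 1) pE)
       (gZE (fun z => expR (-1 * F z)) _ _ k2 (gE (-1)) qE))).
  apply: gsm_le => z; first by rewrite lee_fin addr_ge0// sqr_ge0.
  rewrite lee_fin mul1r mulN1r.
  have -> : 2 * k' * expR (F z) = 2 * expR (F z - mu) by rewrite -mulrA -exp.expRD addrC.
  have -> : 2 * k * expR (- F z) = 2 * expR (- (F z - mu)).
    by rewrite -mulrA -exp.expRD opprB.
  have sq (u : R) : u ^+ 2 + 2 <= 2 * expR u + 2 * expR (- u).
    wlog u0 : u / 0 <= u => [hw|].
      have [|u0] := leP 0 u; first exact: hw.
      by have := hw (- u); rewrite opprK sqrrN oppr_ge0 => /(_ (ltW u0)); lra.
    have := @expR_ge1Dxn _ u 1 u0; rewrite (_ : 2`!%:R = 2 :> R)// => h1.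
    by have := expR_ge0 (- u); lra.
  by have := sq (F z - mu); rewrite !expr2; lra.
have k'p : k' * p <= expR 2.
  apply: (@le_trans _ _ (k' * expR (2 + mu))); first by rewrite ler_wpM2l.
  by rewrite exp.expRD mulrCA [k' * _]mulrC kk mulr1.
have kq : k * q <= expR 2.
  apply: (@le_trans _ _ (k * expR (2 - mu))); first by rewrite ler_wpM2l.
  by rewrite exp.expRD mulrCA kk mulr1.
have e2 : expR 2 <= 10 :> R.
  have h : expR (2 : R) = (expR (- 4^-1))^-1 ^+ 8.
    by rewrite -expRN -expRM_natl; congr expR; field.
  have h1 : (expR (- 4^-1))^-1 <= 4 / 3 :> R.
    rewrite -[leRHS]invrK lef_pV2 ?posrE ?expR_gt0 ?invr_gt0 ?divr_gt0//.
    by apply: le_trans (expR_ge1Dx _); rewrite invf_div; lra.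
  rewrite h; apply: (@le_trans _ _ ((4 / 3) ^+ 8)).
    by apply: lerXn2r => //; rewrite nnegrE ?invr_ge0 ?expR_ge0 ?divr_ge0.
  by lra.
(* With [expR 2 <= 10] the bound reads [S <= mu ^+ 2 + 38], and 38 is below 49. *)
have S7 : S <= (mu + 7) ^+ 2 by rewrite expr2; rewrite expr2 in var; nra.
by rewrite -[leRHS]ger0_norm ?addr_ge0// -sqrtr_sqr ler_sqrt// sqr_ge0.
Qed.

End concentration.

Lemma gsm_affine (R : realType) (V W : lmodType R) (M : {linear V -> W})
    (cs : seq V) (F : W -> \bar R) (w : W) (x : V) :
  gsm (map M cs) F (w + M x) = gsm cs (fun x' => F (w + M x')) x.
Proof.
elim: cs x => //= c cs IH x; rewrite /gsm1; apply: eq_integral => y _.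
by rewrite -IH -addrA linearD linearZ.
Qed.

(** * Escape through a mesh *)

Section escape.
Context {R : realType} {I J : finType}.
Local Notation VI := {ffun I -> R}.
Local Notation VJ := {ffun J -> R}.
Local Notation V := {ffun I * J -> R}.

Definition embJ (g : VJ) : V := [ffun a => g a.2].
Definition embI (h : VI) : V := [ffun a => - h a.1].

Lemma embJ_linear : linear embJ.
Proof. by move=> k g g'; apply/ffunP => a; rewrite !ffunE. Qed.

Lemma embI_linear : linear embI.
Proof.
by move=> k h h'; apply/ffunP => a; rewrite !ffunE opprD -scalerN.
Qed.

HB.instance Definition _ := GRing.isLinear.Build R VJ V _ embJ embJ_linear.
HB.instance Definition _ := GRing.isLinear.Build R VI V _ embI embI_linear.

Lemma gcov_embJ (cs : seq VJ) a b : gcov (map embJ cs) a b = gcov cs a.2 b.2.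
Proof. by rewrite /gcov big_map; apply: eq_bigr => c _; rewrite !ffunE. Qed.

Lemma gcov_embI (cs : seq VI) a b : gcov (map embI cs) a b = gcov cs a.1 b.1.
Proof. by rewrite /gcov big_map; apply: eq_bigr => c _; rewrite !ffunE mulrNN. Qed.

Lemma gcov_le1 (A : finType) (cs : seq {ffun A -> R}) a b :
  (forall a, gcov cs a a = 1) -> gcov cs a b <= 1.
Proof.
move=> u1; have h : gcov cs a b *+ 2 <= gcov cs a a + gcov cs b b.
  rewrite /gcov -sumrMnl -big_split /=; apply: ler_sum => c _.
  by have := sqr_ge0 (c a - c b); rewrite expr2 mulr2n; lra.
by rewrite !u1 mulr2n in h; lra.
Qed.

Lemma fmax_ge (A : finType) (s : seq A) (u : {ffun A -> R}) a :
  a \in s -> u a <= fmax s u.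
Proof.
elim: s => //= b s IH; rewrite inE le_max => /predU1P[->|/IH ->]; last by rewrite orbT.
by rewrite lexx.
Qed.

Lemma fmax_lt (A : finType) (s : seq A) (u : {ffun A -> R}) (m : R) :
  0 < m -> (forall a, u a < m) -> fmax s u < m.
Proof. by move=> m0 um; elim: s => //= a s IH; rewrite gt_max um. Qed.

(** Chernoff's bound before integration: a failure forces [fmax] of [g] below [fmax] of [h] plus
    [c]. Positivity of [c] covers the base value 0 of [fmax]. *)
Lemma fails_expR (c l : R) (g : VJ) (h : VI) : 0 < c -> 0 <= l ->
  (failsE c (embJ g + embI h)%R <=
   (expR (l * c) * (expR (l * fmax (enum I) h) * expR (- l * fmax (enum J) g)))%:E)%E.
Proof.
move=> c0 l0; rewrite lee_fin -!exp.expRD.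
case: (boolP (reaches _ _)) => /= [_|]; first exact: expR_ge0.
rewrite negb_forall => /existsP[i]; rewrite negb_exists => /forallP hi.
rewrite -[leLHS]exp.expR0 ler_expR.
have : fmax (enum J) g < fmax (enum I) h + c.
  apply: fmax_lt; first by rewrite ltr_wpDl ?fmax_ge0.
  move=> j; have := hi j; rewrite -ltNge !ffunE /= => H.
  by have := @fmax_ge _ (enum I) h i (mem_enum _ _); lra.
move=> H; have -> : l * c + (l * fmax (enum I) h + - l * fmax (enum J) g) =
  l * (fmax (enum I) h + c - fmax (enum J) g) by ring.
by rewrite mulr_ge0// subr_ge0 ltW.
Qed.

Theorem gordon_escape (cX : seq VI) (cV : seq VJ) (cZ : seq V) (SX SV t : R) :
  (forall i, gcov cX i i = 1) -> (forall j, gcov cV j j = 1) ->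
  (forall a b, gcov cZ a b = gcov cX a.1 b.1 * gcov cV a.2 b.2) ->
  gsm cX (fun z => (fmax (enum I) z ^+ 2)%:E) 0 = SX%:E ->
  gsm cV (fun z => (fmax (enum J) z ^+ 2)%:E) 0 = SV%:E ->
  1 <= t -> Num.sqrt SX + 18 * Num.sqrt t <= Num.sqrt SV ->
  (gsm cZ (failsE (4^-1)) 0%R <= (expR (- t) / 2)%:E)%E.
Proof.
move=> X1 V1 covZ SXE SVE t1 gap.
have X1' i : gcov cX i i <= 1 by rewrite X1.
have V1' j : gcov cV j j <= 1 by rewrite V1.
have [muX [SX' [muX0 muSX _ SXE' concX]]] :=
  @gsm_fmax_conc R I cX X1' (enum I).
have [muV [SV' [muV0 _ muSV SVE' concV]]] :=
  @gsm_fmax_conc R J cV V1' (enum J).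
have [eX] : SX'%:E = SX%:E :> \bar R by rewrite -SXE' SXE.
have [eV] : SV'%:E = SV%:E :> \bar R by rewrite -SVE' SVE.
rewrite {}eX in muSX; rewrite {}eV in muSV.
pose l := Num.sqrt t.
have l1 : 1 <= l by rewrite -[leLHS]sqrtr1 ler_sqrt//; lra.
have l0 : 0 <= l by lra.
have l2 : l ^+ 2 = t by rewrite sqr_sqrtr//; lra.
have muXs : muX <= Num.sqrt SX.
  by rewrite -[leLHS]ger0_norm// -sqrtr_sqr ler_sqrt// (le_trans _ muSX)// sqr_ge0.
pose ys := map embJ cV ++ map embI cX.
have covY a b : gcov ys a b = gcov cV a.2 b.2 + gcov cX a.1 b.1.
  by rewrite gcov_cat gcov_embJ gcov_embI.
have d4 : 0 < 4^-1 :> R by rewrite invr_gt0.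
have ysE : (gsm ys (failsE (4^-1 + 4^-1 + 4^-1)) 0%R <= (expR (- (6 * t)))%:E)%E.
  have -> : gsm ys (failsE (4^-1 + 4^-1 + 4^-1)) 0 = gsm cV (fun g => gsm cX (fun h =>
      failsE (4^-1 + 4^-1 + 4^-1) (embJ g + embI h)) 0) 0.
    rewrite /ys gsm_cat -[X in gsm _ _ X](_ : 0 + embJ 0 = 0); last first.
      by rewrite linear0 addr0.
    rewrite (gsm_affine embJ); congr (gsm _ _ _); apply/funext => g.
    by rewrite add0r -[X in gsm _ _ X](_ : embJ g + embI 0 = embJ g) ?(gsm_affine embI)//
      linear0 addr0.
  pose k := expR (l * (4^-1 + 4^-1 + 4^-1)).
  have k0 : 0 <= k := expR_ge0 _.
  have [cX1 _] := concX l l0; have [_ cV1] := concV l l0.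
  apply: (@le_trans _ _ (gsm cV (fun g => (k * expR (2 * l ^+ 2 + l * muX))%:E *
      (expR (- l * fmax (enum J) g))%:E)%E 0)).
    apply: gsm_le => g; first by apply: gsm_ge0 => h; rewrite lee_fin.
    apply: (@le_trans _ _ (gsm cX (fun h => (k * expR (- l * fmax (enum J) g))%:E *
       (expR (l * fmax (enum I) h))%:E)%E 0)).
      apply: gsm_le => h; first by rewrite lee_fin.
      apply: le_trans (fails_expR _ _ _ l0) _; first by rewrite !addr_gt0.
      by rewrite -EFinM lee_fin /k -!mulrA [X in _ * X]mulrC.
    rewrite gsmZl ?mulr_ge0 ?expR_ge0//; last exact: gfun_expR_fmax.
    rewrite [leRHS](_ : _ = (k * expR (- l * fmax (enum J) g))%:E *
      (expR (2 * l ^+ 2 + l * muX))%:E)%E; last by rewrite -!EFinM; congr EFin; ring.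
    by apply: lee_wpmul2l => //; rewrite lee_fin mulr_ge0 ?expR_ge0.
  rewrite gsmZl ?mulr_ge0 ?expR_ge0//; last exact: gfun_expR_fmax.
  apply: (@le_trans _ _ ((k * expR (2 * l ^+ 2 + l * muX))%:E *
     (expR (2 * l ^+ 2 - l * muV))%:E)%E).
    by apply: lee_wpmul2l => //; rewrite lee_fin mulr_ge0 ?expR_ge0.
  rewrite -EFinM lee_fin /k -!exp.expRD ler_expR.
  (* The exponent is 3l/4 + 4l^2 + l(muX - muV), where muX - muV <= 7 - 18l; since l >= 1 it is at
     most -6l^2. *)
  by rewrite -l2; rewrite -/l in gap; nra.
have h := @gordon R I J cZ ys 4^-1 4^-1 _ d4 (expR_gt0 (- (6 * t))).
apply: le_trans (h _ _) _.
(* The difference of the covariances is (1 - a)(1 - b), with both correlations at most 1. *)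
- move=> a b; rewrite covY covZ.
  have := gcov_le1 a.1 b.1 X1; have := gcov_le1 a.2 b.2 V1; nra.
- by move=> a b ab; rewrite covY covZ ab X1 mul1r.
apply: (@le_trans _ _ (4%:E * (expR (- (6 * t)))%:E + (expR (- (6 * t)))%:E)%E).
  by apply: leeD => //; apply: lee_wpmul2l.
rewrite -EFinM -EFinD lee_fin.
have -> : - (6 * t) = - t + - (5 * t) by ring.
rewrite exp.expRD.
(* The total is five times [expR (- (6 * t))], so a factor 1/10 leaves half of [expR (- t)]. *)
have e5 : expR (- (5 * t)) <= 10^-1.
  rewrite expRN lef_pV2 ?posrE ?expR_gt0//.
  apply: le_trans (@expR_ge1Dxn _ _ 1 _); last by lra.
  by rewrite (_ : 2`!%:R = 2 :> R)// expr2; nra.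
have := expR_ge0 (- t); nra.
Qed.

End escape.

(** * Euclidean geometry of cones *)

Section euclid.
Context {R : realType} {n : nat}.
Implicit Types (u v w x y z : 'cV[R]_n).

Definition dot u v : R := \sum_(i < n) u i 0 * v i 0.

Definition sqn u : R := \sum_(i < n) u i 0 ^+ 2.

Lemma sqnE u : sqn u = dot u u.
Proof. by apply: eq_bigr => i _; rewrite expr2. Qed.

Lemma dotC u v : dot u v = dot v u.
Proof. by apply: eq_bigr => i _; rewrite mulrC. Qed.

Lemma dotDl u v w : dot (u + v) w = dot u w + dot v w.
Proof. by rewrite -big_split; apply: eq_bigr => i _; rewrite mxE mulrDl. Qed.

Lemma dotZl (a : R) u w : dot (a *: u) w = a * dot u w.
Proof. by rewrite mulr_sumr; apply: eq_bigr => i _; rewrite mxE mulrA. Qed.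

Lemma dotNl u w : dot (- u) w = - dot u w.
Proof. by rewrite -scaleN1r dotZl mulN1r. Qed.

Lemma dotBl u v w : dot (u - v) w = dot u w - dot v w.
Proof. by rewrite dotDl dotNl. Qed.

Lemma dotDr u v w : dot w (u + v) = dot w u + dot w v.
Proof. by rewrite !(dotC w) dotDl. Qed.

Lemma dotZr (a : R) u w : dot w (a *: u) = a * dot w u.
Proof. by rewrite !(dotC w) dotZl. Qed.

Lemma dotNr u w : dot w (- u) = - dot w u.
Proof. by rewrite !(dotC w) dotNl. Qed.

Lemma dotBr u v w : dot w (u - v) = dot w u - dot w v.
Proof. by rewrite !(dotC w) dotBl. Qed.

Lemma dot0l w : dot 0 w = 0.
Proof. by rewrite -(scale0r 0) dotZl mul0r. Qed.

Lemma sqn_ge0 u : 0 <= sqn u.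
Proof. by apply: sumr_ge0 => i _; exact: sqr_ge0. Qed.

Lemma sqn_eq0 u : sqn u = 0 -> u = 0.
Proof.
move=> /eqP; rewrite psumr_eq0 => [/allP h|i _]; last exact: sqr_ge0.
apply/matrixP => i j; rewrite (ord1 j) mxE; apply/eqP; rewrite -sqrf_eq0.
by apply: h; rewrite mem_index_enum.
Qed.

Lemma sqn0 : sqn (0 : 'cV[R]_n) = 0.
Proof. by rewrite sqnE dot0l. Qed.

Lemma sqnZ (a : R) u : sqn (a *: u) = a ^+ 2 * sqn u.
Proof. by rewrite !sqnE dotZl dotZr mulrA expr2. Qed.

Lemma sqnD u v : sqn (u + v) = sqn u + 2 * dot u v + sqn v.
Proof. by rewrite !sqnE dotDl !dotDr (dotC v u); ring. Qed.

Lemma sqnB u v : sqn (u - v) = sqn u - 2 * dot u v + sqn v.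
Proof. by rewrite sqnD dotNr !sqnE dotNl dotNr; ring. Qed.

Lemma dot_CS u v : dot u v ^+ 2 <= sqn u * sqn v.
Proof.
have [u0|u0] := eqVneq (sqn u) 0.
  by rewrite u0 mul0r (sqn_eq0 u0) dot0l expr0n.
have up : 0 < sqn u by rewrite lt_def u0 sqn_ge0.
have := sqn_ge0 (sqn u *: v - dot u v *: u).
rewrite sqnB !sqnZ dotZl dotZr (dotC v u).
have -> : sqn u ^+ 2 * sqn v - 2 * (sqn u * (dot u v * dot u v)) +
   dot u v ^+ 2 * sqn u = sqn u * (sqn u * sqn v - dot u v ^+ 2) by ring.
by rewrite pmulr_rge0// subr_ge0.
Qed.

Lemma sum_continuous (T : topologicalType) (I : Type) (r : seq I) (f : I -> T -> R) :
  (forall i, continuous (f i)) -> continuous (fun t => \sum_(i <- r) f i t).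
Proof.
move=> cf; elim: r => [|i r IH] t.
  by under eq_fun do rewrite big_nil; exact: cst_continuous.
under eq_fun do rewrite big_cons.
by apply: continuousD; [exact: cf | exact: IH].
Qed.

Lemma sqnB_continuous z : continuous (fun x => sqn (x - z)).
Proof.
apply: sum_continuous => i t.
under eq_fun do rewrite !mxE expr2.
have c : {for t, continuous (fun x => x i 0 - z i 0)}.
  apply: (@continuousB _ _ _ (fun x : 'cV[R]_n => x i 0) (fun=> z i 0) t).
    exact: coord_continuous.
  exact: cst_continuous.
exact: (@continuousM _ _ (fun x => x i 0 - z i 0) (fun x => x i 0 - z i 0) t c c).
Qed.

Lemma sqn_continuous : continuous (@sqn).
Proof. by move=> x; have := @sqnB_continuous 0 x; under eq_fun do rewrite subr0. Qed.

Lemma trmx_continuous (m : nat) : continuous (fun r : 'M[R]_(m, n) => r^T).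
Proof.
move=> /= M s /= /(nbhs_ballP (M^T)) [e e0 es].
apply/nbhs_ballP; exists e => //= N [e' MN]; apply: es; split => // i j.
by rewrite !mxE.
Qed.

Lemma cV_compact (A : set 'cV[R]_n) (B : R) :
  closed A -> (forall x, A x -> sqn x <= B) -> compact A.
Proof.
move=> cA AB; pose A' := [set r : 'rV[R]_n | A r^T].
have -> : A = (fun r : 'rV[R]_n => r^T) @` A'.
  apply/seteqP; split => [x Ax|_ [r Ar <-]//].
  by exists x^T; rewrite /A' /= ?trmxK.
apply: continuous_compact; first exact/continuous_subspaceT/trmx_continuous.
apply: bounded_closed_compact; last first.
  by apply: (preimage_closed _ cA) => r _; exact: trmx_continuous.
exists (B + 1); split; first exact: num_real.
move=> M BM r /AB rB; rewrite /Num.norm /= mx_normrE.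
apply/bigmax_leP; split => [|[i j] _ /=].
  by apply: le_trans (ltW BM); rewrite addr_ge0// (le_trans _ rB)// sqn_ge0.
apply: le_trans (ltW BM).
have h : (r i j) ^+ 2 <= B.
  apply: le_trans rB; rewrite /sqn (bigD1 j)//= mxE (ord1 i) lerDl.
  by apply: sumr_ge0 => k _; exact: sqr_ge0.
have := real_normK (num_real (r i j)); rewrite -normrX.
have := sqr_ge0 (`|r i j| - 1); rewrite !expr2.
have : `|r i j| * `|r i j| <= B by rewrite -normrM -expr2 ger0_norm// sqr_ge0.
by have := normr_ge0 (r i j); nra.
Qed.

Lemma sphere_net (D : set 'cV[R]_n) (e : R) : closed D -> 0 < e ->
  exists s : seq 'cV[R]_n, (forall x, x \in s -> D x /\ sqn x = 1) /\
    forall y, D y -> sqn y = 1 -> exists2 x, x \in s & sqn (y - x) <= e.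
Proof.
move=> cD e0; pose S := D `&` [set x | sqn x = 1].
have cS : compact S.
  apply: (@cV_compact _ 1) => [|x [_ ->]//].
  apply: closedI => //; apply: (@preimage_closed _ _ (@sqn) [set 1]) => [x _|].
    exact: sqn_continuous.
  exact: closed_eq.
move: cS; rewrite compact_cover => /(_ _ S (fun x => [set y | sqn (y - x) < e])) [].
- move=> x _; apply: (@open_comp _ _ (fun y => sqn (y - x)) [set r | r < e]) => [y _|].
    exact: sqnB_continuous.
  exact: open_lt.
- by move=> x Sx; exists x => //=; rewrite subrr sqn0.
move=> s sS cov; exists (finmap.enum_fset s); split => [x xs|y Dy y1].
  by have := sS x xs; rewrite inE => -[].
have /cov [x xs yx] : S y by [].
by exists x => //; exact: ltW.
Qed.

End euclid.

(** * Least squares over a closed convex cone *)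

Section cones.
Context {R : realType}.

Definition cvx_cone n (K : set 'cV[R]_n) : Prop :=
  [/\ K 0, closed K, (forall x (a : R), K x -> 0 <= a -> K (a *: x)) &
      (forall x y, K x -> K y -> K (x + y))].

(** The first-order condition at a minimum, where a small step [s] makes the quadratic term
    negligible. *)
Lemma quad_le0 (x y : R) : (forall s : R, 0 < s <= 1 -> 2 * s * x <= s ^+ 2 * y) ->
  x <= 0.
Proof.
move=> h; rewrite leNgt; apply/negP => x0.
have [yx|xy] := leP y x.
  by have := h 1; rewrite ltr01 lexx expr1n => /(_ isT); lra.
have y0 : 0 < y by lra.
have : 0 < x / y <= 1 by rewrite divr_gt0//= ler_pdivrMr// mul1r ltW.
move=> /h; have -> : (x / y) ^+ 2 * y = x / y * x by field; rewrite gt_eqF.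
have : 0 < x / y * x by rewrite mulr_gt0// divr_gt0.
have -> : 2 * (x / y) * x = 2 * (x / y * x) by ring.
by lra.
Qed.

Section least_squares.
Context {p q : nat}.
Variables (D : set 'cV[R]_p) (M : 'M[R]_(q, p)).
Hypothesis coneD : cvx_cone D.
Hypothesis kerD : forall x, D x -> M *m x = 0 -> x = 0.

Lemma mulmxB_continuous (z : 'cV[R]_q) : continuous (fun x => sqn (M *m x - z)).
Proof.
apply: sum_continuous => i t.
under eq_fun do rewrite !mxE expr2.
have c : {for t, continuous (fun x : 'cV[R]_p => \sum_j M i j * x j 0 - z i 0)}.
  apply: (@continuousB _ _ _ (fun x : 'cV[R]_p => \sum_j M i j * x j 0) (fun=> z i 0) t).
    apply: sum_continuous => j u.
    apply: continuousM; first exact: cst_continuous.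
    exact: coord_continuous.
  exact: cst_continuous.
exact: (@continuousM _ _ _ _ t c c).
Qed.

(** [M] is injective at 0 on the cone only, so its minimum on the compact unit part of [D] is
    positive. This makes least squares over [D] attain their minimum. *)
Lemma cone_coercive : exists2 k : R, 0 < k & forall x, D x -> k * sqn x <= sqn (M *m x).
Proof.
have [D0 clD sD aD] := coneD.
pose S := D `&` [set x | sqn x = 1].
have clS : closed S.
  apply: closedI => //; apply: (@preimage_closed _ _ (@sqn R p) [set 1]) => [x _|].
    exact: sqn_continuous.
  exact: closed_eq.
have [S0|SN0] := pselect (S = set0).
  exists 1 => // x Dx; have [x0|xN0] := eqVneq (sqn x) 0.
    by rewrite x0 mulr0 sqn_ge0.
  have : S ((Num.sqrt (sqn x))^-1 *: x).
    split => /=; first by apply: sD => //; rewrite invr_ge0 sqrtr_ge0.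
    by rewrite sqnZ exprVn sqr_sqrtr ?sqn_ge0// mulVf.
  by rewrite S0.
have /set0P SS : S != set0 by apply/eqP.
have cS : compact S by apply: (@cV_compact _ _ _ 1) => // x [_ ->].
have cf : continuous (fun x => sqn (M *m x)).
  by have := @mulmxB_continuous 0; under eq_fun do rewrite subr0.
have [c] := compact_EVT_min SS cS (continuous_subspaceT cf).
rewrite inE => -[Dc c1] cmin; exists (sqn (M *m c)).
  rewrite lt_def sqn_ge0 andbT; apply/eqP => /sqn_eq0/(kerD Dc) c0.
  by move: c1; rewrite c0 /= sqn0 => /eqP; rewrite eq_sym oner_eq0.
move=> x Dx; have [x0|xN0] := eqVneq (sqn x) 0.
  by rewrite x0 mulr0 sqn_ge0.
have xp : 0 < sqn x by rewrite lt_def xN0 sqn_ge0.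
have Sx : S ((Num.sqrt (sqn x))^-1 *: x).
  split => /=; first by apply: sD => //; rewrite invr_ge0 sqrtr_ge0.
  by rewrite sqnZ exprVn sqr_sqrtr ?sqn_ge0// mulVf.
have := cmin _ (mem_set Sx).
by rewrite -scalemxAr sqnZ exprVn sqr_sqrtr ?sqn_ge0// mulrC ler_pdivlMr.
Qed.

Lemma cone_lsq_min (z : 'cV[R]_q) : exists2 d, D d &
  forall d', D d' -> sqn (M *m d - z) <= sqn (M *m d' - z).
Proof.
have [D0 clD sD aD] := coneD; have [k k0 kM] := cone_coercive.
(* Outside this ball the residual is at least the one at 0. *)
pose B := 4 * sqn z / k.
pose E := D `&` [set x | sqn x <= B].
have clE : closed E.
  apply: closedI => //; apply: (@preimage_closed _ _ (@sqn R p) [set x | x <= B]) => [x _|].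
    exact: sqn_continuous.
  exact: closed_le.
have E0 : E 0 by split => //=; rewrite sqn0 divr_ge0 ?mulr_ge0 ?sqn_ge0// ltW.
have cE : compact E by apply: (@cV_compact _ _ _ B) => // x [].
have [d] := compact_EVT_min (ex_intro _ 0 E0) cE
  (continuous_subspaceT (@mulmxB_continuous z)).
rewrite inE => -[Dd _] dmin; exists d => // d' Dd'.
have [dB|dB] := leP (sqn d') B; first by apply: dmin; rewrite inE.
apply: le_trans (dmin 0 (mem_set E0)) _.
rewrite mulmx0 sub0r [leLHS]sqnE dotNl dotNr opprK -sqnE.
have h1 : 4 * sqn z <= sqn (M *m d').
  apply: le_trans (kM _ Dd').
  have -> : 4 * sqn z = k * B by rewrite /B [RHS]mulrC divfK// gt_eqF.
  by rewrite ler_wpM2l// ltW.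
have h2 : sqn (M *m d') <= 2 * sqn (M *m d' - z) + 2 * sqn z.
  rewrite -[X in sqn X <= _](subrK z (M *m d')) sqnD.
  by have := sqn_ge0 (M *m d' - z - z); rewrite sqnB; lra.
by lra.
Qed.

Lemma cone_lsq (z : 'cV[R]_q) : exists2 d, D d &
  dot (z - M *m d) (M *m d) = 0 /\ forall d', D d' -> dot (z - M *m d) (M *m d') <= 0.
Proof.
have [D0 clD sD aD] := coneD.
have [d Dd dmin] := cone_lsq_min z; exists d => //.
have var (w : 'cV[R]_p) : (forall s : R, 0 < s <= 1 -> D (d + s *: w)) ->
    dot (z - M *m d) (M *m w) <= 0.
  move=> Dw; apply: (@quad_le0 _ (sqn (M *m w))) => s s01.
  have := dmin _ (Dw s s01); rewrite mulmxDr -scalemxAr addrAC [leRHS]sqnD sqnZ dotZr.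
  by rewrite -(opprB z) dotNl; lra.
have le0 d' : D d' -> dot (z - M *m d) (M *m d') <= 0.
  move=> Dd'; apply: var => s /andP[s0 _]; apply: aD => //; apply: sD => //; exact: ltW.
split => //; apply/eqP; rewrite eq_le le0//=.
(* The direction [- d] is admissible because [d - s *: d] is a nonnegative multiple of [d] for
   [s <= 1]. *)
have := var (- d); rewrite mulmxN dotNr oppr_le0; apply => s /andP[s0 s1].
by rewrite scalerN -{1}(scale1r d) -scalerBl; apply: sD => //; rewrite subr_ge0.
Qed.

End least_squares.

End cones.

(** * Gaussian matrices *)

Section gaussian_matrix.
Context {R : realType}.

Definition gbasis p q : seq 'M[R]_(p, q) :=
  [seq delta_mx a.1 a.2 | a <- enum {: 'I_p * 'I_q}].

Lemma big_gbasis p q (F : 'M[R]_(p, q) -> R) :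
  \sum_(c <- gbasis p q) F c = \sum_i \sum_j F (delta_mx i j).
Proof.
by rewrite big_map big_enum /= -(pair_bigA _ (fun i j => F (delta_mx i j))).
Qed.

Section bilinear.
Context {p q : nat} {A : finType}.
Variables (u : A -> 'cV[R]_p) (w : A -> 'cV[R]_q).

Definition bil (G : 'M[R]_(p, q)) : {ffun A -> R} :=
  [ffun a => dot (u a) (G *m w a)].

Lemma bil_linear : linear bil.
Proof.
move=> k G H; apply/ffunP => a.
by rewrite !ffunE mulmxDl -scalemxAl dotDr dotZr.
Qed.

HB.instance Definition _ := GRing.isLinear.Build R _ _ _ bil bil_linear.

Lemma bil_delta i j a : bil (delta_mx i j) a = u a i 0 * w a j 0.
Proof.
rewrite ffunE /dot (bigD1 i)//= [X in _ + X]big1 ?addr0 => [|k ki].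
  rewrite mxE (bigD1 j)//= [X in _ + X]big1 ?addr0 => [|l lj].
    by rewrite mxE !eqxx mul1r.
  by rewrite mxE (negbTE lj) andbF mul0r.
rewrite mxE big1 ?mulr0// => l _.
by rewrite mxE (negbTE ki) mul0r.
Qed.

Lemma gcov_bil a b :
  gcov (map bil (gbasis p q)) a b = dot (u a) (u b) * dot (w a) (w b).
Proof.
rewrite /gcov big_map big_gbasis /dot mulr_suml; apply: eq_bigr => i _.
rewrite mulr_sumr; apply: eq_bigr => j _.
by rewrite !bil_delta; ring.
Qed.

End bilinear.

Fact entry_scalar p q (a : 'I_p * 'I_q) : scalar (fun G : 'M[R]_(p, q) => G a.1 a.2).
Proof. by move=> k G H; rewrite !mxE. Qed.

Definition entryf p q (a : 'I_p * 'I_q) : {scalar 'M[R]_(p, q)} :=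
  HB.pack (fun G : 'M[R]_(p, q) => G a.1 a.2)
    (GRing.isLinear.Build R 'M[R]_(p, q) R *%R _ (entry_scalar a)).

Definition fnorm2 p q (G : 'M[R]_(p, q)) : R := \sum_(a : 'I_p * 'I_q) G a.1 a.2 ^+ 2.

Lemma fnorm2_ge0 p q (G : 'M[R]_(p, q)) : 0 <= fnorm2 G.
Proof. by apply: sumr_ge0 => a _; exact: sqr_ge0. Qed.

Lemma gmeas_fnorm2 p q : gmeas (@fnorm2 p q).
Proof.
have h (a : 'I_p * 'I_q) : gmeas (fun G : 'M[R]_(p, q) => G a.1 a.2 ^+ 2).
  by apply: gmeas_sqr; exact: (gmeas_form (entryf a)).
exact: (@gmeas_sum _ _ _ (index_enum {: 'I_p * 'I_q}) _ h).
Qed.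

Lemma gfun_fnorm2 p q (k : R) : 0 <= k ->
  gfun (fun G : 'M[R]_(p, q) => (k * fnorm2 G)%:E).
Proof.
move=> k0; apply: gfun_EFin => [|G]; last by rewrite mulr_ge0// fnorm2_ge0.
by apply: gmeasM; [exact: gmeas_cst | exact: gmeas_fnorm2].
Qed.

Lemma gsm_fnorm2 p q (k : R) : 0 <= k ->
  gsm (gbasis p q) (fun G => (k * fnorm2 G)%:E) 0 = (k * (p * q)%:R)%:E.
Proof.
move=> k0.
rewrite (_ : (fun G => _) = fun G => (k%:E * (fnorm2 G)%:E)%E)//.
have g1 : gfun (fun G : 'M[R]_(p, q) => (fnorm2 G)%:E).
  by have := @gfun_fnorm2 p q 1 ler01; under eq_fun do rewrite mul1r.
rewrite gsmZl// EFinM; congr (_ * _)%E.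
rewrite (_ : (fun G => _) = fun G => (\sum_(a <- index_enum {: 'I_p * 'I_q})
   (entryf a G + 0) ^+ 2)%:E); last first.
  by apply/funext => G; congr EFin; apply: eq_bigr => a _; rewrite addr0.
rewrite (gsm_sum_sqr _ (@entryf p q)); congr EFin.
transitivity (\sum_(a : 'I_p * 'I_q) (1 : R)); last first.
  by rewrite sumr_const card_prod !card_ord.
apply: eq_bigr => a _; rewrite linear0 addr0 expr0n add0r big_gbasis.
rewrite (bigD1 a.1)//= (bigD1 a.2)//= !mxE !eqxx expr1n.
rewrite [X in _ + X + _]big1 => [|j ja]; last by rewrite mxE eqxx eq_sym (negbTE ja) expr0n.
rewrite [X in _ + X]big1 ?addr0// => i ia.
by rewrite big1// => j _; rewrite mxE eq_sym (negbTE ia) expr0n.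
Qed.

(** As [E] is an arbitrary set, its indicator is bounded below by the measurable function [h], in
    which [k * fnorm2 G] is the Markov bound for a norm above [rho]. *)
Lemma gsm_prob_ge p q (I J : finType) (L : {linear 'M[R]_(p, q) -> {ffun I * J -> R}})
    (E : set 'M[R]_(p, q)) (rho c d : R) : 0 < rho ->
  (forall G, reaches c (L G) -> fnorm2 G <= rho -> E G) ->
  (p * q)%:R / rho <= d ->
  (gsm (map L (gbasis p q)) (failsE c) 0%R <= d%:E)%E ->
  ((1 - (d + d))%:E <= gsm (gbasis p q) (fun G => (\1_E G)%:E) 0%R)%E.
Proof.
move=> rho0 EP pqd fd.
pose f G : R := (~~ reaches c (L G))%:R.
pose k : R := rho^-1.
have k0 : 0 <= k by rewrite invr_ge0 ltW.
pose h (G : 'M[R]_(p, q)) : R := Num.max (1 - (f G + k * fnorm2 G)) 0.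
have mf : gmeas f.
  have := gmeas_linear L (@gmeas_reaches R I J c).
  apply: (@gmeas_comp _ _ _ bool _ _ (fun b : bool => (~~ b)%:R : R)).
  by [].
have mn : gmeas (fun G : 'M[R]_(p, q) => k * fnorm2 G).
  by apply: gmeasM; [exact: gmeas_cst | exact: gmeas_fnorm2].
have f0 G : 0 <= f G by exact: ler0n.
have gf : gfun (fun G => (f G)%:E) by exact: gfun_EFin.
have gn : gfun (fun G : 'M[R]_(p, q) => (k * fnorm2 G)%:E) by exact: (@gfun_fnorm2 p q k k0).
have h0 G : 0 <= h G by rewrite le_max lexx orbT.
have gh : gfun (fun G => (h G)%:E).
  apply: gfun_EFin => //; apply: gmeas_max; last exact: gmeas_cst.
  move=> kk w cc; apply: measurable_funB; first exact: measurable_cst.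
  exact: measurable_funD (mf kk w cc) (mn kk w cc).
have hE : (gsm (gbasis p q) (fun G => (h G)%:E) 0%R <=
    gsm (gbasis p q) (fun G => (\1_E G)%:E) 0%R)%E.
  apply: gsm_le => G; first by rewrite lee_fin.
  rewrite lee_fin ge_max; apply/andP; split; last by rewrite indicE.
  rewrite indicE; case: (boolP (reaches c (L G))) => [rG|rG]; last first.
    rewrite /f rG opprD addrA subrr sub0r (@le_trans _ _ 0)//.
    by rewrite oppr_le0 mulr_ge0// fnorm2_ge0.
  have [Gr|Gr] := leP (fnorm2 G) rho.
    rewrite mem_set; last exact: EP.
    by rewrite lerBlDr lerDl addr_ge0// mulr_ge0// fnorm2_ge0.
  rewrite (@le_trans _ _ 0)// /f rG add0r subr_le0 /k mulrC.
  by rewrite ler_pdivlMr// mul1r ltW.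
apply: le_trans hE.
have tot : (1 <= gsm (gbasis p q) (fun G => (h G)%:E) 0%R +
   (gsm (gbasis p q) (fun G => (f G)%:E) 0%R +
    gsm (gbasis p q) (fun G => (k * fnorm2 G)%:E) 0%R))%E.
  rewrite -gsmD// -gsmD//; last first.
    split => [kk w cc|G]; last by apply: adde_ge0; [exact: gf.2 | exact: gn.2].
    exact: emeasurable_funD (gf.1 kk w cc) (gn.1 kk w cc).
  rewrite -(gsm_cst (gbasis p q) 0 1); apply: gsm_le => G; first exact: lee01.
  rewrite -!EFinD lee_fin /h.
  by have := le_max (1 - (f G + k * fnorm2 G)) (1 - (f G + k * fnorm2 G)) 0;
    rewrite lexx /= => ?; lra.
have fE : (gsm (gbasis p q) (fun G => (f G)%:E) 0%R <= d%:E)%E.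
  have e := gsm_linear L (gbasis p q) (failsE c) 0; rewrite linear0 in e.
  by rewrite -e in fd.
have nE : (gsm (gbasis p q) (fun G => (k * fnorm2 G)%:E) 0%R <= d%:E)%E.
  by rewrite gsm_fnorm2// lee_fin mulrC.
have := le_trans tot (leeD (lexx _) (leeD fE nE)).
have := gsm_ge0 (gbasis p q) 0 gh.2.
case: (gsm _ _ _) => [r| |]//=; last by move=> *; rewrite leey.
by rewrite -!EFinD !lee_fin; lra.
Qed.

End gaussian_matrix.

(** * Statistical dimension through nets *)

Section widths.
Context {R : realType} {n : nat}.
Implicit Types (g r x : 'cV[R]_n) (C : set 'cV[R]_n).

Definition wd (I : finType) (x : I -> 'cV[R]_n) g : R :=
  fmax (enum I) [ffun i => dot (x i) g].

Lemma wd_ge0 (I : finType) (x : I -> 'cV[R]_n) g : 0 <= wd x g.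
Proof. exact: fmax_ge0. Qed.

(** Here [g - r] is polar to [C], so <x_i, g> <= <x_i, r>, and Cauchy-Schwarz bounds this by the
    norm of [r]. *)
Lemma wd_sqr_le (I : finType) (x : I -> 'cV[R]_n) C g r :
  (forall i, C (x i) /\ sqn (x i) = 1) -> (forall q, C q -> dot (g - r) q <= 0) ->
  wd x g ^+ 2 <= sqn r.
Proof.
move=> xC hr; have : wd x g <= Num.sqrt (sqn r).
  rewrite /wd; elim: (enum I) => [|i s IH] /=; first exact: sqrtr_ge0.
  rewrite ge_max IH andbT ffunE; have [Cx x1] := xC i.
  have : dot (x i) g <= dot (x i) r.
    by have := hr _ Cx; rewrite dotC dotBr; lra.
  move=> h; apply: le_trans h _; apply: le_trans (ler_norm _) _.
  by rewrite -sqrtr_sqr ler_sqrt ?sqn_ge0// (le_trans (dot_CS _ _))// x1 mul1r.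
move=> h; rewrite -[leRHS]sqr_sqrtr ?sqn_ge0//.
by rewrite lerXn2r// nnegrE ?wd_ge0// sqrtr_ge0.
Qed.

(** The norm of [r] is the inner product of [g] with the direction of [r]. A net point near that
    direction loses at most e|g|, and squaring costs 2e + e^2 <= 3e. *)
Lemma wd_sqr_ge (I : finType) (x : I -> 'cV[R]_n) C g r (e : R) :
  0 <= e <= 1 -> (forall i, C (x i) /\ sqn (x i) = 1) ->
  (forall y, C y -> sqn y = 1 -> exists i, sqn (y - x i) <= e ^+ 2) ->
  (forall y (a : R), C y -> 0 <= a -> C (a *: y)) ->
  C r -> dot (g - r) r = 0 -> (forall q, C q -> dot (g - r) q <= 0) ->
  sqn r <= wd x g ^+ 2 + 3 * e * sqn g.
Proof.
move=> /andP[e0 e1] xC net sC Cr rr0 hr.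
have gE : sqn g = sqn r + sqn (g - r).
  by rewrite -[in LHS](subrK r g) [LHS]sqnD rr0; ring.
have w0 := wd_ge0 x g; have wr := wd_sqr_le xC hr.
have g0 := sqn_ge0 g.
have [r0|rN0] := eqVneq (sqn r) 0.
  by rewrite r0 addr_ge0 ?sqr_ge0// !mulr_ge0.
have rp : 0 < sqn r by rewrite lt_def rN0 sqn_ge0.
pose N := Num.sqrt (sqn r); have N0 : 0 < N by rewrite sqrtr_gt0.
have N2 : N ^+ 2 = sqn r by rewrite sqr_sqrtr// ltW.
pose y := N^-1 *: r.
have Cy : C y by apply: sC => //; rewrite invr_ge0 ltW.
have y1 : sqn y = 1 by rewrite sqnZ exprVn N2 mulVf.
have [i xi] := net _ Cy y1.
pose Gn := Num.sqrt (sqn g); have Gn0 : 0 <= Gn by exact: sqrtr_ge0.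
have G2 : Gn ^+ 2 = sqn g by rewrite sqr_sqrtr.
have yg : dot y g = N.
  rewrite /y dotZl; have -> : dot r g = sqn r.
    by move: rr0; rewrite dotC dotBr sqnE; lra.
  by rewrite -N2 expr2 mulKf// gt_eqF.
have d1 : dot (y - x i) g <= e * Gn.
  apply: le_trans (ler_norm _) _; rewrite -sqrtr_sqr.
  have -> : e * Gn = Num.sqrt (e ^+ 2 * sqn g).
    by rewrite sqrtrM ?sqr_ge0// sqrtr_sqr ger0_norm.
  rewrite ler_sqrt ?mulr_ge0 ?sqr_ge0//; apply: le_trans (dot_CS _ _) _.
  by rewrite ler_wpM2r.
have xw : dot (x i) g <= wd x g.
  by have := fmax_ge [ffun i => dot (x i) g] (mem_enum I i); rewrite ffunE.
have Nw : N <= wd x g + e * Gn.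
  by move: d1; rewrite dotBl yg; lra.
have wG : wd x g <= Gn.
  rewrite -[leLHS]ger0_norm// -sqrtr_sqr ler_sqrt//; apply: le_trans wr _.
  by rewrite gE lerDl sqn_ge0.
rewrite -N2 -G2.
have : N ^+ 2 <= (wd x g + e * Gn) ^+ 2.
  by rewrite lerXn2r// nnegrE ?(ltW N0)// addr_ge0// mulr_ge0.
have h1 : e * (wd x g * Gn) <= e * (Gn ^+ 2) by rewrite expr2 ler_wpM2l// ler_wpM2r.
have h2 : e ^+ 2 * Gn ^+ 2 <= e * Gn ^+ 2.
  by rewrite ler_wpM2r ?sqr_ge0// expr2 -[leRHS]mul1r ler_wpM2r.
have -> : (wd x g + e * Gn) ^+ 2 = wd x g ^+ 2 + 2 * (e * (wd x g * Gn)) + e ^+ 2 * Gn ^+ 2.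
  by ring.
by lra.
Qed.

Definition polar C : set 'cV[R]_n := [set v | forall q, C q -> dot v q <= 0].

Lemma dot_continuous q : continuous (fun v : 'cV[R]_n => dot v q).
Proof.
apply: sum_continuous => i t.
apply: continuousM; last exact: cst_continuous.
exact: coord_continuous.
Qed.

Lemma polar_closed C : closed (polar C).
Proof.
have -> : polar C = \bigcap_(q in C) [set v | dot v q <= 0].
  by apply/seteqP; split.
apply: closed_bigI => q _.
apply: (@preimage_closed _ _ (fun v => dot v q) [set x | x <= 0]) => [x _|].
  exact: dot_continuous.
exact: closed_le.
Qed.

Lemma polarZ C v (a : R) : polar C v -> 0 <= a -> polar C (a *: v).
Proof. by move=> Cv a0 q Cq; rewrite dotZl mulr_ge0_le0// Cv. Qed.

(** A trivial second factor for [bil]: linear forms in a Gaussian vector become bilinear forms in an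
    [n] by 1 Gaussian matrix. *)
Definition vone (I : finType) (i : I) : 'cV[R]_1 := 1%:M.

Lemma wd_bil (I : finType) (x : I -> 'cV[R]_n) g :
  wd x g = fmax (enum I) (bil x (@vone I) g).
Proof.
congr (fmax _ _); apply/ffunP => i; rewrite !ffunE; congr (dot _ _).
by rewrite mulmx1.
Qed.

Lemma dot_vone (I : finType) (i j : I) : dot (vone i) (vone j) = 1 :> R.
Proof. by rewrite /dot big_ord1 !mxE eqxx mulr1. Qed.

Lemma gcov_bil_vone (I : finType) (x : I -> 'cV[R]_n) i j :
  gcov (map (bil x (@vone I)) (gbasis n 1)) i j = dot (x i) (x j).
Proof. by rewrite gcov_bil dot_vone mulr1. Qed.

Lemma gsm_wd (I : finType) (x : I -> 'cV[R]_n) :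
  gsm (gbasis n 1) (fun g => (wd x g ^+ 2)%:E) 0 =
  gsm (map (bil x (@vone I)) (gbasis n 1)) (fun z => (fmax (enum I) z ^+ 2)%:E) 0.
Proof.
rewrite -[X in _ = gsm _ _ X](linear0 (bil x (@vone I))) -gsm_linear.
by congr (gsm _ _ _); apply/funext => g; rewrite wd_bil.
Qed.

Lemma gmeas_wd_sqr (I : finType) (x : I -> 'cV[R]_n) :
  gmeas (fun g => wd x g ^+ 2).
Proof.
have := gmeas_linear (bil x (@vone I)) (gmeas_fmax (enum I)).
move=> /gmeas_sqr h; rewrite (_ : (fun g => _) = fun g => ((fmax (enum I) \o bil x (@vone I)) g) ^+ 2)//.
by apply/funext => g; rewrite wd_bil.
Qed.

Lemma gsm_wd_fin (I : finType) (x : I -> 'cV[R]_n) : (forall i, sqn (x i) = 1) ->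
  exists2 S : R, 0 <= S & gsm (gbasis n 1) (fun g => (wd x g ^+ 2)%:E) 0 = S%:E.
Proof.
move=> x1; have var i : gcov (map (bil x (@vone I)) (gbasis n 1)) i i <= 1.
  by rewrite gcov_bil_vone -sqnE x1.
have [mu [S [mu0 muS _ SE _]]] := gsm_fmax_conc var (enum I).
by exists S; [exact: le_trans (sqr_ge0 _) muS | rewrite gsm_wd].
Qed.

Lemma sqn_fnorm2 g : sqn g = fnorm2 g.
Proof.
rewrite /fnorm2 -(pair_bigA _ (fun i j => g i j ^+ 2)) /=.
by apply: eq_bigr => i _; rewrite big_ord1.
Qed.

End widths.

(** * From the iterated integrals of the statement to Gaussian sums *)

Section iterated_expectation.

(** Overwriting a coordinate agrees with adding a multiple of its basis matrix as long as the
    coordinate is still 0, whence the conditions on [s] and [x]. *)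
Lemma gauss_iter_gsm (m n : nat) (F : 'M[RR]_(m, n) -> \bar RR)
    (s : seq ('I_m * 'I_n)) (x : 'I_m * 'I_n -> RR) :
  uniq s -> (forall a, a \in s -> x a = 0) ->
  gauss_iter s (fun x => F (\matrix_(i, j) x (i, j))) x =
  gsm [seq delta_mx a.1 a.2 | a <- s] F (\matrix_(i, j) x (i, j)).
Proof.
elim: s x => //= a s IH x /andP[as_ us] xs; rewrite /gsm1.
apply: eq_integral => y _; rewrite IH//; last first.
  move=> b bs; case: eqP => [ba|_]; first by move: as_; rewrite -ba bs.
  by apply: xs; rewrite inE bs orbT.
congr (gsm _ _ _); apply/matrixP => i j; rewrite !mxE.
have -> : ((i, j) == a) = (i == a.1) && (j == a.2) by case: (a).
case: (boolP (_ && _)) => [/andP[/eqP -> /eqP ->]|_]; last by rewrite mulr0 addr0.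
by rewrite -surjective_pairing xs ?mem_head// add0r mulr1.
Qed.

Lemma gauss_expect_gsm (m n : nat) (F : 'M[RR]_(m, n) -> \bar RR) :
  gauss_expect (fun x : 'I_m * 'I_n -> RR => F (\matrix_(i, j) x (i, j))) =
  gsm (gbasis m n) F 0.
Proof.
rewrite /gauss_expect gauss_iter_gsm ?enum_uniq//; congr (gsm _ _ _).
by apply/matrixP => i j; rewrite !mxE.
Qed.

Lemma gauss_mx_probE (m n : nat) (E : set 'M[RR]_(m, n)) :
  gauss_mx_prob E = gsm (gbasis m n) (fun G => (\1_E G)%:E) 0.
Proof. exact: (gauss_expect_gsm (fun G => (\1_E G)%:E)). Qed.

Lemma stat_dimE (n : nat) (K : set 'cV[RR]_n) :
  stat_dim K = gsm (gbasis n 1) (fun g => (sqnorm (Defs.proj K g))%:E) 0.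
Proof. exact: (gauss_expect_gsm (fun g => (sqnorm (Defs.proj K g))%:E)). Qed.

End iterated_expectation.

Section sandwich.
Context {R : realType} {n : nat} {I : finType}.
Variables (x : I -> 'cV[R]_n) (S e : R) (N : 'cV[R]_n -> R).
Hypothesis e0 : 0 <= e.
Hypothesis SE : gsm (gbasis n 1) (fun g => (wd x g ^+ 2)%:E) 0 = S%:E.
Hypothesis N0 : forall g, 0 <= N g.

Let gw : gfun (fun g : 'cV[R]_n => (wd x g ^+ 2)%:E).
Proof. by apply: gfun_EFin => [|g]; [exact: gmeas_wd_sqr | exact: sqr_ge0]. Qed.

Let gs (k : R) : 0 <= k -> gfun (fun g : 'cV[R]_n => (k * sqn g)%:E).
Proof. by move=> k0; under eq_fun do rewrite sqn_fnorm2; exact: gfun_fnorm2. Qed.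

Let gsE (k : R) : 0 <= k ->
  gsm (gbasis n 1) (fun g => (k * sqn g)%:E) 0 = (k * n%:R)%:E.
Proof.
by move=> k0; under eq_fun do rewrite sqn_fnorm2; rewrite gsm_fnorm2// muln1.
Qed.

Let gNfin (M : R) : (gsm (gbasis n 1) (fun g => (N g)%:E) 0%R <= M%:E)%E ->
  exists2 d : R, gsm (gbasis n 1) (fun g => (N g)%:E) 0 = d%:E & d <= M.
Proof.
have : (0 <= gsm (gbasis n 1) (fun g => (N g)%:E) 0%R)%E.
  by apply: gsm_ge0 => g; rewrite lee_fin.
by case: (gsm _ _ _) => [d| |]//= _ dM; exists d; rewrite -?lee_fin.
Qed.

Lemma gsm_sandwich :
  (forall g, wd x g ^+ 2 <= N g <= wd x g ^+ 2 + 3 * e * sqn g) ->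
  exists2 d : R, gsm (gbasis n 1) (fun g => (N g)%:E) 0 = d%:E &
    S <= d <= S + 3 * e * n%:R.
Proof.
move=> wN; have e3 : 0 <= 3 * e by rewrite mulr_ge0.
have [d dE dM] : exists2 d : R, gsm (gbasis n 1) (fun g => (N g)%:E) 0 = d%:E &
    d <= S + 3 * e * n%:R.
  apply: gNfin; rewrite EFinD -SE -(gsE e3) -gsmD//; last exact: gs.
  by apply: gsm_le => g; rewrite lee_fin//; case/andP: (wN g).
exists d => //; rewrite dM andbT -lee_fin -dE -SE.
by apply: gsm_le => g; rewrite lee_fin ?sqr_ge0//; case/andP: (wN g).
Qed.

Lemma gsm_sandwich_compl : (forall g, N g <= sqn g) ->
  (forall g, wd x g ^+ 2 <= sqn g - N g <= wd x g ^+ 2 + 3 * e * sqn g) ->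
  exists2 d : R, gsm (gbasis n 1) (fun g => (N g)%:E) 0 = d%:E &
    S <= n%:R - d <= S + 3 * e * n%:R.
Proof.
move=> Ns wN; have e3 : 0 <= 3 * e by rewrite mulr_ge0.
have s1 : gsm (gbasis n 1) (fun g : 'cV[R]_n => (sqn g)%:E) 0 = n%:R%:E.
  transitivity ((1 * n%:R)%:E : \bar R); last by rewrite mul1r.
  rewrite -gsE//; congr (gsm _ _ _); apply/funext => g.
  by rewrite mul1r.
have [d dE dM] : exists2 d : R, gsm (gbasis n 1) (fun g => (N g)%:E) 0 = d%:E &
    d <= n%:R.
  by apply: gNfin; rewrite -s1; apply: gsm_le => g; rewrite lee_fin.
have ms : gmeas (fun g : 'cV[R]_n => sqn g).
  under eq_fun do rewrite sqn_fnorm2.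
  exact: gmeas_fnorm2.
have mw := gmeas_wd_sqr x.
pose h (g : 'cV[R]_n) := sqn g - wd x g ^+ 2.
have mh : gmeas h.
  by move=> k w c; apply: measurable_funB; [exact: ms | exact: mw].
have h0 g : 0 <= h g by have /andP[h1 _] := wN g; have := N0 g; rewrite /h; lra.
have hE : (gsm (gbasis n 1) (fun g => (h g)%:E) 0%R + S%:E = n%:R%:E)%E.
  rewrite -SE -gsmD//; last exact: gfun_EFin.
  rewrite -s1; congr (gsm _ _ _); apply/funext => g.
  by rewrite -EFinD /h subrK.
pose h2 (g : 'cV[R]_n) := Num.max (h g - 3 * e * sqn g) 0.
have gh2 : gfun (fun g => (h2 g)%:E).
  apply: gfun_EFin => [|g]; last by rewrite le_max lexx orbT.
  apply: gmeas_max; last exact: gmeas_cst.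
  move=> k w c; apply: measurable_funB; first exact: mh.
  by apply: measurable_funM; [exact: measurable_cst | exact: ms].
have h2E : (n%:R%:E <= gsm (gbasis n 1) (fun g => (h2 g)%:E) 0%R +
    (S%:E + (3 * e * n%:R)%:E))%E.
  rewrite -SE -(gsE e3) -gsmD//; last exact: gs.
  have gws : gfun (fun g : 'cV[R]_n => ((wd x g ^+ 2)%:E + (3 * e * sqn g)%:E)%E).
    split => [k w c|g]; first exact: emeasurable_funD (gw.1 k w c) ((gs e3).1 k w c).
    by apply: adde_ge0; [exact: gw.2 | exact: (gs e3).2].
  rewrite -gsmD// -s1; apply: gsm_le => g; first by rewrite lee_fin sqn_ge0.
  rewrite -!EFinD lee_fin /h2 /h.
  have : sqn g - wd x g ^+ 2 - 3 * e * sqn g <= Num.max (sqn g - wd x g ^+ 2 - 3 * e * sqn g) 0.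
    by rewrite le_max lexx.
  by lra.
have hd : (d%:E <= gsm (gbasis n 1) (fun g => (h g)%:E) 0%R)%E.
  rewrite -dE; apply: gsm_le => g; rewrite lee_fin//.
  by have /andP[h1 _] := wN g; rewrite /h; lra.
have h2d : (gsm (gbasis n 1) (fun g => (h2 g)%:E) 0%R <= d%:E)%E.
  rewrite -dE; apply: gsm_le => g; first exact: gh2.2.
  rewrite lee_fin /h2 ge_max N0 andbT.
  by have /andP[_ h1] := wN g; rewrite /h; lra.
exists d => //; apply/andP; split.
  move: hE hd; case: (gsm _ _ _) => [r| |]//=.
  by rewrite -EFinD => -[<-]; rewrite lee_fin; lra.
have := le_trans h2E (leeD h2d (lexx _)).
by rewrite -!EFinD lee_fin; lra.
Qed.

End sandwich.

Definition unit_net (R : realType) n (C : set 'cV[R]_n) (e : R) (I : finType)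
    (x : I -> 'cV[R]_n) : Prop :=
  (forall i, C (x i) /\ sqn (x i) = 1) /\
  (forall y, C y -> sqn y = 1 -> exists i, sqn (y - x i) <= e ^+ 2).

Lemma unit_net_exists (R : realType) n (C : set 'cV[R]_n) (e : R) :
  closed C -> 0 < e -> exists N (x : 'I_N -> 'cV[R]_n), unit_net C e x.
Proof.
move=> cC e0; have [s [sC net]] := sphere_net cC (exprn_gt0 2 e0).
exists (size s), (tnth (in_tuple s)); split => [i|y Cy y1].
  by apply: sC; exact: mem_tnth.
have [z zs yz] := net y Cy y1.
have /tnthP[i zi] : z \in in_tuple s by [].
by exists i; rewrite -zi.
Qed.

Lemma fnorm2_mul (R : realType) m n (G : 'M[R]_(m, n)) (y : 'cV[R]_n) :
  sqn (G *m y) <= fnorm2 G * sqn y.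
Proof.
rewrite /fnorm2 -(pair_bigA _ (fun i j => G i j ^+ 2)) /= mulr_suml.
apply: ler_sum => i _; have := dot_CS (row i G)^T y.
have -> : dot (row i G)^T y = (G *m y) i 0.
  by rewrite [RHS]mxE; apply: eq_bigr => j _; rewrite mxE [X in X * _]mxE.
have -> // : sqn (row i G)^T = \sum_j G i j ^+ 2.
by apply: eq_bigr => j _; rewrite mxE [X in X ^+ _]mxE.
Qed.

Section projection.
Context {n : nat}.
Implicit Types (K : set 'cV[RR]_n).

Lemma closed_convex_cone_cvx K : closed_convex_cone K -> cvx_cone K.
Proof.
move=> [K0 cK sK vK]; split => // x y Kx Ky.
have -> : x + y = (2 : RR) *: ((2^-1 : RR) *: x + (1 - 2^-1 : RR) *: y).
  have e1 : 1 - 2^-1 = 2^-1 :> RR by lra.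
  by rewrite e1 scalerDr !scalerA divff ?scale1r// pnatr_eq0.
apply: sK; last by lra.
by apply: vK => //; apply/andP; split; lra.
Qed.

(** [cone_lsq] for the identity matrix yields a point with Moreau's conditions. They make it the
    unique nearest point, hence the one chosen by [xget]. *)
Lemma projP K (g : 'cV[RR]_n) : closed_convex_cone K ->
  [/\ K (Defs.proj K g), dot (g - Defs.proj K g) (Defs.proj K g) = 0 &
      forall q, K q -> dot (g - Defs.proj K g) q <= 0].
Proof.
move=> /closed_convex_cone_cvx cK.
have inj x : K x -> 1%:M *m x = 0 -> x = 0 by rewrite mul1mx.
have [p Kp] := cone_lsq cK inj g; rewrite mul1mx => -[gpp gp].
have gpq q : K q -> dot (g - p) q <= 0 by move=> /gp; rewrite mul1mx.
have projp : is_proj K g p.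
  split => // q Kq; change (sqn (g - p) <= sqn (g - q)).
  have -> : g - q = (g - p) + (p - q) by rewrite addrA subrK.
  rewrite [leRHS]sqnD dotBr gpp; have := gpq q Kq; have := sqn_ge0 (p - q); lra.
have [Kp' minp'] : is_proj K g (Defs.proj K g) by apply: (xgetPex 0); exists p.
suff -> : Defs.proj K g = p by [].
have := minp' p Kp; set p' := Defs.proj K g.
change (sqn (g - p') <= sqn (g - p) -> p' = p).
have -> : g - p' = (g - p) + (p - p') by rewrite addrA subrK.
rewrite [leLHS]sqnD dotBr gpp => h; apply/esym/eqP; rewrite -subr_eq0; apply/eqP.
apply: sqn_eq0; have := gpq p' Kp'; have := sqn_ge0 (p - p'); lra.
Qed.

Lemma proj_sqn K (g : 'cV[RR]_n) : closed_convex_cone K ->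
  sqn g = sqn (Defs.proj K g) + sqn (g - Defs.proj K g).
Proof.
move=> /projP -/(_ g)[_ h _].
by rewrite -[in LHS](subrK (Defs.proj K g) g) [LHS]sqnD h; lra.
Qed.

Lemma stat_dim_net K (e : RR) (I : finType) (x : I -> 'cV[RR]_n) (S : RR) :
  closed_convex_cone K -> 0 <= e <= 1 -> unit_net K e x ->
  gsm (gbasis n 1) (fun g => (wd x g ^+ 2)%:E) 0 = S%:E ->
  exists2 d : RR, stat_dim K = d%:E & S <= d <= S + 3 * e * n%:R.
Proof.
move=> cK e01 [xK net] SE; rewrite stat_dimE.
have e0 : 0 <= e by case/andP: e01.
apply: (gsm_sandwich e0 SE) => [g|g]; first exact: sqn_ge0.
have [Kp gpp gpq] := projP g cK; have [_ _ sK _] := cK.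
apply/andP; split; first exact: (wd_sqr_le xK gpq).
by apply: (wd_sqr_ge e01 xK net _ Kp gpp gpq) => y a Ky a0; exact: sK.
Qed.

(** The residual [g - proj K g] satisfies Moreau's conditions for the polar cone, so its squared
    norm is what the width of the polar net approximates. *)
Lemma stat_dim_polar_net K (e : RR) (I : finType) (x : I -> 'cV[RR]_n) (S : RR) :
  closed_convex_cone K -> 0 <= e <= 1 -> unit_net (polar K) e x ->
  gsm (gbasis n 1) (fun g => (wd x g ^+ 2)%:E) 0 = S%:E ->
  exists2 d : RR, stat_dim K = d%:E & S <= n%:R - d <= S + 3 * e * n%:R.
Proof.
move=> cK e01 [xK net] SE; rewrite stat_dimE.
have e0 : 0 <= e by case/andP: e01.
apply: (gsm_sandwich_compl e0 SE) => [g|g|g]; first exact: sqn_ge0.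
  by rewrite (proj_sqn g cK) lerDl sqn_ge0.
have [Kp gpp gpq] := projP g cK.
rewrite (_ : sqn g - _ = sqn (g - Defs.proj K g)); last first.
  by rewrite (proj_sqn g cK) addrAC subrr add0r.
have Pr : polar K (g - Defs.proj K g) by exact: gpq.
have rr : dot (g - (g - Defs.proj K g)) (g - Defs.proj K g) = 0.
  by rewrite opprB addrC subrK dotC.
have rq q : polar K q -> dot (g - (g - Defs.proj K g)) q <= 0.
  by move=> Pq; rewrite opprB addrC subrK dotC; exact: Pq.
apply/andP; split; first exact: (wd_sqr_le xK rq).
by apply: (wd_sqr_ge e01 xK net _ Pr rr rq) => y a; exact: polarZ.
Qed.

End projection.

(** * Duality and the exceptional case *)

(** In the full-rank factorization of [P], idempotence makes the reversed product of the factors an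
    identity of size the rank. *)
Lemma mxtrace_idem (F : fieldType) n (P : 'M[F]_n) :
  P *m P = P -> \tr P = (\rank P)%:R.
Proof.
move=> PP; rewrite -[in LHS](mulmx_base P) mxtrace_mulC.
suff -> : row_base P *m col_base P = 1%:M by rewrite mxtrace1.
have /row_free_inj inj := row_base_free P; apply: inj.
have /row_full_inj injc := col_base_full P; apply: injc.
by rewrite mul1mx mulmxA mulmxA mulmx_base -mulmxA mulmx_base PP.
Qed.

Section subspace.
Context {n : nat}.
Variable K : set 'cV[RR]_n.
Hypothesis coneK : closed_convex_cone K.

Lemma proj_unique (g p : 'cV[RR]_n) : K p -> dot (g - p) p = 0 ->
  (forall q, K q -> dot (g - p) q <= 0) -> Defs.proj K g = p.
Proof.
move=> Kp gpp gpq; have [] := projP g coneK; set p' := Defs.proj K g.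
move=> Kp' gpp' gpq'; apply/eqP; rewrite -subr_eq0; apply/eqP; apply: sqn_eq0.
apply/eqP; rewrite eq_le sqn_ge0 andbT sqnE.
have := gpq _ Kp'; have := gpq' _ Kp.
by rewrite !dotBl !dotBr; rewrite !dotBl in gpp gpp'; rewrite (dotC p p'); lra.
Qed.

Hypothesis symK : forall x, K x -> K (- x).

Lemma proj_ortho (g q : 'cV[RR]_n) : K q -> dot (g - Defs.proj K g) q = 0.
Proof.
have [_ _ h] := projP g coneK.
by move=> Kq; have := h _ Kq; have := h _ (symK Kq); rewrite dotNr; lra.
Qed.

Lemma proj_linear : linear (Defs.proj K : 'cV[RR]_n -> 'cV[RR]_n).
Proof.
have [_ _ sK aK] := closed_convex_cone_cvx coneK.
have zK (a : RR) x : K x -> K (a *: x).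
  move=> Kx; have [a0|a0] := leP 0 a; first exact: sK.
  by rewrite -[a]opprK scaleNr; apply: symK; apply: sK => //; lra.
move=> a g h; have [Kg _ _] := projP g coneK; have [Kh _ _] := projP h coneK.
have Kgh : K (a *: Defs.proj K g + Defs.proj K h) by apply: aK => //; exact: zK.
have o q : K q -> dot (a *: g + h - (a *: Defs.proj K g + Defs.proj K h)) q = 0.
  move=> Kq; rewrite opprD addrACA -scalerBr dotDl dotZl !proj_ortho// mulr0 addr0//.
by apply: proj_unique => // [|q Kq]; rewrite o.
Qed.

HB.instance Definition _ := GRing.isLinear.Build RR 'cV[RR]_n 'cV[RR]_n _
  (Defs.proj K : 'cV[RR]_n -> 'cV[RR]_n) proj_linear.

Definition proj_mx : 'M[RR]_n := \matrix_(i, j) Defs.proj K (delta_mx j 0) i 0.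

Lemma proj_mxE g : Defs.proj K g = proj_mx *m g.
Proof.
rewrite [in LHS](matrix_sum_delta g) linear_sum; apply/matrixP => i j.
rewrite (ord1 j) summxE mxE; apply: eq_bigr => k _.
by rewrite big_ord1 linearZ !mxE mulrC.
Qed.

Lemma proj_mxK x : K x -> proj_mx *m x = x.
Proof.
move=> Kx; rewrite -proj_mxE; apply: proj_unique => // [|q _].
  by rewrite subrr dot0l.
by rewrite subrr dot0l.
Qed.

Lemma proj_mx_in g : K (proj_mx *m g).
Proof. by rewrite -proj_mxE; have [] := projP g coneK. Qed.

Lemma proj_mx_idem : proj_mx *m proj_mx = proj_mx.
Proof.
apply/matrixP => i j.
have cE (A : 'M[RR]_n) : A i j = (A *m delta_mx j (0 : 'I_1)) i 0.
  by rewrite -colE mxE.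
by rewrite cE [RHS]cE -mulmxA proj_mxK//; exact: proj_mx_in.
Qed.

Lemma proj_mx_sym : proj_mx^T *m proj_mx = proj_mx.
Proof.
suff h : (1%:M - proj_mx)^T *m proj_mx = 0.
  move/eqP: h; rewrite linearB /= trmx1 mulmxBl mul1mx subr_eq0.
  by move/eqP/esym.
apply/matrixP => i j.
have -> : ((1%:M - proj_mx)^T *m proj_mx) i j =
    dot ((1%:M - proj_mx) *m delta_mx i 0) (proj_mx *m delta_mx j 0).
  rewrite mxE; apply: eq_bigr => k _.
  by rewrite -!colE !mxE.
by rewrite mulmxBl mul1mx -(proj_mxE (delta_mx i 0)) proj_ortho ?mxE//; exact: proj_mx_in.
Qed.

(** The mean of |P g|^2 is the sum of the squared entries of P, which is tr(P^T P) = tr P, the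
    rank. *)
Lemma stat_dim_subspace : stat_dim K = ((\rank proj_mx)%:R)%:E.
Proof.
rewrite stat_dimE.
pose l (i : 'I_n) : {scalar 'cV[RR]_n} := entryf (i, 0 : 'I_1) \o mulmx proj_mx.
rewrite (_ : (fun g => _) = fun g => (\sum_(i <- index_enum 'I_n) (l i g + 0) ^+ 2)%:E); last first.
  apply/funext => g; rewrite proj_mxE; congr EFin; apply: eq_bigr => i _.
  by rewrite addr0.
rewrite (gsm_sum_sqr _ l); congr EFin.
rewrite -(mxtrace_idem proj_mx_idem) -[in RHS]proj_mx_sym.
have -> : \tr (proj_mx^T *m proj_mx) = \sum_i \sum_j proj_mx i j ^+ 2.
  rewrite /mxtrace exchange_big /=; apply: eq_bigr => j _.
  by rewrite mxE; apply: eq_bigr => i _; rewrite mxE expr2.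
apply: eq_bigr => i _; rewrite linear0 addr0 expr0n add0r big_gbasis.
apply: eq_bigr => j _; rewrite big_ord1 /l /=; congr (_ ^+ 2).
by rewrite -colE mxE.
Qed.

End subspace.

Section alternative.
Context {m n : nat}.
Variables (K : set 'cV[RR]_n) (L : set 'cV[RR]_m) (G : 'M[RR]_(m, n)).
Hypothesis coneK : closed_convex_cone K.
Hypothesis coneL : closed_convex_cone L.

Lemma usubmx_continuous : continuous (fun d : 'cV[RR]_(n + m) => usubmx d).
Proof.
move=> /= M s /= /(nbhs_ballP (usubmx M)) [e e0 es].
apply/nbhs_ballP; exists e => //= N [e' MN]; apply: es; split => // i j.
by rewrite !mxE.
Qed.

Lemma dsubmx_continuous : continuous (fun d : 'cV[RR]_(n + m) => dsubmx d).
Proof.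
move=> /= M s /= /(nbhs_ballP (dsubmx M)) [e e0 es].
apply/nbhs_ballP; exists e => //= N [e' MN]; apply: es; split => // i j.
by rewrite !mxE.
Qed.

Hypothesis trivKL : forall x, K x -> L (G *m x) -> x = 0.
Hypothesis trivP : forall z, polar L z -> (forall x, K x -> 0 <= dot z (G *m x)) -> z = 0.

Let D : set 'cV[RR]_(n + m) := [set d | K (usubmx d) /\ L (dsubmx d)].
Let M : 'M[RR]_(m, n + m) := row_mx (- G) 1%:M.

Let ME (d : 'cV[RR]_(n + m)) : M *m d = dsubmx d - G *m usubmx d.
Proof. by rewrite -[in LHS](vsubmxK d) mul_row_col mulNmx mul1mx addrC. Qed.

Let coneD : cvx_cone D.
Proof.
have [K0 cK sK aK] := closed_convex_cone_cvx coneK.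
have [L0 cL sL aL] := closed_convex_cone_cvx coneL.
split => [||d a [Kd Ld] a0|d d' [Kd Ld] [Kd' Ld']].
- by split; rewrite linear0.
- apply: closedI.
    by apply: (@preimage_closed _ _ (fun d => usubmx d) K) => // d _; exact: usubmx_continuous.
  by apply: (@preimage_closed _ _ (fun d => dsubmx d) L) => // d _; exact: dsubmx_continuous.
- by split; rewrite linearZ; [exact: sK | exact: sL].
- by split; rewrite linearD; [exact: aK | exact: aL].
Qed.

Let kerD d : D d -> M *m d = 0 -> d = 0.
Proof.
move=> [Kd Ld]; rewrite ME => /eqP; rewrite subr_eq0 => /eqP e.
have u0 : usubmx d = 0 by apply: trivKL => //; rewrite -e.
by rewrite -(vsubmxK d) e u0 mulmx0 col_mx0.
Qed.

(** The least-squares residual has nonpositive product with every y - G x. Hence it lies in the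
    polar of [L] and is nonnegative on the image of [K], so [trivP] makes it zero. *)
Let surjD z : exists2 d, D d & M *m d = z.
Proof.
have [K0 _ _ _] := coneK; have [L0 _ _ _] := coneL.
have [d Dd [_ h]] := cone_lsq coneD kerD z; exists d => //.
apply/esym/eqP; rewrite -subr_eq0; apply/eqP; apply: trivP => [q Lq|x Kx].
  have := h (col_mx 0 q); rewrite (ME (col_mx 0 q)) col_mxKu col_mxKd mulmx0 subr0; apply.
  by split; rewrite ?col_mxKu ?col_mxKd.
have := h (col_mx x 0); rewrite (ME (col_mx x 0)) col_mxKu col_mxKd sub0r dotNr oppr_le0; apply.
by split; rewrite ?col_mxKu ?col_mxKd.
Qed.

(* A preimage in [D] of [- M d] cancels [d], because only [0] in [D] is mapped
   to [0]. *)
Let symD d : D d -> D (- d).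
Proof.
move=> Dd; have [d' Dd' e] := surjD (- (M *m d)); have [_ _ _ aD] := coneD.
have : d + d' = 0 by apply: kerD; [exact: aD | rewrite mulmxDr e subrr].
by move=> /eqP; rewrite addrC addr_eq0 => /eqP <-.
Qed.

Let symK x : K x -> K (- x).
Proof.
have [L0 _ _ _] := coneL; move=> Kx; have := @symD (col_mx x 0).
rewrite /D /= opp_col_mx !col_mxKu !col_mxKd => h.
by have [] := h (conj Kx L0).
Qed.

Let symL y : L y -> L (- y).
Proof.
have [K0 _ _ _] := coneK; move=> Ly; have := @symD (col_mx 0 y).
rewrite /D /= opp_col_mx !col_mxKu !col_mxKd => h.
by have [] := h (conj K0 Ly).
Qed.

(** Both cones are now subspaces. [G] is injective on [K] ([cap1]) and the image of [K] meets [L]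
    only at 0 ([cap2]), so the ranks add up to at most [m]. Transposes turn column spaces into row
    spaces. *)
Lemma stat_dim_transversal : exists dK dL : RR,
  [/\ stat_dim K = dK%:E, stat_dim L = dL%:E & dK <= m%:R - dL].
Proof.
exists (\rank (proj_mx K))%:R, (\rank (proj_mx L))%:R.
split; [exact: stat_dim_subspace | exact: stat_dim_subspace |].
rewrite lerBrDr -natrD ler_nat.
set P := proj_mx K; set Q := proj_mx L.
have KP g : K (P *m g) by exact: proj_mx_in.
have LQ g : L (Q *m g) by exact: proj_mx_in.
have cap1 : \rank (P^T :&: kermx G^T)%MS = 0%N.
  apply/eqP; rewrite mxrank_eq0 -submx0; apply/rV_subP => u.
  rewrite sub_capmx => /andP[/submxP[a ->] /sub_kermxP].
  move=> /(congr1 trmx); rewrite trmx0 !trmx_mul !trmxK => e.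
  have x0 : P *m a^T = 0.
    by apply: trivKL => //; rewrite e; have [L0 _ _ _] := coneL.
  by rewrite -[a *m P^T]trmxK trmx_mul trmxK x0 trmx0 sub0mx.
have r1 : \rank (P^T *m G^T)%MS = \rank P.
  by have := mxrank_mul_ker P^T G^T; rewrite cap1 addn0 mxrank_tr.
have cap2 : \rank ((P^T *m G^T) :&: Q^T)%MS = 0%N.
  apply/eqP; rewrite mxrank_eq0 -submx0; apply/rV_subP => u.
  rewrite sub_capmx => /andP[/submxP[a uE] /submxP[b uE']].
  have e1 : u^T = G *m (P *m a^T) by rewrite uE !trmx_mul !trmxK mulmxA.
  have e2 : u^T = Q *m b^T by rewrite uE' trmx_mul trmxK.
  have x0 : P *m a^T = 0 by apply: trivKL => //; rewrite -e1 e2.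
  by rewrite -[u]trmxK e1 x0 mulmx0 trmx0 sub0mx.
have := mxrank_sum_cap (P^T *m G^T) Q^T; rewrite cap2 addn0 r1 mxrank_tr => <-.
exact: rank_leq_col.
Qed.

End alternative.

(** * Transfer from the nets to the cones *)

Lemma escape_prob (R : realType) m n p q (I J : finType)
    (u : I -> 'cV[R]_p) (w : J -> 'cV[R]_q)
    (L : {linear 'M[R]_(m, n) -> {ffun I * J -> R}}) (Su Sw t : R)
    (E : set 'M[R]_(m, n)) :
  (forall i, sqn (u i) = 1) -> (forall j, sqn (w j) = 1) ->
  (forall a b, gcov (map L (gbasis m n)) a b =
     dot (u a.1) (u b.1) * dot (w a.2) (w b.2)) ->
  gsm (gbasis p 1) (fun g => (wd u g ^+ 2)%:E) 0 = Su%:E ->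
  gsm (gbasis q 1) (fun g => (wd w g ^+ 2)%:E) 0 = Sw%:E ->
  1 <= t -> Num.sqrt Su + 18 * Num.sqrt t <= Num.sqrt Sw ->
  (forall G, reaches 4^-1 (L G) -> fnorm2 G <= 2 * (m * n)%:R * expR t + 1 -> E G) ->
  ((1 - expR (- t))%:E <= gsm (gbasis m n) (fun G => (\1_E G)%:E) 0%R)%E.
Proof.
move=> u1 w1 covL SuE SwE t1 gap EP.
(* The mean of [fnorm2] is m n, so Markov's inequality costs [expR (- t) / 2], the other half being
   left for Gordon. The [+ 1] keeps [rho] positive when m n = 0. *)
pose rho := 2 * (m * n)%:R * expR t + 1.
have rho0 : 0 < rho by rewrite ltr_wpDl// !mulr_ge0// expR_ge0.
have -> : 1 - expR (- t) = 1 - (expR (- t) / 2 + expR (- t) / 2).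
  by congr (_ - _); field.
apply: (@gsm_prob_ge _ _ _ _ _ L E rho 4^-1) => //.
  rewrite ler_pdivrMr// /rho.
  have e1 : expR (- t) * expR t = 1 by rewrite mulrC expRxMexpNx_1.
  have -> : expR (- t) / 2 * (2 * (m * n)%:R * expR t + 1) =
    (expR (- t) * expR t) * (m * n)%:R + expR (- t) / 2 by field.
  by rewrite e1 mul1r lerDl divr_ge0// expR_ge0.
apply: (@gordon_escape _ _ _ (map (bil u (@vone R I)) (gbasis p 1))
  (map (bil w (@vone R J)) (gbasis q 1)) _ Su Sw) => //.
- by move=> i; rewrite gcov_bil_vone -sqnE.
- by move=> j; rewrite gcov_bil_vone -sqnE.
- by move=> a b; rewrite covL !gcov_bil_vone.
- by rewrite -gsm_wd.
- by rewrite -gsm_wd.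
Qed.

Lemma bil_small (R : realType) m n (G : 'M[R]_(m, n)) v y (rho e : R) :
  sqn v = 1 -> fnorm2 G <= rho -> sqn y <= e ^+ 2 -> rho * e ^+ 2 < 16^-1 ->
  `|dot v (G *m y)| < 4^-1.
Proof.
move=> v1 Gr ye re; have := dot_CS v (G *m y); rewrite v1 mul1r => h.
have h2 : dot v (G *m y) ^+ 2 <= rho * e ^+ 2.
  apply: le_trans h _; apply: le_trans (fnorm2_mul G y) _.
  by apply: ler_pM; rewrite ?fnorm2_ge0 ?sqn_ge0.
rewrite -(@ltr_pXn2r _ 2)// ?nnegrE//.
rewrite real_normK ?num_real//; apply: le_lt_trans h2 _; apply: lt_le_trans re _.
by rewrite exprVn -natrX.
Qed.

(** Turns the mesh error in a squared width into the additive 1 that separates 19 from 18. *)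
Lemma sqrt_le_D1 (R : realType) (S d c : R) : 0 <= S -> d <= S + c -> c <= 1 ->
  Num.sqrt d <= Num.sqrt S + 1.
Proof.
move=> S0 dS c1; have s0 := sqrtr_ge0 S.
rewrite -[leRHS]ger0_norm ?addr_ge0// -sqrtr_sqr; apply: ler_wsqrtr.
by have := sqr_sqrtr S0; rewrite !expr2; nra.
Qed.

Section dichotomy.
Context {m n : nat}.
Variables (K : set 'cV[RR]_n) (L : set 'cV[RR]_m).
Hypothesis coneK : closed_convex_cone K.
Hypothesis coneL : closed_convex_cone L.
Variables (G : 'M[RR]_(m, n)) (rho e : RR) (I J : finType).
Variables (x : I -> 'cV[RR]_n) (v : J -> 'cV[RR]_m).
Hypothesis netx : unit_net K e x.
Hypothesis netv : unit_net (polar L) e v.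
Hypothesis rhoe : rho * e ^+ 2 < 16^-1.
Hypothesis Grho : fnorm2 G <= rho.

Lemma normalize p (C : set 'cV[RR]_p) (z : 'cV[RR]_p) :
  (forall z (a : RR), C z -> 0 <= a -> C (a *: z)) -> C z -> z != 0 ->
  exists a : RR, [/\ 0 < a, C (a *: z) & sqn (a *: z) = 1].
Proof.
move=> sC Cz zN0; have z0 : 0 < sqn z.
  rewrite lt_def sqn_ge0 andbT; apply: contra zN0 => /eqP/sqn_eq0 ->.
  by rewrite eqxx.
exists (Num.sqrt (sqn z))^-1; split.
- by rewrite invr_gt0 sqrtr_gt0.
- by apply: sC => //; rewrite invr_ge0 sqrtr_ge0.
- by rewrite sqnZ exprVn sqr_sqrtr ?ltW// mulVf// gt_eqF.
Qed.

(** A nonzero point of the intersection, normalized to [y], lies near some x_i. The v_j reached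
    there has <v_j, G x_i> >= 1/4 but <v_j, G y> <= 0, while [bil_small] keeps the two less than 1/4
    apart. *)
Lemma reaches_trivial :
  reaches 4^-1 (bil (fun a : I * J => v a.2) (fun a => x a.1) G) ->
  K `&` preim_mx G L = [set 0].
Proof.
move=> hr; have [K0 _ sK _] := coneK; have [L0 _ sL _] := coneL.
have [xK xnet] := netx; have [vL vnet] := netv.
apply/seteqP; split => [z [Kz Lz]|_ ->]; last first.
  by split; rewrite /preim_mx //= mulmx0.
apply/eqP; apply/negP => /negP zN0.
have [a [a0 Ky y1]] := normalize sK Kz zN0; set y := a *: z in Ky y1.
have [i xi] := xnet _ Ky y1.
have /existsP[j] := forallP hr i; rewrite ffunE /= => hij.
have [vj v1] := vL j.
have := bil_small v1 Grho xi rhoe.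
have Ly : L (G *m y) by rewrite /y -scalemxAr; apply: sL => //; exact: ltW.
have := vj _ Ly; rewrite mulmxBr dotBr => h1.
by rewrite ltr_norml; lra.
Qed.

(** With the sign of [x] reversed, each v_j has some x_i with <v_j, G x_i> <= -1/4. By the mesh, no
    nonzero polar vector is then nonnegative on the image of [K]; if the intersection were trivial
    too, [stat_dim_transversal] would contradict the gap. *)
Lemma reaches_nontrivial (dK dL : RR) :
  stat_dim K = dK%:E -> stat_dim L = dL%:E -> m%:R - dL < dK ->
  reaches 4^-1 (bil (fun a : J * I => v a.1) (fun a => - x a.2) G) ->
  K `&` preim_mx G L <> [set 0].
Proof.
move=> dKE dLE gap hr; have [K0 _ sK _] := coneK; have [L0 _ sL _] := coneL.
have [xK xnet] := netx; have [vL vnet] := netv.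
move=> triv.
have trivKL z : K z -> L (G *m z) -> z = 0.
  move=> Kz Lz; have : (K `&` preim_mx G L) z by split.
  by rewrite triv.
have trivP z : polar L z -> (forall y, K y -> 0 <= dot z (G *m y)) -> z = 0.
  move=> Pz hz; apply/eqP; apply/negP => /negP zN0.
  have [a [a0 Pw w1]] := normalize (@polarZ _ _ L) Pz zN0; set w := a *: z in Pw w1.
  have [j wj] := vnet _ Pw w1.
  have /existsP[i] := forallP hr j; rewrite ffunE /= mulmxN dotNr => hij.
  have [Kx x1] := xK i.
  have vw : dot (v j - w) (v j - w) <= e ^+ 2.
    by rewrite -opprB dotNl dotNr opprK -sqnE.
  have h1 : 0 <= dot w (G *m x i) by rewrite /w dotZl mulr_ge0 ?hz// ltW.
  have := dot_CS (w - v j) (G *m x i) => h2.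
  have h3 : dot (w - v j) (G *m x i) ^+ 2 <= rho * e ^+ 2.
    apply: le_trans h2 _; rewrite mulrC; apply: ler_pM; rewrite ?sqn_ge0//.
    apply: le_trans (fnorm2_mul _ _) _; rewrite x1 mulr1//.
  have h4 : 4^-1 <= dot (w - v j) (G *m x i) by rewrite dotBl; lra.
  by have := le_lt_trans h3 rhoe; rewrite expr2; nra.
have [dK' [dL' [e1 e2 le]]] := stat_dim_transversal coneK coneL trivKL trivP.
move: e1 e2; rewrite dKE dLE => -[e1] [e2].
by move: gap; rewrite e1 e2; lra.
Qed.

End dichotomy.

Theorem theorem1p5 :
  exists C : RR, 0 < C /\
  forall (n m : nat) (K : set 'cV[RR]_n) (L : set 'cV[RR]_m),
    closed_convex_cone K -> nontrivial K ->
    closed_convex_cone L -> nontrivial L ->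
    forall t : RR, 1 <= t ->
      (Num.sqrt (fine (stat_dim K)) - Num.sqrt (m%:R - fine (stat_dim L))
         <= - (C * Num.sqrt t) ->
       ((1 - expR (- t))%:E <=
          gauss_mx_prob [set G | K `&` preim_mx G L = [set 0%R]])%E) /\
      (C * Num.sqrt t <=
         Num.sqrt (fine (stat_dim K)) - Num.sqrt (m%:R - fine (stat_dim L)) ->
       ((1 - expR (- t))%:E <=
          gauss_mx_prob [set G | K `&` preim_mx G L <> [set 0%R]])%E).
Proof.
exists 19; split => // n m K L cK _ cL _ t t1.
pose rho : RR := 2 * (m * n)%:R * expR t + 1.
have rho1 : 1 <= rho by rewrite lerDr !mulr_ge0// expR_ge0.
(* Serves two needs: [rho * e ^+ 2 < 16^-1], which moves bilinear forms by less than 1/4, and mesh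
   errors [3 * e * n] and [3 * e * m] of at most 1 in the statistical dimensions. *)
pose e : RR := (16 * rho * (m + n).+1%:R)^-1.
have mn1 : 1 <= (m + n).+1%:R :> RR by rewrite ler1n.
have den : 16 <= 16 * rho * (m + n).+1%:R :> RR by nra.
have e0 : 0 < e by rewrite invr_gt0; lra.
have rE : 16 * rho * (m + n).+1%:R * e = 1 by rewrite divff// gt_eqF//; lra.
have e1 : 16 * e <= 1 by have := ler_wpM2r (ltW e0) den; rewrite rE.
have re0 : 0 <= 16 * rho * e by rewrite !mulr_ge0//; lra.
have e01 : 0 <= e <= 1 by apply/andP; split; lra.
have rhoe : rho * e ^+ 2 < 16^-1.
  have h : rho * e * 16 <= 1 by have := ler_wpM2l re0 mn1; lra.
  by rewrite expr2 mulrA; nra.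
have small (k : nat) : (k <= m + n)%N -> 3 * e * k%:R <= 1.
  move=> kmn; have k1 : k%:R <= (m + n).+1%:R :> RR by rewrite ler_nat leqW.
  have e3 : 3 * e <= 16 * rho * e by rewrite ler_wpM2r ?(ltW e0)//; lra.
  have e30 : 0 <= 3 * e by rewrite mulr_ge0// ltW.
  by have := ler_pM e30 (ler0n _ _) e3 k1; rewrite (mulrAC (16 * rho) e) rE.
have clK : closed K by have [] := cK.
have [NI [x netx]] := unit_net_exists clK e0.
have [NJ [v netv]] := unit_net_exists (@polar_closed _ _ L) e0.
have x1 i : sqn (x i) = 1 by have [] := netx.1 i.
have v1 j : sqn (v j) = 1 by have [] := netv.1 j.
have [Sx Sx0 SxE] := gsm_wd_fin x1.
have [Sv Sv0 SvE] := gsm_wd_fin v1.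
have [dK dKE /andP[dKl dKu]] := stat_dim_net cK e01 netx SxE.
have [dL dLE /andP[dLl dLu]] := stat_dim_polar_net cL e01 netv SvE.
rewrite dKE dLE /= !gauss_mx_probE.
have t0 : 1 <= Num.sqrt t by rewrite -[leLHS]sqrtr1; apply: ler_wsqrtr.
split => gap.
  apply: (@escape_prob _ m n n m _ _ x v
    (bil (fun a : 'I_NI * 'I_NJ => v a.2) (fun a => x a.1)) Sx Sv) => //.
  - by move=> a b; rewrite gcov_bil mulrC.
  - have h1 : Num.sqrt Sx <= Num.sqrt dK by apply: ler_wsqrtr.
    have h2 := sqrt_le_D1 Sv0 dLu (small m (leq_addr _ _)).
    lra.
  - move=> G hr Gr; exact: (reaches_trivial cK cL netx netv rhoe Gr hr).
apply: (@escape_prob _ m n m n _ _ v x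
    (bil (fun a : 'I_NJ * 'I_NI => v a.1) (fun a => - x a.2)) Sv Sx) => //.
- by move=> a b; rewrite gcov_bil dotNl dotNr opprK.
- have h1 : Num.sqrt Sv <= Num.sqrt (m%:R - dL) by apply: ler_wsqrtr.
  have h2 := sqrt_le_D1 Sx0 dKu (small n (leq_addl _ _)).
  lra.
move=> G hr Gr; apply: (reaches_nontrivial cK cL netx netv rhoe Gr dKE dLE _ hr).
(* Were dK at most m - dL, the difference of square roots would be nonpositive, against a gap of at
   least 19. *)
rewrite ltNge; apply/negP => /ler_wsqrtr; lra.
Qed.
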